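(* Let $\tilde\nu$ be a positive regular Borel measure on $[0,\infty)$ with $\sup_{t>0}\frac{\tilde\nu[0,2t)}{\tilde\nu[0,t)}<\infty$, let $\nu=\tilde\nu\otimes\lambda$ on $\overline{\mathbb C_+}=[0,\infty)\times\mathbb R$ (so that the associated space $A^2_\nu$ is a Zen space), let $w:(0,\infty)\to\mathbb R_+$ be given by $w(t)=2\pi\int_0^\infty e^{-2rt}\,d\tilde\nu(r)$ for $t>0$, and let $\mu$ be a positive regular Borel measure on $\mathbb C_+$. Then the following are equivalent: 1. The Laplace transform $\mathcal L$ given by $\mathcal Lf(z)=\int_0^\infty e^{-tz}f(t)\,dt$ defines a bounded linear map $\mathcal L:L^2_w(0,\infty)\to L^2(\mathbb C_+,\mu)$. 2. For a sufficiently large $N\in\mathbb N$, there exists a constant $C>0$ such that $$\int_{\mathbb C_+}\big|\big(\mathcal L(t^{N-1}e^{-\lambda t})\big)(z)\big|^2\,d\mu(z)\le C\int_0^\infty|t^{N-1}e^{-\lambda t}|^2w(t)\,dt\quad\text{for each }\lambda\in\mathbb C_+ .$$ 3. There exists a constant $C>0$ such that $\mu(Q_I)\le C\,\nu(Q_I)$ for each Carleson square $Q_I$.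
   Context: $\mathbb C_+=\{z\in\mathbb C:\operatorname{Re}z>0\}$; $\lambda$ in $\tilde\nu\otimes\lambda$ denotes Lebesgue measure on $\mathbb R$, and $x+iy$ is identified with $(x,y)$. The Zen space $A^2_\nu$ consists of the analytic $f:\mathbb C_+\to\mathbb C$ with $\sup_{\varepsilon>0}\int_{\overline{\mathbb C_+}}|f(z+\varepsilon)|^2\,d\nu(z)<\infty$. $L^2_w(0,\infty)$ has norm $\big(\int_0^\infty|f(t)|^2w(t)\,dt\big)^{1/2}$, and the integral defining $w$ is over $[0,\infty)$. For a bounded interval $I\subset i\mathbb R$ of length $|I|$, the Carleson square is $Q_I=\{x+iy:iy\in I,\ 0\le x<|I|\}$, so $\nu(Q_I)=|I|\,\tilde\nu([0,|I|))$. *)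

(* Defs.v *)
From HB Require Import structures.
From mathcomp Require Import all_boot all_order all_algebra.
From mathcomp Require Import all_classical all_reals all_analysis.
From mathcomp Require Import complex.

Set Implicit Arguments.
Unset Strict Implicit.
Unset Printing Implicit Defensive.

Import Order.TTheory GRing.Theory Num.Theory.
Import numFieldNormedType.Exports.

Local Open Scope classical_set_scope.
Local Open Scope complex_scope.
Local Open Scope ring_scope.

(* A Borel measure on a subspace X of T is represented by the measure on T that
   extends it by 0.  Regularity is relative to X: the open subsets of X are the
   traces V `&` X.  (Regularity of the extension on T would be a different
   condition, e.g. for dx dy / x^2 on the right half-plane.) *)
Definition regular_borel_on {R : realType} {T : topologicalType}
    (X : set T) (mu : set T -> \bar R) : Prop :=
  mu (~` X) = 0%E /\
  forall E : set T, <<s open >> E -> E `<=` X ->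
    mu E = ereal_inf [set mu (V `&` X) | V in [set V | open V /\ E `<=` V]] /\
    mu E = ereal_sup [set mu K | K in [set K | compact K /\ K `<=` E]].

(* The bounds 0 < nut [0, t) < +oo are what gives the quotients a meaning. *)
Definition doubling {R : realType}
    (nut : {measure set (measurableTypeR R) -> \bar R}) : Prop :=
  (forall t : R, 0 < t -> (0 < nut `[0%R, t[%classic < +oo)%E) /\
  exists K : R, forall t : R, 0 < t ->
    (nut `[0%R, (2 * t)%R[%classic <= K%:E * nut `[0%R, t[%classic)%E.

(* Points x + iy of the complex plane are pairs (x, y). *)
Definition half_plane {R : realType} : set (measurableTypeR R * measurableTypeR R) :=
  [set p | 0 < p.1].

Definition cplx {R : realType} (p : R * R) : R[i] := p.1 +i* p.2.

Definition cexp {R : realType} (z : R[i]) : R[i] :=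
  expR (complex.Re z) * cos (complex.Im z) +i*
  (expR (complex.Re z) * sin (complex.Im z)).

Definition abs2 {R : realType} (z : R[i]) : R := Normc.normc z ^+ 2.

Section ComplexIntegral.
Context {d : measure_display} {T : measurableType d} {R : realType}.
Implicit Types (mu : {measure set T -> \bar R}) (D : set T) (f : T -> R[i]).

Definition cmeasurable D f : Prop :=
  measurable_fun D (fun x => complex.Re (f x)) /\
  measurable_fun D (fun x => complex.Im (f x)).

Definition cintegrable mu D f : Prop :=
  mu.-integrable D (fun x => (complex.Re (f x))%:E) /\
  mu.-integrable D (fun x => (complex.Im (f x))%:E).

Definition cintegral mu D f : R[i] :=
  Rintegral mu D (fun x => complex.Re (f x)) +i*
  Rintegral mu D (fun x => complex.Im (f x)).

(* The weight v may be extended-real-valued; v = 1 for an unweighted L^2. *)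
Definition L2norm mu D (v : T -> \bar R) f : \bar R :=
  poweR (\int[mu]_(x in D) ((abs2 (f x))%:E * v x))%E (2^-1)%R.

Definition inL2 mu D (v : T -> \bar R) f : Prop :=
  cmeasurable D f /\ (L2norm mu D v f < +oo)%E.

End ComplexIntegral.

Definition laplace_integrand {R : realType} (f : measurableTypeR R -> R[i])
    (z : R[i]) : measurableTypeR R -> R[i] :=
  fun t => cexp (- (t%:C * z)) * f t.

Definition laplace {R : realType} (f : measurableTypeR R -> R[i]) (z : R[i]) : R[i] :=
  cintegral (@lebesgue_measure R) `]0%R, +oo[%classic (laplace_integrand f z).

Definition zen_weight {R : realType}
    (nut : {measure set (measurableTypeR R) -> \bar R}) (t : R) : \bar R :=
  ((2 * pi)%:E * \int[nut]_(r in `[0%R, +oo[) (expR (- (2 * r * t)))%:E)%E.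

Section Conditions.
Context {R : realType}.
Variable nut : {measure set (measurableTypeR R) -> \bar R}.
Variable mu : {measure set (measurableTypeR R * measurableTypeR R) -> \bar R}.

Let Lw : (measurableTypeR R -> R[i]) -> Prop :=
  inL2 (@lebesgue_measure R) `]0%R, +oo[%classic (zen_weight nut).
Let normw : (measurableTypeR R -> R[i]) -> \bar R :=
  L2norm (@lebesgue_measure R) `]0%R, +oo[%classic (zen_weight nut).
Let Lap (f : measurableTypeR R -> R[i])
  : measurableTypeR R * measurableTypeR R -> R[i] := fun p => laplace f (cplx p).

(* Linearity and boundedness also make the map well defined on classes modulo
   equality almost everywhere. *)
Definition laplace_bounded : Prop :=
  [/\ forall f, Lw f -> forall p, half_plane p ->
        cintegrable (@lebesgue_measure R) `]0%R, +oo[%classic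
          (laplace_integrand f (cplx p)),
      forall f, Lw f -> inL2 mu half_plane (cst 1%E) (Lap f),
      forall (a : R[i]) f g, Lw f -> Lw g -> forall p, half_plane p ->
        Lap (fun t => a * f t + g t) p = a * Lap f p + Lap g p
    & exists2 C : R, 0 < C & forall f, Lw f ->
        (L2norm mu half_plane (cst 1%E) (Lap f) <= C%:E * normw f)%E].

Definition laplace_test_fun (N : nat) (lambda : R[i])
    : measurableTypeR R -> R[i] :=
  fun t => (t%:C) ^+ N.-1 * cexp (- (lambda * t%:C)).

Definition laplace_tested (N : nat) : Prop :=
  exists2 C : R, 0 < C & forall lambda : R[i], 0 < complex.Re lambda ->
    (\int[mu]_(p in half_plane)
       (abs2 (laplace (laplace_test_fun N lambda) (cplx p)))%:E
     <= C%:E * \int[@lebesgue_measure R]_(t in `]0%R, +oo[)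
          ((abs2 (laplace_test_fun N lambda t))%:E * zen_weight nut t))%E.

End Conditions.

Definition carleson_square {R : realType} (I : set R)
    : set (measurableTypeR R * measurableTypeR R) :=
  [set p | I p.2 /\ (0 <= p.1 /\ (p.1%:E < lebesgue_measure I)%E)].

Definition carleson_condition {R : realType}
    (nu mu : set (measurableTypeR R * measurableTypeR R) -> \bar R) : Prop :=
  exists2 C : R, 0 < C & forall I : set R, is_interval I -> bounded_set I ->
    (mu (carleson_square I) <= C%:E * nu (carleson_square I))%E.

(* Main.v *)
From HB Require Import structures.
Require Import Defs.
From mathcomp Require Import all_boot all_order all_algebra.
From mathcomp Require Import all_classical all_reals all_analysis.
From mathcomp Require Import measurable_realfun.
From mathcomp Require Import complex ring lra.

(** The proof goes round the circle: boundedness implies the test inequality,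
    which implies the Carleson condition, which implies boundedness. Throughout,
    V(x) is the mass of [0, x) for the measure on the half-line; it is doubling,
    V(2 x) <= K V(x), and a Carleson square of side L has measure L V(L).

    The first implication is an evaluation at the test functions. For the second
    one, let I have length L and contain y0, and take lambda = 2 N L - i y0. On the
    square over I the transform (N-1)! / (z + lambda)^N of the test function is
    comparable to L^-N (Re_laplace_test_ge). Its energy is a negative moment of
    order 2 N - 1 of the measure on the half-line (test_fun_energy_le), and a
    dyadic decomposition bounds this moment by a multiple of V(L) / L^(2 N - 1) as
    soon as K <= 2^(2 N - 2) (integral_inv_pow_le). This is what N sufficiently
    large means: the bound depends on K only, hence not on mu.

    The third implication is a Carleson embedding theorem. The real and imaginary
    parts of the Laplace transform are sums of damped waves
    U(x,y) = int exp(-x t) cos(t y - c) f(t) dt, which are harmonic. By the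
    inequality half of Plancherel's theorem on vertical lines (wave_plancherel_le),
    the integral of U^2 for nut \x lebesgue is at most the weighted energy of f
    (damped_wave_energy_le). It remains to bound the integral of U^2 for mu by that
    for nut \x lebesgue. Maximal functions and interpolation are avoided by a
    duality argument in the style of Vinogradov and Senichkin. The Poisson formula
    on the lines of abscissa r < x / 2, averaged in r, bounds |U(z)| by an integral
    of |U| against a positive kernel k (damped_wave_poisson_le, avg_kernel). Let T
    be the operator with kernel k. The kernel of T T* is dominated by
    a(z,z') = p(x + x', y - y') / V(max(x,x') / 2), where p is the Poisson kernel
    (avg_kernel_avg_kernel). The elementary inequality
    p(x,s) p(x',t) <= p(x + x', s - t) (p(x,s) + p(x',t)) (pker_pker_le) together
    with the Carleson condition shows that the kernel a, restricted to points w
    below z and below z', reproduces itself when it is integrated twice for mu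
    (low_kernel_low_kernel). This self-improvement bounds the quadratic form of a at
    g = |U| by a multiple of the integral of g^2 for mu, and hence the latter by the
    integral of U^2 for nut \x lebesgue (TTstar_test). *)

Set Implicit Arguments.
Unset Strict Implicit.
Unset Printing Implicit Defensive.

Import Order.TTheory GRing.Theory Num.Theory.
Import numFieldNormedType.Exports.

Local Open Scope classical_set_scope.
Local Open Scope ring_scope.

(** * Exchanging and evaluating integrals *)

Section BoundedKernel.
Context d1 d2 (S : measurableType d1) (T : measurableType d2) (R : realType).
Variables (m : {sigma_finite_measure set S -> \bar R})
  (n : {sigma_finite_measure set T -> \bar R}).

Lemma integrable_bounded_mul d' (U : measurableType d')
    (l : {measure set U -> \bar R}) (b f : U -> R) :
  measurable_fun setT b -> (forall x, `|b x| <= 1) ->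
  l.-integrable setT (EFin \o f) ->
  l.-integrable setT (EFin \o (fun x => b x * f x)).
Proof.
move=> mb b1 If; apply: (le_integrable measurableT _ _ If).
- apply/measurable_EFinP; apply: measurable_funM => //.
  by apply/measurable_EFinP; exact: measurable_int If.
- move=> x _ /=; rewrite lee_fin normrM -[leRHS]mul1r ler_pM//.
Qed.

Lemma integrable_bounded_mulM (M : R) d' (U : measurableType d')
    (l : {measure set U -> \bar R}) (b f : U -> R) :
  measurable_fun setT b -> (forall x, `|b x| <= M) ->
  l.-integrable setT (EFin \o f) ->
  l.-integrable setT (EFin \o (fun x => b x * f x)).
Proof.
move=> mb bM If; apply: (le_integrable measurableT _ _ (integrableZl measurableT M If)).
- apply/measurable_EFinP; apply: measurable_funM => //.
  by apply/measurable_EFinP; exact: measurable_int If.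
- move=> x _ /=; rewrite lee_fin !normrM ler_wpM2r// (le_trans (bM x))//.
  exact: ler_norm.
Qed.

(** Boundedness of k makes k(x,t) g(x) f(t) integrable for the product measure, so
    that Fubini applies to kernels that are not themselves integrable. All
    exchanges of signed integrals go through this one lemma. *)
Lemma Rintegral_swap (k : S * T -> R) (g : S -> R) (f : T -> R) :
  measurable_fun setT k -> (forall p, `|k p| <= 1) ->
  m.-integrable setT (EFin \o g) -> n.-integrable setT (EFin \o f) ->
  \int[m]_x (g x * \int[n]_t (k (x, t) * f t)) =
  \int[n]_t (f t * \int[m]_x (k (x, t) * g x)).
Proof.
move=> mk k1 Ig If.
have mg : measurable_fun setT g by apply/measurable_EFinP; exact: measurable_int Ig.
have mf : measurable_fun setT f by apply/measurable_EFinP; exact: measurable_int If.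
pose F (p : S * T) := (k p * (g p.1 * f p.2))%:E.
have mF : measurable_fun setT F.
  apply/measurable_EFinP; apply: measurable_funM => //.
  by apply: measurable_funM; exact: measurableT_comp.
have Ikf x : n.-integrable setT (EFin \o (fun t => k (x, t) * f t)).
  by apply: integrable_bounded_mul => //; exact: measurableT_comp.
have Ikg t : m.-integrable setT (EFin \o (fun x => k (x, t) * g x)).
  by apply: integrable_bounded_mul => //; exact: measurableT_comp.
have mf' : measurable_fun setT (fun x => `|f x|%:E).
  exact/measurable_EFinP/measurableT_comp.
have mg' : measurable_fun setT (fun x => `|g x|%:E).
  exact/measurable_EFinP/measurableT_comp.
have IF : (m \x n)%E.-integrable setT F.
  apply/(integrable12ltyP _ _ mF).
  apply: (@le_lt_trans _ _ (\int[m]_x \int[n]_t (`|g x|%:E * `|f t|%:E))%E).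
    apply: ge0_le_integral => //.
    - by move=> x _; exact: integral_ge0.
    - apply: (measurable_fun_fubini_tonelli_F (fun p => `|F p|%E)) => //.
      exact: measurableT_comp.
    - apply: (measurable_fun_fubini_tonelli_F
        (fun p : S * T => (`|g p.1|%:E * `|f p.2|%:E)%E)).
        by apply: emeasurable_funM; [exact: (measurableT_comp mg')|
                                     exact: (measurableT_comp mf')].
      by move=> p; rewrite mule_ge0 ?lee_fin.
    - move=> x _; apply: ge0_le_integral => //.
      + apply: measurableT_comp => //.
        exact: (measurableT_comp mF (measurable_pair1 x)).
      + exact: measurable_funeM.
      + move=> t _; rewrite /F -EFinM abse_EFin lee_fin !normrM.
        by rewrite -[leRHS]mul1r ler_wpM2r// mulr_ge0.
  under eq_integral do rewrite ge0_integralZl ?lee_fin//.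
  rewrite ge0_integralZr// ?integral_ge0//; last first.
  case/integrableP : Ig => _ Ig; case/integrableP : If => _ If.
  by apply: lte_mul_pinfty => //; rewrite ?ge0_fin_numE ?integral_ge0.
transitivity (fine (\int[m]_x \int[n]_t F (x, t))%E).
  congr fine; apply: eq_integral => x _.
  rewrite -[in LHS](RintegralZl (g x) measurableT (Ikf x)).
  rewrite /Rintegral fineK.
    by apply: eq_integral => t _; rewrite /F mulrCA.
  apply: integrable_fin_num => //; have /= := integrableZl measurableT (g x) (Ikf x).
  by apply: eq_integrable.
rewrite Fubini//.
congr fine; apply: eq_integral => t _.
rewrite -[in RHS](RintegralZl (f t) measurableT (Ikg t)).
rewrite /Rintegral fineK.
  by apply: eq_integral => x _; congr EFin => /=; ring.
apply: integrable_fin_num => //; have /= := integrableZl measurableT (f t) (Ikg t).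
by apply: eq_integrable.
Qed.

End BoundedKernel.

Section HalfLine.
Context {R : realType}.
Local Notation mu := (@lebesgue_measure R).

Lemma ge0_integral_halves (f : R -> \bar R) :
  measurable_fun setT f -> (forall x, 0 <= f x)%E ->
  (\int[mu]_x f x = \int[mu]_(x in `[0%R, +oo[) f x +
                    \int[mu]_(x in `[0%R, +oo[) f (- x)%R)%E.
Proof.
move=> mf f0.
have mfN : measurable_fun setT (f \o -%R).
  by apply: measurableT_comp => //; exact: oppr_measurable.
have -> : (\int[mu]_(x in `[0%R, +oo[) f (- x)%R =
           \int[mu]_(x in `]-oo, 0%R]) f x)%E.
  rewrite (ge0_integration_by_substitution0 mfN) => [|r]; last exact: f0.
  by apply: eq_integral => x _ /=; rewrite opprK.
have -> : (\int[mu]_(x in `]-oo, 0%R]) f x = \int[mu]_(x in `]-oo, 0%R[) f x)%E.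
  by rewrite integral_itv_bndo_bndc//; exact: measurable_funTS.
rewrite -ge0_integral_setU//=.
- by rewrite -setCitvr setUv.
- exact: measurable_funTS.
- by rewrite -setCitvr; exact/disj_setPCl.
Qed.

Lemma ge0_integral_antiderivative (f F : R -> R) (l : R) :
  (forall x, 0 <= x -> 0 <= f x) -> continuous f ->
  (forall x : R, is_derive x 1 F (f x)) -> F x @[x --> +oo] --> l ->
  (\int[mu]_(x in `[0%R, +oo[) (f x)%:E = (l - F 0)%:E)%E.
Proof.
move=> f0 cf dF Fl; rewrite EFinB; apply: ge0_continuous_FTC2y => //.
- exact: continuous_subspaceT.
- by apply: cvg_at_right_filter; apply: differentiable_continuous;
    apply/derivable1_diffP.
- by move=> x _; rewrite derive1E derive_val.
Qed.

End HalfLine.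

Section DampedCosine.
Context {R : realType}.
Local Notation mu := (@lebesgue_measure R).

(** The Poisson kernel of the right half-plane, up to the factor 1/pi. *)
Definition pker (a u : R) : R := a / (a ^+ 2 + u ^+ 2).

Lemma cvg_expR_mulN (e : R) : 0 < e -> expR (- (e * x)) @[x --> +oo] --> (0 : R).
Proof.
move=> e0; apply: (cvg_comp _ _ _ (@cvgr_expR R)).
by apply: gt0_cvgMry => //; exact: cvg_id.
Qed.

Lemma cvg_expR_harmonic (s : R) :
  expR (- (n.+1%:R^-1 * s)) @[n --> \oo] --> (1 : R).
Proof.
rewrite [X in _ --> X](_ : 1 = expR (- (0 * s))); last by rewrite mul0r oppr0 expR0.
apply: continuous_cvg; first exact: continuous_expR.
by apply: cvgN; apply: cvgMl; exact: cvg_harmonic.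
Qed.

Lemma bounded_mul_cvg0 (F : set_system R) {FF : Filter F} (M : R) (f g : R -> R) :
  (forall x, `|g x| <= M) -> f x @[x --> F] --> (0 : R) ->
  f x * g x @[x --> F] --> (0 : R).
Proof.
move=> gM f0; apply/cvgr0Pnorm_lt => eps eps0.
have M0 : 0 <= M by apply: le_trans (gM 0).
have : 0 < eps / (M + 1) by rewrite divr_gt0// ltr_pwDr.
move/cvgr0Pnorm_lt : f0 => /[apply]; apply: filterS => x.
rewrite ltr_pdivlMr ?ltr_pwDr// => /(le_lt_trans _); apply.
by rewrite normrM ler_wpM2l// (le_trans (gM _))// lerDl.
Qed.

(** The summand 1 makes the integrand nonnegative; the antiderivative then gives
    the integral in the extended reals without a prior proof of integrability. *)
Lemma integral_expR_cos (e th b : R) : 0 < e ->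
  (\int[mu]_(u in `[0%R, +oo[) (expR (- (e * u)) * (1 + cos (th * u + b)))%:E
   = (e^-1 + (e * cos b - th * sin b) / (e ^+ 2 + th ^+ 2))%:E)%E.
Proof.
move=> e0.
have d0 : 0 < e ^+ 2 + th ^+ 2 by rewrite ltr_wpDr ?sqr_ge0// exprn_gt0.
pose G u := (th * sin (th * u + b) - e * cos (th * u + b)) / (e ^+ 2 + th ^+ 2) - e^-1.
have dF (x : R) : is_derive x 1 (fun u => expR (- (e * u)) * G u)
    (expR (- (e * x)) * (1 + cos (th * x + b))).
  rewrite /G; apply: is_derive_eq.
  by rewrite /GRing.scale /=; field; rewrite !gt_eqF.
have Fl : expR (- (e * u)) * G u @[u --> +oo] --> 0.
  apply: (bounded_mul_cvg0 (M := (`|th| + e) / (e ^+ 2 + th ^+ 2) + e^-1)); last exact: cvg_expR_mulN.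
  move=> x; rewrite /G (le_trans (ler_normB _ _))// lerD//; last first.
    by rewrite gtr0_norm ?invr_gt0.
  rewrite normrM [X in _ * X]gtr0_norm ?invr_gt0// ler_wpM2r ?invr_ge0 ?(ltW d0)//.
  rewrite (le_trans (ler_normB _ _))// lerD// normrM.
    by rewrite -[leRHS]mulr1 ler_wpM2l// ler_norml sin_geN1 sin_le1.
  by rewrite (gtr0_norm e0) -[leRHS]mulr1 ler_wpM2l ?(ltW e0)// ler_norml cos_geN1 cos_le1.
rewrite (ge0_integral_antiderivative _ _ dF Fl).
- congr EFin; rewrite /G !mulr0 oppr0 expR0 !add0r; ring.
- by move=> x _; rewrite mulr_ge0 ?expR_ge0// -lerBlDl sub0r cos_geN1.
- move=> x; apply: cvgM.
    apply: continuous_comp; last exact: continuous_expR.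
    by apply: cvgN; apply: cvgM; [exact: cvg_cst|exact: cvg_id].
  apply: cvgD; first exact: cvg_cst.
  apply: continuous_comp; last exact: continuous_cos.
  by apply: cvgD; [apply: cvgM; [exact: cvg_cst|exact: cvg_id]|exact: cvg_cst].
Qed.

Lemma measurable_expR_abs (e : R) :
  measurable_fun setT (fun u : R => expR (- (e * `|u|))).
Proof.
apply: measurableT_comp; first exact: measurable_expR.
by apply: measurableT_comp => //; apply: measurable_funM => //; exact: measurableT_comp.
Qed.

Lemma measurable_cos_affine (th b : R) :
  measurable_fun setT (fun u : R => cos (th * u + b)).
Proof.
apply: (measurableT_comp (continuous_measurable_fun (@continuous_cos R))).
by apply: measurable_funD => //; exact: measurable_funM.
Qed.

Let integral_expR_abs_1Dcos (e th b : R) : 0 < e ->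
  (\int[mu]_u (expR (- (e * `|u|)) * (1 + cos (th * u + b)))%:E
   = (2 / e + 2 * pker e th * cos b)%:E)%E.
Proof.
move=> e0.
have cos1 x : 0 <= 1 + cos x :> R by rewrite -lerBlDl sub0r cos_geN1.
rewrite ge0_integral_halves; last 2 first.
- apply/measurable_EFinP; apply: measurable_funM.
    exact: measurable_expR_abs.
  by apply: measurable_funD => //; exact: measurable_cos_affine.
- by move=> x; rewrite lee_fin mulr_ge0 ?expR_ge0.
transitivity ((\int[mu]_(u in `[0%R, +oo[) (expR (- (e * u)) * (1 + cos (th * u + b)))%:E +
  \int[mu]_(u in `[0%R, +oo[) (expR (- (e * u)) * (1 + cos (- th * u + b)))%:E)%E).
  congr (_ + _)%E; apply: eq_integral => x; rewrite inE/= in_itv/= andbT => x0.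
    by rewrite ger0_norm.
  by rewrite normrN ger0_norm// mulrN mulNr.
rewrite !integral_expR_cos// -EFinD; congr EFin; rewrite /pker sqrrN; ring.
Qed.

Lemma integral_expR_abs (e : R) : 0 < e ->
  (\int[mu]_u (expR (- (e * `|u|)))%:E = (2 / e)%:E)%E.
Proof.
move=> e0; have := integral_expR_abs_1Dcos 0 (pi / 2) e0.
rewrite cos_pihalf mulr0 addr0 => <-.
by apply: eq_integral => u _; rewrite mul0r add0r cos_pihalf addr0 mulr1.
Qed.

Lemma integrable_expR_abs (e : R) : 0 < e ->
  mu.-integrable setT (EFin \o (fun u => expR (- (e * `|u|)))).
Proof.
move=> e0; apply/integrableP; split.
  by apply/measurable_EFinP; exact: measurable_expR_abs.
under eq_integral do rewrite /= ger0_norm ?expR_ge0//.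
by rewrite integral_expR_abs// ltry.
Qed.

(** The cosine transform of exp(-e|u|) is the Poisson kernel: this is where the
    kernel enters. *)
Lemma Rintegral_expR_abs_cos (e th b : R) : 0 < e ->
  \int[mu]_u (cos (th * u + b) * expR (- (e * `|u|))) = 2 * pker e th * cos b.
Proof.
move=> e0.
have Ie := integrable_expR_abs e0.
have Ic : mu.-integrable setT
    (EFin \o (fun u => cos (th * u + b) * expR (- (e * `|u|)))).
  apply: integrable_bounded_mul => //; first exact: measurable_cos_affine.
  by move=> x; exact: cos_max.
have /= := integralD_EFin measurableT Ie Ic.
have -> : (\int[mu]_u (expR (- (e * `|u|)) + cos (th * u + b) * expR (- (e * `|u|)))%:E
    = (2 / e + 2 * pker e th * cos b)%:E)%E.
  rewrite -(integral_expR_abs_1Dcos th b e0).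
  by apply: eq_integral => u _; rewrite mulrDr mulr1 [cos _ * _]mulrC.
rewrite (integral_expR_abs e0) /Rintegral.
move/(integrable_fin_num measurableT)/fineK : Ic => /= <-.
by rewrite -EFinD => -[/addrI].
Qed.

End DampedCosine.

(** * The Poisson integral of a damped cosine *)

Lemma Rintegral_dominated_cvg d (T : measurableType d) (R : realType)
    (m : {measure set T -> \bar R}) (D : set T) (f_ : (T -> R)^nat)
    (f g : T -> R) :
  measurable D -> (forall n, measurable_fun D (f_ n)) ->
  (forall x, D x -> f_ n x @[n --> \oo] --> f x) ->
  m.-integrable D (EFin \o g) ->
  (forall n x, D x -> `|f_ n x| <= g x) ->
  \int[m]_(x in D) f_ n x @[n --> \oo] --> \int[m]_(x in D) f x.
Proof.
move=> mD mf_ cf Ig fg.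
have mf_' n : measurable_fun D (EFin \o f_ n) by exact/measurable_EFinP.
have cf' x : D x -> (EFin \o f_ n) x @[n --> \oo] --> (EFin \o f) x.
  by move=> Dx; apply: cvg_EFin; [exact: nearW|exact: cf].
have fg' n x : D x -> (`|(EFin \o f_ n) x| <= (EFin \o g) x)%E.
  by move=> Dx; rewrite /= lee_fin; exact: fg.
have mf : measurable_fun D (EFin \o f) by exact: emeasurable_fun_cvg mf_' cf'.
have [If _ cvf] := dominated_convergence mD mf_' mf (aeW _ cf') Ig
  (aeW _ (fun x n => fg' n x)).
by apply: fine_cvg; rewrite fineK; last exact: (integrable_fin_num mD If).
Qed.

Lemma measurable_fun_ge0V d (T : measurableType d) (R : realType) (f : T -> R) :
  measurable_fun setT f -> (forall x, 0 <= f x) ->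
  measurable_fun setT (fun x => (f x)^-1).
Proof.
move=> mf f0; have -> : (fun x => (f x)^-1) = (@powR R ^~ (- 1)) \o f.
  by apply/funext => x /=; rewrite powR_inv1.
by apply: measurableT_comp; first exact: measurable_powR.
Qed.

Section PoissonIntegral.
Context {R : realType}.
Local Notation mu := (@lebesgue_measure R).

Lemma pker_gt0 (a u : R) : 0 < a -> 0 < pker a u.
Proof. by move=> a0; rewrite divr_gt0// ltr_wpDr ?sqr_ge0// exprn_gt0. Qed.

Lemma measurable_pker d (T : measurableType d) (x y : T -> R) :
  measurable_fun setT x -> measurable_fun setT y ->
  measurable_fun setT (fun t => pker (x t) (y t)).
Proof.
move=> mx my; apply: measurable_funM => //; apply: measurable_fun_ge0V => [|t].
  by apply: measurable_funD; exact: measurable_funX.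
by rewrite addr_ge0 ?sqr_ge0.
Qed.

Lemma continuous_pker (y a : R) : 0 < a -> continuous (fun u => pker a (y - u)).
Proof.
move=> a0 u; apply: cvgM; first exact: cvg_cst.
apply: cvgV; first by rewrite gt_eqF// ltr_wpDr ?sqr_ge0// exprn_gt0.
apply: cvgD; first exact: cvg_cst.
by apply: cvgM; apply: cvgB; [exact: cvg_cst|exact: cvg_id
                             |exact: cvg_cst|exact: cvg_id].
Qed.

Lemma integral_pker_rescale (e t : R) (G : R -> R) : 0 < e ->
  continuous G -> (forall x, 0 <= G x) ->
  (\int[mu]_s (pker e (t - s) * G s)%:E =
   \int[mu]_v ((oneDsqr v)^-1 * G (t + e * v))%:E)%E.
Proof.
move=> e0 cG G0.
have dF (x : R) : is_derive x 1 (fun v => t + e * v) e.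
  by apply: is_derive_eq; rewrite /GRing.scale /=; ring.
have dFE : derive1 (fun v : R => t + e * v) = cst e.
  by apply/funext => x; rewrite derive1E derive_val.
rewrite (@increasing_ge0_integration_by_substitutionT _ (fun v => t + e * v)).
- apply: eq_integral => v _; rewrite dFE !fctE; congr EFin.
  rewrite /pker /oneDsqr opprD addNKr; field.
  by apply/andP; split; rewrite lt0r_neq0// ltr_wpDr ?sqr_ge0 ?exprn_gt0.
- by move=> x y xy; rewrite ltrD2l ltr_pM2l.
- by rewrite dFE; exact: cst_continuous.
- by rewrite dFE; exact: is_cvg_cst.
- by rewrite dFE; exact: is_cvg_cst.
- by move=> x; exact: ex_derive.
- by apply: (cvg_comp _ _ _ (@cvg_addrl_Ny R t)); apply: gt0_cvgMrNy => //; exact: cvg_id.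
- by apply: (cvg_comp _ _ _ (@cvg_addrl R t)); apply: gt0_cvgMry => //; exact: cvg_id.
- move=> x; apply: cvgM; last exact: cG.
  exact: continuous_pker.
- by move=> x; rewrite mulr_ge0// ltW// pker_gt0.
Qed.

Let oneDsqr_ge0 (x : R) : 0 <= oneDsqr x.
Proof. exact: le_trans ler01 (oneDsqr_ge1 x). Qed.

Lemma integral_oneDsqrV : (\int[mu]_v (oneDsqr v)^-1%:E = (pi : R)%:E)%E.
Proof.
rewrite (ge0_symfun_integralT (f := fun v : R => (oneDsqr v)^-1)).
- rewrite (_ : [set x | _] = `[0, +oo[%classic); last first.
    by apply/seteqP; split => x/=; rewrite in_itv/= andbT.
  by rewrite integral0y_oneDsqr -EFinM mulrC divfK// pnatr_eq0.
- by move=> x; rewrite invr_ge0 oneDsqr_ge0.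
- exact: continuous_oneDsqrV.
- by move=> x; rewrite /= /oneDsqr sqrrN.
Qed.

Lemma integral_pker (a y : R) : 0 < a ->
  (\int[mu]_u (pker a (y - u))%:E = pi%:E)%E.
Proof.
move=> a0; rewrite -integral_oneDsqrV.
have := integral_pker_rescale y a0 (@cst_continuous R R 1) (fun=> ler01).
under eq_integral do rewrite mulr1.
by move=> ->; apply: eq_integral => v _; rewrite mulr1.
Qed.

Lemma integrable_pker (a y : R) : 0 < a ->
  mu.-integrable setT (EFin \o (fun u => pker a (y - u))).
Proof.
move=> a0; apply/integrableP; split.
  by apply/measurable_EFinP; apply: measurable_pker => //; exact: measurable_funB.
under eq_integral do rewrite /= gtr0_norm ?pker_gt0//.
by rewrite integral_pker// ltry.
Qed.

Lemma integrable_oneDsqrV :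
  mu.-integrable setT (EFin \o (fun v => (oneDsqr v)^-1)).
Proof.
apply/integrableP; split.
  apply/measurable_EFinP; apply: continuous_measurable_fun.
  exact: continuous_oneDsqrV.
under eq_integral do rewrite /= ger0_norm ?invr_ge0 ?oneDsqr_ge0//.
by rewrite integral_oneDsqrV ltry.
Qed.

Lemma Rintegral_pker_rescale (e t : R) (G : R -> R) : 0 < e ->
  continuous G -> (forall x, `|G x| <= 1) ->
  \int[mu]_s (G s * pker e (t - s)) =
  \int[mu]_v (G (t + e * v) * (oneDsqr v)^-1).
Proof.
move=> e0 cG G1.
have cG' : continuous (fun v => G (t + e * v)).
  move=> v; apply: continuous_comp; last exact: cG.
  apply: cvgD; first exact: cvg_cst.
  by apply: cvgM; [exact: cvg_cst|exact: cvg_id].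
have := integral_pker_rescale t e0 _ _ (G := fun x => 1 + G x).
have I1 := integrable_pker t e0.
have I2 : mu.-integrable setT (EFin \o (fun s => G s * pker e (t - s))).
  by apply: integrable_bounded_mul => //; exact: continuous_measurable_fun.
have I3 := integrable_oneDsqrV.
have I4 : mu.-integrable setT (EFin \o (fun v => G (t + e * v) * (oneDsqr v)^-1)).
  by apply: integrable_bounded_mul => //; exact: continuous_measurable_fun.
have -> : (\int[mu]_s (pker e (t - s) * (1 + G s))%:E =
           \int[mu]_s (pker e (t - s))%:E + \int[mu]_s (G s * pker e (t - s))%:E)%E.
  rewrite -(integralD_EFin measurableT I1 I2).
  by apply: eq_integral => s _ /=; rewrite mulrDr mulr1 [G s * _]mulrC.
have -> : (\int[mu]_v ((oneDsqr v)^-1 * (1 + G (t + e * v)))%:E =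
           \int[mu]_v (oneDsqr v)^-1%:E + \int[mu]_v (G (t + e * v) * (oneDsqr v)^-1)%:E)%E.
  rewrite -(integralD_EFin measurableT I3 I4).
  by apply: eq_integral => s _ /=; rewrite mulrDr mulr1 [G _ * _]mulrC.
rewrite (integral_pker t e0) integral_oneDsqrV => E.
rewrite /Rintegral.
have := integrable_fin_num measurableT I2.
have := integrable_fin_num measurableT I4.
move=> /= /fineK F4 /fineK F2; rewrite -F2 -F4 -!EFinD in E.
have : pi + fine (\int[mu]_s (G s * pker e (t - s))%:E)%E =
        pi + fine (\int[mu]_v (G (t + e * v) * (oneDsqr v)^-1)%:E)%E.
  apply: EFin_inj; apply: E => [x|x].
    by apply: cvgD; [exact: cvg_cst|exact: cG].
  by rewrite -lerBlDl sub0r; move: (G1 x); rewrite ler_norml => /andP[].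
by move/addrI.
Qed.

(** After the substitution s = t + e v the kernel no longer depends on e, and
    dominated convergence applies as e tends to 0. *)
Lemma pker_approximate_identity (G : R -> R) (t : R) :
  continuous G -> (forall x, `|G x| <= 1) ->
  \int[mu]_s (G s * pker n.+1%:R^-1 (t - s)) @[n --> \oo] --> pi * G t.
Proof.
move=> cG G1.
under eq_fun do rewrite Rintegral_pker_rescale//.
have -> : pi * G t = \int[mu]_v (G t * (oneDsqr v)^-1).
  rewrite (RintegralZl (G t) measurableT integrable_oneDsqrV).
  by rewrite /Rintegral integral_oneDsqrV mulrC.
have := @Rintegral_dominated_cvg _ (measurableTypeR R) R mu setT
  (fun n v => G (t + n.+1%:R^-1 * v) * (oneDsqr v)^-1)
  (fun v => G t * (oneDsqr v)^-1) (fun v => (oneDsqr v)^-1) measurableT.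
apply.
- move=> n; apply: measurable_funM.
    apply: (measurableT_comp (continuous_measurable_fun cG)).
    by apply: measurable_funD => //; exact: measurable_funM.
  exact: (continuous_measurable_fun (@continuous_oneDsqrV R)).
- move=> v _; apply: cvgMl.
  apply: (continuous_cvg _ (cG t)).
  rewrite -[X in _ --> X]addr0; apply: cvgD; first exact: cvg_cst.
  by rewrite -(mul0r v); apply: cvgMl; exact: cvg_harmonic.
- exact: integrable_oneDsqrV.
- move=> n v _; rewrite normrM -[leRHS]mul1r ler_pM//.
  by rewrite ger0_norm// invr_ge0 oneDsqr_ge0.
Qed.

(** The damped cosine exp(-a|t|) cos(t y - c) is harmonic in (a,y), hence is the
    Poisson integral of its boundary values. The proof computes the double integral
    of exp(-e|u|) exp(-a|s|) cos((y-u) s + t u - c) in both orders. Integrating in s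
    first leaves a regularised form of the left-hand side, integrating in u first
    leaves the integral of exp(-a|s|) cos(y s - c) against the approximate identity
    pker e (t - s); then e tends to 0. *)
Lemma poisson_cos (a y t c : R) : 0 < a ->
  \int[mu]_u (cos (t * u - c) * pker a (y - u)) =
  pi * (expR (- (a * `|t|)) * cos (t * y - c)).
Proof.
move=> a0.
pose G (s : R) := expR (- (a * `|s|)) * cos (y * s - c).
have ccos b d : continuous (fun u : R => cos (b * u - d)).
  move=> u; apply: continuous_comp; last exact: continuous_cos.
  apply: cvgB; last exact: cvg_cst.
  by apply: cvgM; [exact: cvg_cst|exact: cvg_id].
have cG : continuous G.
  move=> s; apply: cvgM; last exact: ccos.
  apply: continuous_comp; last exact: continuous_expR.
  by apply: cvgN; apply: cvgM; [exact: cvg_cst|exact: norm_continuous].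
have exp1 (e s : R) : 0 < e -> `|expR (- (e * `|s|))| <= 1.
  by move=> e0; rewrite ger0_norm ?expR_ge0// expR_le1 oppr_le0 mulr_ge0// ltW.
have G1 s : `|G s| <= 1.
  by rewrite normrM -[leRHS]mul1r ler_pM ?exp1 ?cos_max.
have Ip : mu.-integrable setT (EFin \o (fun u => cos (t * u - c) * pker a (y - u))).
  apply: integrable_bounded_mul => [||]; last exact: integrable_pker.
    exact: continuous_measurable_fun.
  by move=> u; exact: cos_max.
have := pker_approximate_identity (t := t) cG G1.
have -> : (fun n => \int[mu]_s (G s * pker n.+1%:R^-1 (t - s))) =
  (fun n => \int[mu]_u (expR (- (n.+1%:R^-1 * `|u|)) *
             (cos (t * u - c) * pker a (y - u)))).
  apply/funext => n; set e := n.+1%:R^-1; have e0 : 0 < e by rewrite invr_gt0.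
  have := Rintegral_swap (m := mu) (n := mu)
    (k := fun p : measurableTypeR R * measurableTypeR R =>
            cos ((y - p.1) * p.2 + (t * p.1 - c)))
    _ (fun=> cos_max _) (integrable_expR_abs e0) (integrable_expR_abs a0).
  have Ie : mu.-integrable setT (EFin \o (fun u => expR (- (e * `|u|)) *
      (cos (t * u - c) * pker a (y - u)))).
    apply: integrable_bounded_mul => //; first exact: measurable_expR_abs.
    by move=> x; exact: exp1.
  have IG : mu.-integrable setT (EFin \o (fun s => G s * pker e (t - s))).
    apply: integrable_bounded_mul => //; last exact: integrable_pker.
    exact: continuous_measurable_fun.
  have -> : \int[mu]_u (expR (- (e * `|u|)) *
      \int[mu]_s (cos ((y - u) * s + (t * u - c)) * expR (- (a * `|s|)))) =
      2 * \int[mu]_u (expR (- (e * `|u|)) * (cos (t * u - c) * pker a (y - u))).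
    rewrite -(RintegralZl 2 measurableT Ie); apply: eq_Rintegral => u _.
    by rewrite Rintegral_expR_abs_cos//; ring.
  have -> : \int[mu]_s (expR (- (a * `|s|)) *
      \int[mu]_u (cos ((y - u) * s + (t * u - c)) * expR (- (e * `|u|)))) =
      2 * \int[mu]_s (G s * pker e (t - s)).
    rewrite -(RintegralZl 2 measurableT IG); apply: eq_Rintegral => s _.
    have -> : (fun u => cos ((y - u) * s + (t * u - c)) * expR (- (e * `|u|))) =
              (fun u => cos ((t - s) * u + (y * s - c)) * expR (- (e * `|u|))).
      by apply/funext => u; congr (cos _ * _); ring.
    by rewrite Rintegral_expR_abs_cos// /G; ring.
  move=> E; apply: (@mulfI _ (2 : R)); first by rewrite pnatr_eq0.
  apply/esym/E; apply: (measurableT_comp (continuous_measurable_fun (@continuous_cos R))).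
  apply: measurable_funD.
    by apply: measurable_funM => //; apply: measurable_funB.
  by apply: measurable_funB => //; exact: measurable_funM.
have lim2 : \int[mu]_u (expR (- (n.+1%:R^-1 * `|u|)) *
    (cos (t * u - c) * pker a (y - u))) @[n --> \oo] -->
    \int[mu]_u (cos (t * u - c) * pker a (y - u)).
  have := @Rintegral_dominated_cvg _ (measurableTypeR R) R mu setT
    (fun n u => expR (- (n.+1%:R^-1 * `|u|)) * (cos (t * u - c) * pker a (y - u)))
    (fun u => cos (t * u - c) * pker a (y - u)) (fun u => pker a (y - u)) measurableT.
  apply.
  - move=> n; apply: measurable_funM; first exact: measurable_expR_abs.
    by apply/measurable_EFinP; exact: measurable_int Ip.
  - move=> u _; rewrite -[X in _ --> X]mul1r; apply: cvgMl.
    exact: cvg_expR_harmonic.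
  - exact: integrable_pker.
  - move=> n u _; rewrite 2!normrM (gtr0_norm (pker_gt0 _ a0)).
    by rewrite mulrA ler_piMl ?(ltW (pker_gt0 _ a0))// mulr_ile1 ?exp1 ?cos_max.
by move=> lim1; rewrite (cvg_unique _ lim2 lim1)// /G [y * t]mulrC.
Qed.

End PoissonIntegral.

(** * A test for the boundedness of integral operators *)

Lemma mule_le_weighted_squares (R : realType) (t : R) (x y : \bar R) : 0 < t ->
  (0 <= x -> 0 <= y ->
   x * y + x * y <= t%:E * (x * x) + t^-1%:E * (y * y))%E.
Proof.
move=> t0; move: x y => [x| |] [y| |] // x0 y0; rewrite ?lee_fin in x0 y0.
- rewrite -!EFinM -!EFinD lee_fin -subr_ge0.
  have -> : t * (x * x) + t^-1 * (y * y) - (x * y + x * y)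
          = t * (x - t^-1 * y) ^+ 2 by field; rewrite gt_eqF.
  by rewrite mulr_ge0 ?sqr_ge0// ltW.
- by rewrite mulyy [X in (_ <= _ + X)%E]gt0_muley ?lte_fin ?invr_gt0// addey ?leey.
- by rewrite mulyy [X in (_ <= X + _)%E]gt0_muley ?lte_fin// addye ?leey.
- by rewrite mulyy [X in (_ <= X + _)%E]gt0_muley ?lte_fin//
    gt0_muley ?lte_fin ?invr_gt0// leey.
Qed.

Lemma le_integral_sum2 d (T : measurableType d) (R : realType)
    (n : {measure set T -> \bar R}) (u v w : T -> \bar R) :
  measurable_fun setT u -> measurable_fun setT v -> measurable_fun setT w ->
  (forall z, 0 <= u z)%E -> (forall z, 0 <= v z)%E -> (forall z, 0 <= w z)%E ->
  (forall z, u z <= v z + w z)%E ->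
  (\int[n]_z u z <= \int[n]_z v z + \int[n]_z w z)%E.
Proof.
move=> mu mv mw u0 v0 w0 uvw.
rewrite -ge0_integralD//; apply: ge0_le_integral => //.
exact: emeasurable_funD.
Qed.

Lemma integral_le_weighted_squares d (T : measurableType d) (R : realType)
    (n : {measure set T -> \bar R}) (t : R) (u v : T -> \bar R) :
  0 < t -> measurable_fun setT u -> measurable_fun setT v ->
  (forall z, 0 <= u z)%E -> (forall z, 0 <= v z)%E ->
  (\int[n]_z (u z * v z) + \int[n]_z (u z * v z) <=
      t%:E * \int[n]_z (u z * u z) + t^-1%:E * \int[n]_z (v z * v z))%E.
Proof.
move=> t0 mu mv u0 v0.
have ti0 : 0 <= t^-1 by rewrite invr_ge0 ltW.
have muv := emeasurable_funM mu mv.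
have muu := emeasurable_funM mu mu.
have mvv := emeasurable_funM mv mv.
have uv0 z : (0 <= u z * v z)%E by exact: mule_ge0.
have uu0 z : (0 <= u z * u z)%E by exact: mule_ge0.
have vv0 z : (0 <= v z * v z)%E by exact: mule_ge0.
rewrite -(ge0_integralD _ measurableT (fun z _ => uv0 z) muv (fun z _ => uv0 z) muv).
rewrite -(ge0_integralZl_EFin n measurableT (fun z _ => uu0 z) muu (ltW t0)).
rewrite -(ge0_integralZl_EFin n measurableT (fun z _ => vv0 z) mvv ti0).
apply: le_integral_sum2 => [|||z|z|z|z].
- exact: emeasurable_funD.
- exact: measurable_funeM.
- exact: measurable_funeM.
- exact: adde_ge0.
- by rewrite mule_ge0// lee_fin ltW.
- by rewrite mule_ge0// lee_fin.
- exact: mule_le_weighted_squares.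
Qed.

Section TTstar.
Local Open Scope ereal_scope.
Context d1 d2 (Z : measurableType d1) (W : measurableType d2) (R : realType).
Variables (m : {sigma_finite_measure set Z -> \bar R})
  (nu : {sigma_finite_measure set W -> \bar R}).

(** The squared norm of the adjoint of the operator with kernel k is the quadratic
    form of the kernel obtained by integrating k twice in its second variable. *)
Lemma integral_TTstar (k : Z * W -> \bar R) (g : Z -> \bar R) :
  measurable_fun setT k -> (forall p, 0 <= k p) ->
  measurable_fun setT g -> (forall z, 0 <= g z) ->
  \int[nu]_w ((\int[m]_z (k (z, w) * g z)) * (\int[m]_z (k (z, w) * g z))) =
  \int[m]_z \int[m]_z' (g z * g z' * \int[nu]_w (k (z, w) * k (z', w))).
Proof.
move=> mk k0 mg g0.
pose Phi w := \int[m]_z (k (z, w) * g z).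
have mkg : measurable_fun setT (fun p : Z * W => k p * g p.1).
  by apply: emeasurable_funM => //; exact: measurableT_comp.
have mPhi : measurable_fun setT Phi.
  apply: (measurable_fun_fubini_tonelli_G (fun p : Z * W => k p * g p.1)) => //.
  by move=> p; exact: mule_ge0.
have Phi0 w : 0 <= Phi w by apply: integral_ge0 => z _; exact: mule_ge0.
have mkz z : measurable_fun setT (fun w => k (z, w)) by exact: measurableT_comp.
have mkw w : measurable_fun setT (fun z => k (z, w)) by exact: measurableT_comp.
transitivity (\int[nu]_w \int[m]_z (k (z, w) * g z * Phi w)).
  apply: eq_integral => w _; rewrite ge0_integralZr//.
  - by apply: emeasurable_funM.
  - by move=> z _; exact: mule_ge0.
rewrite -(@fubini_tonelli _ _ _ _ _ m nu
  (fun p : Z * W => k p * g p.1 * Phi p.2)); last 2 first.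
  - by apply: emeasurable_funM => //; exact: measurableT_comp.
  - by move=> p; rewrite !mule_ge0.
apply: eq_integral => z _ /=.
transitivity (\int[nu]_w \int[m]_z' (g z * (k (z, w) * k (z', w) * g z'))).
  apply: eq_integral => w _; rewrite -ge0_integralZl//.
  - apply: eq_integral => z' _.
    by rewrite -!muleA muleCA; congr (_ * _); rewrite muleCA.
  - by apply: emeasurable_funM.
  - by move=> z' _; exact: mule_ge0.
  - exact: mule_ge0.
rewrite -(@fubini_tonelli _ _ _ _ _ m nu
  (fun p : Z * W => g z * (k (z, p.2) * k p * g p.1))); last 2 first.
  - apply: emeasurable_funM => //; apply: emeasurable_funM => //.
      apply: emeasurable_funM => //.
      exact: (measurableT_comp (mkz z) measurable_snd).
    exact: measurableT_comp.
  - by move=> p; rewrite !mule_ge0.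
apply: eq_integral => z' _ /=.
rewrite -ge0_integralZl//.
- by apply: eq_integral => w _; rewrite [X in g z * X]muleC muleA.
- by apply: emeasurable_funM.
- by move=> w _; exact: mule_ge0.
- exact: mule_ge0.
Qed.

End TTstar.

(** The weights (2 C2)^-1 and (8 c C1 C2)^-1 are those for which the terms in y
    and x on the right are at most half of the left-hand sides. *)
Lemma absorb_quadratic_terms (R : realFieldType) (c C1 C2 x y t : R) :
  0 < c -> 0 < C1 -> 0 < C2 ->
  y <= (2 * C2)^-1 * (C2 * y) + 2 * C2 * x ->
  x <= c * ((8 * c * C1 * C2)^-1 * (C1 * y) + 8 * c * C1 * C2 * t) ->
  x <= 16 * c ^+ 2 * C1 * C2 * t.
Proof.
move=> c0 C10 C20 yb xb.
have C20' : C2 != 0%R by rewrite gt_eqF.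
have C10' : C1 != 0%R by rewrite gt_eqF.
have c0' : c != 0%R by rewrite gt_eqF.
have {}yb : (y <= 4 * C2 * x).
  have e : ((2 * C2)^-1 * (C2 * y) = y / 2) by field.
  by rewrite e in yb; lra.
have e : (c * ((8 * c * C1 * C2)^-1 * (C1 * y) + 8 * c * C1 * C2 * t)
  = (8 * C2)^-1 * y + 8 * c ^+ 2 * C1 * C2 * t).
  by field; rewrite C20' C10' c0'.
rewrite {}e in xb.
have e : ((8 * C2)^-1 * y <= x / 2).
  have -> : (x / 2 = (8 * C2)^-1 * (4 * C2 * x)) by field.
  by rewrite ler_wpM2l// invr_ge0 mulr_ge0// ltW.
have -> : (16 * c ^+ 2 * C1 * C2 * t = 2 * (8 * c ^+ 2 * C1 * C2 * t)) by ring.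
lra.
Qed.

Section TTstar_test.
Local Open Scope ereal_scope.
Context d1 d2 (Z : measurableType d1) (W : measurableType d2) (R : realType).
Variables (m : {sigma_finite_measure set Z -> \bar R})
  (nu : {sigma_finite_measure set W -> \bar R}).

(** A criterion for a function dominated by an integral operator to be square
    integrable for m. Let S and B be the adjoints of the operators with kernels k
    and k2, applied to g, and let Y be the quadratic form of a at g. Then
    int g^2 <= c int S h and int S^2 <= C1 Y. The kernel a need not satisfy the Schur
    condition for m, but it is dominated by the symmetrisation of k2, so that
    Y <= 2 int B g, while int B^2 <= C2 Y; hence Y <= 4 C2 int g^2 and int g^2 is
    bounded by a multiple of int h^2. The finiteness hypotheses allow the
    absorption of terms, and do not enter the constant. *)
Lemma TTstar_test (k : Z * W -> \bar R) (a k2 : Z * Z -> \bar R)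
    (g : Z -> \bar R) (h : W -> \bar R) (c C1 C2 : R) :
  (0 < c)%R -> (0 < C1)%R -> (0 < C2)%R ->
  measurable_fun setT k -> (forall p, 0 <= k p) ->
  measurable_fun setT a -> (forall p, 0 <= a p) ->
  measurable_fun setT k2 -> (forall p, 0 <= k2 p) ->
  measurable_fun setT g -> (forall z, 0 <= g z) ->
  measurable_fun setT h -> (forall w, 0 <= h w) ->
  (forall z, g z <= c%:E * \int[nu]_w (k (z, w) * h w)) ->
  (forall z z', \int[nu]_w (k (z, w) * k (z', w)) <= C1%:E * a (z, z')) ->
  (forall z z', a (z, z') <= k2 (z, z') + k2 (z', z)) ->
  (forall z z', \int[m]_w (k2 (z, w) * k2 (z', w)) <= C2%:E * a (z, z')) ->
  \int[m]_z (g z * g z) < +oo ->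
  \int[m]_z \int[m]_z' (g z * g z' * a (z, z')) < +oo ->
  \int[m]_z (g z * g z) <= (16 * c ^+ 2 * C1 * C2)%:E * \int[nu]_w (h w * h w).
Proof.
move=> c0 C10 C20 mk k0 ma a0 mk2 k20 mg g0 mh h0 Hg Hk Ha Hk2.
set X := \int[m]_z (g z * g z); set Y := \int[m]_z \int[m]_z' _.
set H := \int[nu]_w (h w * h w) => Xoo Yoo.
pose S w := \int[m]_z (k (z, w) * g z).
pose B w := \int[m]_z (k2 (z, w) * g z).
have mkg : measurable_fun setT (fun p : Z * W => k p * g p.1).
  by apply: emeasurable_funM => //; exact: measurableT_comp.
have mk2g : measurable_fun setT (fun p : Z * Z => k2 p * g p.1).
  by apply: emeasurable_funM => //; exact: measurableT_comp.
have mS : measurable_fun setT S.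
  apply: (measurable_fun_fubini_tonelli_G (fun p : Z * W => k p * g p.1)) => //.
  by move=> p; exact: mule_ge0.
have mB : measurable_fun setT B.
  apply: (measurable_fun_fubini_tonelli_G (fun p : Z * Z => k2 p * g p.1)) => //.
  by move=> p; exact: mule_ge0.
have S0 w : 0 <= S w by apply: integral_ge0 => z _; exact: mule_ge0.
have B0 w : 0 <= B w by apply: integral_ge0 => z _; exact: mule_ge0.
have mkz z : measurable_fun setT (fun w => k (z, w)) by exact: measurableT_comp.
have mkw w : measurable_fun setT (fun z => k (z, w)) by exact: measurableT_comp.
have mk2z z : measurable_fun setT (fun w => k2 (z, w)) by exact: measurableT_comp.
have mk2w w : measurable_fun setT (fun z => k2 (z, w)) by exact: measurableT_comp.
have maz z : measurable_fun setT (fun w => a (z, w)) by exact: measurableT_comp.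
have mgg : measurable_fun setT (fun p : Z * Z => g p.1 * g p.2).
  by apply: emeasurable_funM; exact: measurableT_comp.
have X0 : 0 <= X by apply: integral_ge0 => z _; exact: mule_ge0.
have Y0 : 0 <= Y.
  by do 2 (apply: integral_ge0 => ? _); rewrite !mule_ge0.
have H0 : 0 <= H by apply: integral_ge0 => z _; exact: mule_ge0.
have mggz z : measurable_fun setT (fun z' => g z * g z').
  exact: emeasurable_funM.
have mgga z : measurable_fun setT (fun z' => g z * g z' * a (z, z')).
  exact: emeasurable_funM (mggz z) (maz z).
have mgga2 : measurable_fun setT (fun p : Z * Z => g p.1 * g p.2 * a p).
  exact: emeasurable_funM.
have mYi : measurable_fun setT (fun z => \int[m]_z' (g z * g z' * a (z, z'))).
  apply: (measurable_fun_fubini_tonelli_F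
    (fun p : Z * Z => g p.1 * g p.2 * a p)) => //.
  by move=> p; rewrite !mule_ge0.
have mswap (q : Z * Z -> \bar R) : measurable_fun setT q ->
    measurable_fun setT (fun p : Z * Z => q (p.2, p.1)).
  move=> mq; apply: (measurableT_comp mq); apply: measurable_fun_pair;
    [exact: measurable_snd|exact: measurable_fst].
have quad (C : R) (q : Z * Z -> \bar R) : (0 <= C)%R ->
    (forall z z', 0 <= q (z, z')) -> measurable_fun setT q ->
    (forall z z', q (z, z') <= C%:E * a (z, z')) ->
    \int[m]_z \int[m]_z' (g z * g z' * q (z, z')) <= C%:E * Y.
  move=> C0 q0 mq qa; rewrite -ge0_integralZl//; last first.
    by move=> z _; apply: integral_ge0 => z' _; rewrite !mule_ge0.
  have mgq z : measurable_fun setT (fun z' => g z * g z' * q (z, z')).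
    apply: (emeasurable_funM (mggz z)); exact: measurableT_comp.
  apply: ge0_le_integral => //.
  - by move=> z _; apply: integral_ge0 => z' _; rewrite !mule_ge0.
  - apply: (measurable_fun_fubini_tonelli_F
      (fun p : Z * Z => g p.1 * g p.2 * q p)) => //.
      exact: emeasurable_funM.
    by move=> p; rewrite !mule_ge0//; case: p.
  - exact: emeasurable_funM.
  - move=> z _; rewrite -ge0_integralZl//; last by move=> z' _; rewrite !mule_ge0.
    apply: ge0_le_integral => //.
    + by move=> z' _; rewrite !mule_ge0.
    + exact: emeasurable_funM.
    + by move=> z' _; rewrite muleCA lee_pmul// mule_ge0.
have SY : \int[nu]_w (S w * S w) <= C1%:E * Y.
  rewrite (integral_TTstar m nu mk k0 mg g0); apply: (quad _
    (fun p => \int[nu]_w (k (p.1, w) * k (p.2, w)))) => //.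
  - exact: ltW.
  - by move=> z z'; apply: integral_ge0 => w _; exact: mule_ge0.
  - apply: (measurable_fun_fubini_tonelli_F
      (fun p : (Z * Z) * W => k (p.1.1, p.2) * k (p.1.2, p.2))) => //.
      apply: emeasurable_funM; apply: (measurableT_comp mk);
        apply: measurable_fun_pair => //; exact: measurableT_comp.
    by move=> p; exact: mule_ge0.
have BY : \int[m]_w (B w * B w) <= C2%:E * Y.
  rewrite (integral_TTstar m m mk2 k20 mg g0); apply: (quad _
    (fun p => \int[m]_w (k2 (p.1, w) * k2 (p.2, w)))) => //.
  - exact: ltW.
  - by move=> z z'; apply: integral_ge0 => w _; exact: mule_ge0.
  - apply: (measurable_fun_fubini_tonelli_F
      (fun p : (Z * Z) * Z => k2 (p.1.1, p.2) * k2 (p.1.2, p.2))) => //.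
      apply: emeasurable_funM; apply: (measurableT_comp mk2);
        apply: measurable_fun_pair => //; exact: measurableT_comp.
    by move=> p; exact: mule_ge0.
pose P := \int[m]_z \int[m]_z' (g z * g z' * k2 (z, z')).
have mggk2 : measurable_fun setT (fun p : Z * Z => g p.1 * g p.2 * k2 p).
  exact: emeasurable_funM.
have mggk2' : measurable_fun setT
    (fun p : Z * Z => g p.1 * g p.2 * k2 (p.2, p.1)).
  by apply: emeasurable_funM => //; exact: mswap.
have PE : P = \int[m]_z' \int[m]_z (g z * g z' * k2 (z, z')).
  apply: (@fubini_tonelli _ _ _ _ _ m m
    (fun p : Z * Z => g p.1 * g p.2 * k2 p)) => // p.
  by rewrite !mule_ge0.
(* g(z) g(z') is symmetric, so both halves of the symmetrisation of k2 contribute P *)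
have YPP : Y <= P + P.
  have {2}-> : P = \int[m]_z \int[m]_z' (g z * g z' * k2 (z', z)).
    rewrite PE; apply: eq_integral => z _; apply: eq_integral => z' _.
    by rewrite [g z * _]muleC.
  have k2F (q : Z * Z -> \bar R) : (forall p, 0 <= q p) ->
      measurable_fun setT q ->
      measurable_fun setT (fun z => \int[m]_z' (g z * g z' * q (z, z'))).
    move=> q0 mq; apply: (measurable_fun_fubini_tonelli_F
        (fun p : Z * Z => g p.1 * g p.2 * q p)) => [|p].
      exact: emeasurable_funM.
    by rewrite !mule_ge0.
  have gq0 (q : Z * Z -> \bar R) z : (forall p, 0 <= q p) ->
      0 <= \int[m]_z' (g z * g z' * q (z, z')).
    by move=> q0; apply: integral_ge0 => z' _; rewrite !mule_ge0.
  apply: le_integral_sum2 => [|||z|z|z|z].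
  - exact: k2F.
  - exact: k2F.
  - exact: (k2F (fun p => k2 (p.2, p.1)) (fun p => k20 _) (mswap k2 mk2)).
  - exact: gq0.
  - exact: gq0.
  - exact: (gq0 (fun p => k2 (p.2, p.1)) z (fun p => k20 _)).
  - apply: le_integral_sum2 => [|||z'|z'|z'|z'].
    + exact: mgga.
    + exact: (emeasurable_funM (mggz z) (mk2z z)).
    + exact: (emeasurable_funM (mggz z) (mk2w z)).
    + by rewrite !mule_ge0.
    + by rewrite !mule_ge0.
    + by rewrite !mule_ge0.
    + have gg0 : 0 <= g z * g z' by exact: mule_ge0.
      have := lee_pmul gg0 (a0 _) (lexx _) (Ha z z').
      by rewrite (ge0_muleDr _ (k20 _) (k20 _)).
have PB : P = \int[m]_z (B z * g z).
  rewrite PE.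
  apply: eq_integral => z' _.
  transitivity (\int[m]_z (k2 (z, z') * g z * g z')).
    by apply: eq_integral => z _; rewrite muleC muleA.
  apply: (ge0_integralZr m measurableT (emeasurable_funM (mk2w z') mg)).
    by move=> z _; exact: mule_ge0.
  exact: g0.
have SH0 : 0 <= \int[nu]_w (S w * h w).
  by apply: integral_ge0 => w _; exact: mule_ge0.
have XSh : X <= c%:E * \int[nu]_w (S w * h w).
  have -> : \int[nu]_w (S w * h w) =
            \int[nu]_w \int[m]_z (k (z, w) * g z * h w).
    apply: eq_integral => w _; apply/esym.
    apply: (ge0_integralZr m measurableT (emeasurable_funM (mkw w) mg)).
      by move=> z _; exact: mule_ge0.
    exact: h0.
  have mkgh : measurable_fun setT (fun p : Z * W => k p * g p.1 * h p.2).
    apply: (emeasurable_funM mkg).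
    exact: (measurableT_comp mh measurable_snd).
  have kgh0 p : 0 <= k p * g p.1 * h p.2 by rewrite !mule_ge0.
  rewrite -(@fubini_tonelli _ _ _ _ _ m nu
    (fun p : Z * W => k p * g p.1 * h p.2) mkgh kgh0) /=.
  have mF := measurable_fun_fubini_tonelli_F (m2 := nu) _ mkgh kgh0.
  have F0 z : 0 <= \int[nu]_w (k (z, w) * g z * h w).
    by apply: integral_ge0 => w _; rewrite !mule_ge0.
  rewrite -(ge0_integralZl_EFin m measurableT (fun z _ => F0 z) mF (ltW c0)).
  apply: (ge0_le_integral m measurableT).
  - by move=> z _; exact: mule_ge0.
  - exact: emeasurable_funM.
  - exact: measurable_funeM.
  - move=> z _.
    have := lee_pmul (g0 z) (g0 z) (lexx _) (Hg z).
    suff -> : \int[nu]_w (k (z, w) * g z * h w) =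
              g z * \int[nu]_w (k (z, w) * h w) by rewrite muleCA.
    have mkh := emeasurable_funM (mkz z) mh.
    have kh0 w : 0 <= k (z, w) * h w by exact: mule_ge0.
    rewrite -(ge0_integralZl nu measurableT mkh (fun w _ => kh0 w) (g0 z)).
    by apply: eq_integral => w _; rewrite -muleA muleCA.
have t1 : (0 < (2 * C2)^-1)%R by rewrite invr_gt0 mulr_gt0.
have t2 : (0 < (8 * c * C1 * C2)^-1)%R by rewrite invr_gt0 !mulr_gt0.
have YB : Y <= (2 * C2)^-1%:E * (C2%:E * Y) + (2 * C2)%:E * X.
  apply: (le_trans YPP); rewrite PB.
  have BX := integral_le_weighted_squares m t1 mB mg B0 g0.
  rewrite invrK in BX; apply: (le_trans BX (leeD _ (lexx _))).
  by apply: (lee_wpmul2l _ BY); rewrite lee_fin ltW.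
have XB : X <= c%:E * ((8 * c * C1 * C2)^-1%:E * (C1%:E * Y)
                        + (8 * c * C1 * C2)%:E * H).
  apply: (le_trans XSh); apply: lee_wpmul2l; first by rewrite lee_fin ltW.
  have Sh := integral_le_weighted_squares nu t2 mS mh S0 h0.
  rewrite invrK in Sh; apply: (le_trans (leeDl _ SH0) (le_trans Sh _)).
  by apply: (leeD (lee_wpmul2l _ SY) (lexx _)); rewrite lee_fin ltW.
have [Hoo|Hoo] := eqVneq H +oo.
  have K0 : 0 < (16 * c ^+ 2 * C1 * C2)%:E.
    by rewrite lte_fin !mulr_gt0 ?exprn_gt0.
  by rewrite Hoo (gt0_muley K0) leey.
have Hfin : H \is a fin_num by rewrite (ge0_fin_numE H0) ltey.
have Yfin : Y \is a fin_num by rewrite (ge0_fin_numE Y0); exact: Yoo.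
have Xfin : X \is a fin_num by rewrite (ge0_fin_numE X0); exact: Xoo.
move: YB XB; rewrite -(fineK Hfin) -(fineK Yfin) -(fineK Xfin).
move: (fine X) (fine Y) (fine H) => x y t.
rewrite -!(EFinM, EFinD) !lee_fin.
exact: absorb_quadratic_terms.
Qed.
End TTstar_test.

(** * Waves and the Plancherel inequality *)

Lemma norm_Rintegral_le d (T : measurableType d) (R : realType)
    (m : {measure set T -> \bar R}) (f : T -> R) : measurable_fun setT f ->
  (`|\int[m]_x f x|%:E <= \int[m]_x `|f x|%:E)%E.
Proof.
move=> mf; have mf' : measurable_fun setT (EFin \o f) by exact/measurable_EFinP.
apply: (le_trans _ (le_abse_integral m measurableT mf')).
rewrite /Rintegral -[(\int[m]_x (EFin \o f) x)%E]/(\int[m]_x (f x)%:E)%E.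
by case: (\int[m]_x (f x)%:E)%E => [r| |] //=; rewrite normr0 leey.
Qed.

Section Wave.
Context {R : realType}.
Local Notation mu := (@lebesgue_measure R).

(** The phase c treats the cosine transform (c = 0) and the sine transform
    (c = pi / 2) at once, and keeps all integrals real. *)
Definition wave (f : R -> R) (c y : R) : R := \int[mu]_t (cos (t * y - c) * f t).

Lemma measurable_cos_phase (c : R) :
  measurable_fun setT (fun p : measurableTypeR R * measurableTypeR R =>
    cos (p.2 * p.1 - c)).
Proof.
apply: (measurableT_comp (continuous_measurable_fun (@continuous_cos R))).
by apply: measurable_funB => //; exact: measurable_funM.
Qed.

Lemma measurable_cos_phase1 (c y : R) :
  measurable_fun setT (fun t : R => cos (t * y - c)).
Proof. exact: (measurableT_comp (measurable_cos_phase c) (measurable_pair1 y)). Qed.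

Lemma measurable_cos_phase2 (c t : R) :
  measurable_fun setT (fun y : R => cos (t * y - c)).
Proof. exact: (measurableT_comp (measurable_cos_phase c) (measurable_pair2 t)). Qed.

Lemma measurable_integral2 d1 d2 (S : measurableType d1) (T : measurableType d2)
    (m : {sigma_finite_measure set T -> \bar R}) (h : S * T -> R) :
  measurable_fun setT h ->
  measurable_fun setT (fun x => \int[m]_t h (x, t)).
Proof.
move=> mh.
have mh' : measurable_fun setT (EFin \o h) by exact/measurable_EFinP.
have mp := measurable_funepos mh'; have mn := measurable_funeneg mh'.
have := measurable_fun_fubini_tonelli_F (m2 := m) _ mp (fun p => funepos_ge0 _ p).
have := measurable_fun_fubini_tonelli_F (m2 := m) _ mn (fun p => funeneg_ge0 _ p).
move=> mN mP; have mPN := emeasurable_funB mP mN.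
have := measurableT_comp (@fine_measurable R setT measurableT) mPN.
apply: eq_measurable_fun => x _ /=; rewrite /Rintegral integralE.
congr (fine (_ - _)%E); apply: eq_integral => t _.
  by rewrite !funeposE.
by rewrite !funenegE.
Qed.

Lemma measurable_wave (f : R -> R) (c : R) : measurable_fun setT f ->
  measurable_fun setT (wave f c).
Proof.
move=> mf; apply: (measurable_integral2 (mu)
  (h := fun p : measurableTypeR R * measurableTypeR R => cos (p.2 * p.1 - c) * f p.2)).
by apply: measurable_funM; [exact: measurable_cos_phase|exact: measurableT_comp].
Qed.

Lemma integrable_wave (f : R -> R) (c y : R) : mu.-integrable setT (EFin \o f) ->
  mu.-integrable setT (EFin \o (fun t => cos (t * y - c) * f t)).
Proof.
move=> If; apply: integrable_bounded_mul => // [|t]; last exact: cos_max.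
exact: measurable_cos_phase1.
Qed.

Lemma norm_wave_le (f : R -> R) (c y : R) : mu.-integrable setT (EFin \o f) ->
  `|wave f c y| <= \int[mu]_t `|f t|.
Proof.
move=> If; have Iw := integrable_wave c y If.
apply: (le_trans (le_normr_Rintegral measurableT Iw)).
apply: le_Rintegral => //; [exact: integrable_norm|exact: integrable_norm|].
by move=> t _; rewrite normrM ler_piMl// cos_max.
Qed.

(** A consequence of poisson_cos by exchanging integrals: damping f amounts to
    taking the Poisson integral of its wave. *)
Lemma wave_poisson (f : R -> R) (a c y : R) : 0 < a ->
  mu.-integrable setT (EFin \o f) ->
  \int[mu]_u (pker a (y - u) * wave f c u) =
  pi * wave (fun t => expR (- (a * `|t|)) * f t) c y.
Proof.
move=> a0 If.
have Ief : mu.-integrable setT (EFin \o (fun t => expR (- (a * `|t|)) * f t)).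
  apply: integrable_bounded_mul => // [|t]; first exact: measurable_expR_abs.
  by rewrite ger0_norm ?expR_ge0// expR_le1 oppr_le0 mulr_ge0// ltW.
have := Rintegral_swap (m := mu) (n := mu)
  (k := fun p => cos (p.2 * p.1 - c)) (measurable_cos_phase c)
  (fun=> cos_max _) (integrable_pker y a0) If.
rewrite /wave => ->; rewrite -(RintegralZl pi measurableT (integrable_wave c y Ief)).
apply: eq_Rintegral => t _.
by rewrite poisson_cos//; ring.
Qed.

Lemma norm_wave_poisson_le (f : R -> R) (a c y : R) : 0 < a ->
  mu.-integrable setT (EFin \o f) ->
  ((pi * `|wave (fun t => expR (- (a * `|t|)) * f t) c y|)%:E <=
   \int[mu]_u (pker a (y - u) * `|wave f c u|)%:E)%E.
Proof.
move=> a0 If.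
have mf : measurable_fun setT f by apply/measurable_EFinP; exact: measurable_int If.
rewrite -{1}(ger0_norm (pi_ge0 R)) -normrM -wave_poisson//.
have mpw : measurable_fun setT (fun u : R => pker a (y - u) * wave f c u).
  apply: measurable_funM; last exact: measurable_wave.
  by apply: measurable_pker => //; exact: measurable_funB.
apply: (le_trans (norm_Rintegral_le mu mpw)).
rewrite le_eqVlt; apply/orP; left; apply/eqP; apply: eq_integral => u _.
by congr EFin; rewrite normrM (gtr0_norm (pker_gt0 _ a0)).
Qed.

Lemma Rintegral_cos_cos (e c s t : R) : 0 < e ->
  \int[mu]_y (cos (s * y - c) * (cos (t * y - c) * expR (- (e * `|y|)))) =
  pker e (t - s) + pker e (t + s) * cos (2 * c).
Proof.
move=> e0; have Ie := integrable_expR_abs e0.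
have I1 : mu.-integrable setT
    (EFin \o (fun y => cos ((t - s) * y + 0) * expR (- (e * `|y|)))).
  apply: integrable_bounded_mul => // [|y]; last exact: cos_max.
  exact: measurable_cos_affine.
have I2 : mu.-integrable setT
    (EFin \o (fun y => cos ((t + s) * y + - (2 * c)) * expR (- (e * `|y|)))).
  apply: integrable_bounded_mul => // [|y]; last exact: cos_max.
  exact: measurable_cos_affine.
apply: (@mulfI _ (2 : R)); first by rewrite pnatr_eq0.
have I3 : mu.-integrable setT
    (EFin \o (fun y => cos (s * y - c) * (cos (t * y - c) * expR (- (e * `|y|))))).
  apply: integrable_bounded_mul => // [|y|]; last first.
  - apply: integrable_bounded_mul => // [|y]; last exact: cos_max.
    exact: measurable_cos_phase2.
  - exact: cos_max.
  - exact: measurable_cos_phase2.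
rewrite -(RintegralZl 2 measurableT I3).
transitivity (\int[mu]_y (cos ((t - s) * y + 0) * expR (- (e * `|y|)) +
    cos ((t + s) * y + - (2 * c)) * expR (- (e * `|y|)))).
  apply: eq_Rintegral => y _; rewrite -mulrDl !mulrA; congr (_ * _).
  have -> : (t - s) * y + 0 = (t * y - c) - (s * y - c) by ring.
  have -> : (t + s) * y + - (2 * c) = (t * y - c) + (s * y - c) by ring.
  by rewrite (cosB (t * y - c)) (cosD (t * y - c)); ring.
rewrite (RintegralD measurableT I1 I2) !Rintegral_expR_abs_cos// cos0 cosN.
by ring.
Qed.

(** A symmetric majorant of the kernel of Rintegral_cos_cos that does not depend
    on the phase. *)
Definition sym_pker (e : R) (p : measurableTypeR R * measurableTypeR R) : R :=
  pker e (p.1 - p.2) + pker e (p.1 + p.2).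

Lemma measurable_sym_pker e : measurable_fun setT (sym_pker e).
Proof.
apply: measurable_funD; apply: measurable_pker => //.
  exact: measurable_funB.
exact: measurable_funD.
Qed.

Lemma sym_pker_ge0 e p : 0 < e -> 0 <= sym_pker e p.
Proof. by move=> e0; rewrite addr_ge0// ltW// pker_gt0. Qed.

Lemma sym_pkerC e s t : sym_pker e (t, s) = sym_pker e (s, t).
Proof. by rewrite /sym_pker/= [s + t]addrC -[s - t]opprB /pker sqrrN. Qed.

Lemma integral_sym_pker e t : 0 < e ->
  (\int[mu]_s (sym_pker e (t, s))%:E = (2 * pi)%:E)%E.
Proof.
move=> e0; rewrite /sym_pker/=.
under eq_integral do rewrite EFinD.
rewrite ge0_integralD//; first last.
- apply/measurable_EFinP; apply: measurable_pker => //; exact: measurable_funD.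
- by move=> s _; rewrite lee_fin ltW// pker_gt0.
- apply/measurable_EFinP; apply: measurable_pker => //; exact: measurable_funB.
- by move=> s _; rewrite lee_fin ltW// pker_gt0.
have -> : (\int[mu]_s (pker e (t + s))%:E = \int[mu]_s (pker e (- t - s))%:E)%E.
  by apply: eq_integral => s _; rewrite /pker -opprD sqrrN.
by rewrite !integral_pker// -EFinD; congr EFin; ring.
Qed.

(** Schur's test: the kernel is symmetric and its integral in either variable is
    2 pi, so that |f(t) f(s)| <= (f(t)^2 + f(s)^2) / 2 suffices. *)
Lemma schur_sym_pker (e : R) (f : R -> R) : 0 < e -> measurable_fun setT f ->
  (\int[mu]_t \int[mu]_s (`|f t| * (`|f s| * sym_pker e (t, s)))%:E <=
   (2 * pi)%:E * \int[mu]_t (f t ^+ 2)%:E)%E.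
Proof.
move=> e0 mf.
have mf2 : measurable_fun setT (fun t => (2^-1 * f t ^+ 2)%:E).
  by apply/measurable_EFinP; apply: measurable_funM => //; exact: measurable_funX.
have ms := measurable_sym_pker e.
pose u (p : measurableTypeR R * measurableTypeR R) :=
  (`|f p.1| * (`|f p.2| * sym_pker e p))%:E.
pose v (p : measurableTypeR R * measurableTypeR R) :=
  ((2^-1 * f p.1 ^+ 2)%:E * (sym_pker e p)%:E)%E.
pose w (p : measurableTypeR R * measurableTypeR R) :=
  ((2^-1 * f p.2 ^+ 2)%:E * (sym_pker e p)%:E)%E.
have mu' : measurable_fun setT u.
  apply/measurable_EFinP; apply: measurable_funM.
    by apply: measurableT_comp => //; exact: measurableT_comp.
  apply: measurable_funM => //.
  by apply: measurableT_comp => //; exact: measurableT_comp.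
have mv : measurable_fun setT v.
  apply: emeasurable_funM; last exact/measurable_EFinP.
  exact: (measurableT_comp mf2).
have mw : measurable_fun setT w.
  apply: emeasurable_funM; last exact/measurable_EFinP.
  exact: (measurableT_comp mf2).
have f20 t : (0 <= (2^-1 * f t ^+ 2)%:E)%E by rewrite lee_fin mulr_ge0 ?sqr_ge0.
have s0 p : (0 <= (sym_pker e p)%:E)%E by rewrite lee_fin sym_pker_ge0.
have u0 p : (0 <= u p)%E.
  by rewrite lee_fin mulr_ge0// mulr_ge0// sym_pker_ge0.
have v0 p : (0 <= v p)%E by exact: mule_ge0.
have w0 p : (0 <= w p)%E by exact: mule_ge0.
have ms1 t : measurable_fun setT (fun s => (sym_pker e (t, s))%:E).
  by apply/measurable_EFinP; exact: (measurableT_comp ms (measurable_pair1 t)).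
have row t : (\int[mu]_s ((2^-1 * f t ^+ 2)%:E * (sym_pker e (t, s))%:E) =
              (2 * pi)%:E * (2^-1 * f t ^+ 2)%:E)%E.
  rewrite (ge0_integralZl mu measurableT (ms1 t) (fun s _ => s0 _) (f20 t)).
  by rewrite integral_sym_pker// muleC.
have pi20 : 0 <= 2 * pi :> R by rewrite mulr_ge0// pi_ge0.
have half : (\int[mu]_t ((2 * pi)%:E * (2^-1 * f t ^+ 2)%:E) =
             pi%:E * \int[mu]_t (f t ^+ 2)%:E)%E.
  rewrite -(ge0_integralZl_EFin mu measurableT _ _ (pi_ge0 R)).
  - by apply: eq_integral => t _; rewrite -!EFinM; congr EFin; field.
  - by move=> t _; rewrite lee_fin sqr_ge0.
  - by apply/measurable_EFinP; exact: measurable_funX.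
have vE : (\int[mu]_t \int[mu]_s v (t, s) = pi%:E * \int[mu]_t (f t ^+ 2)%:E)%E.
  by rewrite -half; apply: eq_integral => t _; exact: row.
have wE : (\int[mu]_t \int[mu]_s w (t, s) = pi%:E * \int[mu]_t (f t ^+ 2)%:E)%E.
  rewrite (fubini_tonelli (m1 := mu) (m2 := mu) w mw w0) -half.
  apply: eq_integral => s _; rewrite -row; apply: eq_integral => t _.
  by rewrite /w/= sym_pkerC.
have -> : (2 * pi)%:E = (pi%:E + pi%:E)%E :> \bar R by rewrite -EFinD; congr EFin; ring.
rewrite ge0_muleDl ?lee_fin ?pi_ge0// -{1}vE -wE.
apply: le_integral_sum2 => [|||t|t|t|t].
- exact: (measurable_fun_fubini_tonelli_F (m2 := mu) u mu' u0).
- exact: (measurable_fun_fubini_tonelli_F (m2 := mu) v mv v0).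
- exact: (measurable_fun_fubini_tonelli_F (m2 := mu) w mw w0).
- by apply: integral_ge0 => s _; exact: (u0 (t, s)).
- by apply: integral_ge0 => s _; exact: (v0 (t, s)).
- by apply: integral_ge0 => s _; exact: (w0 (t, s)).
- apply: le_integral_sum2 => [|||s|s|s|s].
  + exact: (measurableT_comp mu' (measurable_pair1 t)).
  + exact: (measurableT_comp mv (measurable_pair1 t)).
  + exact: (measurableT_comp mw (measurable_pair1 t)).
  + exact: (u0 (t, s)).
  + exact: (v0 (t, s)).
  + exact: (w0 (t, s)).
  + rewrite /v /w /= -!EFinM -EFinD lee_fin mulrA -mulrDl.
    rewrite ler_wpM2r ?sym_pker_ge0// -subr_ge0.
    rewrite -(real_normK (num_real (f t))) -(real_normK (num_real (f s))).
    rewrite (_ : _ - _ = 2^-1 * (`|f t| - `|f s|) ^+ 2); last by field.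
    by rewrite mulr_ge0 ?sqr_ge0.
Qed.

End Wave.

Section Plancherel.
Context {R : realType}.
Local Notation mu := (@lebesgue_measure R).

(** Expanding the square of the wave and integrating in y first turns the window
    exp(-e|y|) into Poisson kernels of width e, whose mass does not depend on e. *)
Lemma windowed_wave_le (f : R -> R) (c e : R) : 0 < e ->
  mu.-integrable setT (EFin \o f) ->
  (\int[mu]_y (expR (- (e * `|y|)) * wave f c y ^+ 2)%:E <=
   (2 * pi)%:E * \int[mu]_t (f t ^+ 2)%:E)%E.
Proof.
move=> e0 If.
have mf : measurable_fun setT f by apply/measurable_EFinP; exact: measurable_int If.
have Ie := integrable_expR_abs e0.
have mw := measurable_wave c mf.
have wM y := norm_wave_le c y If.
have me := measurable_expR_abs e.
have mg : measurable_fun setT (fun y => wave f c y * expR (- (e * `|y|))).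
  exact: measurable_funM.
have Ig : mu.-integrable setT (EFin \o (fun y => wave f c y * expR (- (e * `|y|)))).
  exact: (integrable_bounded_mulM (U := measurableTypeR R) mw wM Ie).
have Igw : mu.-integrable setT
    (EFin \o (fun y => wave f c y * (wave f c y * expR (- (e * `|y|))))).
  exact: (integrable_bounded_mulM (U := measurableTypeR R) mw wM Ig).
have -> : (\int[mu]_y (expR (- (e * `|y|)) * wave f c y ^+ 2)%:E =
  (\int[mu]_y (wave f c y * expR (- (e * `|y|)) * wave f c y))%:E)%E.
  rewrite /Rintegral fineK.
    by apply: eq_integral => y _; congr EFin; ring.
  have := integrable_fin_num measurableT Igw.
  rewrite (_ : (\int[mu]_x _ = \int[mu]_x
      (wave f c x * expR (- (e * `|x|)) * wave f c x)%:E)%E)//.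
  by apply: eq_integral => y _; congr EFin; ring.
have sw1 := Rintegral_swap (m := mu) (n := mu)
  (k := fun p => cos (p.2 * p.1 - c)) (measurable_cos_phase c)
  (fun=> cos_max _) Ig If.
have -> : \int[mu]_y (wave f c y * expR (- (e * `|y|)) * wave f c y) =
    \int[mu]_t (f t * \int[mu]_y
      (cos (t * y - c) * (wave f c y * expR (- (e * `|y|))))) by exact: sw1.
pose kap (p : measurableTypeR R * measurableTypeR R) : R :=
  pker e (p.1 - p.2) + pker e (p.1 + p.2) * cos (2 * c).
have mkap : measurable_fun setT kap.
  apply: measurable_funD; last apply: measurable_funM => //; apply: measurable_pker => //.
    exact: measurable_funB.
  exact: measurable_funD.
have kapE t : \int[mu]_y (cos (t * y - c) * (wave f c y * expR (- (e * `|y|)))) =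
    \int[mu]_s (f s * kap (t, s)).
  have Ict : mu.-integrable setT (EFin \o (fun y => cos (t * y - c) * expR (- (e * `|y|)))).
    apply: integrable_bounded_mul => // [|y]; last exact: cos_max.
    exact: measurable_cos_phase2.
  have sw2 := Rintegral_swap (m := mu) (n := mu)
    (k := fun p => cos (p.2 * p.1 - c)) (measurable_cos_phase c)
    (fun=> cos_max _) Ict If.
  transitivity (\int[mu]_y (cos (t * y - c) * expR (- (e * `|y|)) * wave f c y)).
    by apply: eq_Rintegral => y _; ring.
  rewrite /wave sw2; apply: eq_Rintegral => s _; congr (_ * _).
  exact: Rintegral_cos_cos.
have -> : \int[mu]_t (f t * \int[mu]_y
      (cos (t * y - c) * (wave f c y * expR (- (e * `|y|))))) =
    \int[mu]_t (f t * \int[mu]_s (f s * kap (t, s))).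
  by apply: eq_Rintegral => t _; rewrite kapE.
have mfk : measurable_fun setT
    (fun p : measurableTypeR R * measurableTypeR R => f p.2 * kap p).
  by apply: measurable_funM => //; exact: measurableT_comp.
have mik : measurable_fun setT (fun t => \int[mu]_s (f s * kap (t, s))).
  exact: (measurable_integral2 mu mfk).
have mfik : measurable_fun setT (fun t => f t * \int[mu]_s (f s * kap (t, s))).
  exact: measurable_funM.
have ms := measurable_sym_pker e.
have mfs : measurable_fun setT
    (fun p : measurableTypeR R * measurableTypeR R => (`|f p.1| * (`|f p.2| * sym_pker e p))%:E).
  apply/measurable_EFinP; apply: measurable_funM.
    by apply: measurableT_comp => //; exact: measurableT_comp.
  apply: measurable_funM => //.
  by apply: measurableT_comp => //; exact: measurableT_comp.
have fs0 (p : measurableTypeR R * measurableTypeR R) :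
    (0 <= (`|f p.1| * (`|f p.2| * sym_pker e p))%:E)%E.
  by rewrite lee_fin mulr_ge0// mulr_ge0// sym_pker_ge0.
apply: le_trans (schur_sym_pker e0 mf).
apply: (@le_trans _ _ (`|\int[mu]_t (f t * \int[mu]_s (f s * kap (t, s)))|%:E)).
  by rewrite lee_fin ler_norm.
apply: (le_trans (norm_Rintegral_le mu mfik)).
apply: (ge0_le_integral mu measurableT).
- by move=> t _; rewrite lee_fin.
- by apply/measurable_EFinP; exact: measurableT_comp.
- exact: (measurable_fun_fubini_tonelli_F (m2 := mu) _ mfs fs0).
- move=> t _; rewrite normrM.
  have mfkt := measurableT_comp mfk (measurable_pair1 t).
  have h := norm_Rintegral_le mu mfkt.
  apply: (@le_trans _ _ (`|f t|%:E * \int[mu]_s (`|f s * kap (t, s)|%:E))%E).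
    by rewrite EFinM; apply: lee_wpmul2l => //; rewrite lee_fin.
  rewrite -(ge0_integralZl_EFin mu measurableT _ _ (normr_ge0 (f t))); last 2 first.
  + by move=> s _; rewrite lee_fin.
  + by apply/measurable_EFinP; exact: measurableT_comp.
  apply: (ge0_le_integral mu measurableT).
  + by move=> s _; rewrite -EFinM lee_fin mulr_ge0.
  + apply: measurable_funeM; apply/measurable_EFinP; exact: measurableT_comp.
  + exact: (measurableT_comp mfs (measurable_pair1 t)).
  + move=> s _; rewrite -EFinM lee_fin ler_wpM2l// normrM ler_wpM2l//.
    rewrite /kap /sym_pker/= (le_trans (ler_normD _ _))// lerD//.
      by rewrite gtr0_norm// pker_gt0.
    rewrite normrM (gtr0_norm (pker_gt0 _ e0)) -[leRHS]mulr1.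
    by rewrite ler_wpM2l ?cos_max// ltW// pker_gt0.
Qed.

(** The inequality half of Plancherel's theorem, by letting the window of
    windowed_wave_le increase to 1. *)
Lemma wave_plancherel_le (f : R -> R) (c : R) :
  mu.-integrable setT (EFin \o f) ->
  (\int[mu]_y (wave f c y ^+ 2)%:E <= (2 * pi)%:E * \int[mu]_t (f t ^+ 2)%:E)%E.
Proof.
move=> If.
have mf : measurable_fun setT f by apply/measurable_EFinP; exact: measurable_int If.
have mw := measurable_wave c mf.
pose u (n : nat) (y : R) := (expR (- (n.+1%:R^-1 * `|y|)) * wave f c y ^+ 2)%:E.
have cu y : u n y @[n --> \oo] --> (wave f c y ^+ 2)%:E.
  apply: cvg_EFin; first exact: nearW.
  rewrite -[X in _ --> X]mul1r; apply: cvgMl.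
  exact: cvg_expR_harmonic.
have -> : (\int[mu]_y (wave f c y ^+ 2)%:E = \int[mu]_y limn (u ^~ y))%E.
  by apply: eq_integral => y _; rewrite (cvg_lim (@ereal_hausdorff R) (cu y)).
have mu_ n : measurable_fun setT (u n).
  apply/measurable_EFinP; apply: measurable_funM; first exact: measurable_expR_abs.
  exact: measurable_funX.
have u0 n y : (0 <= u n y)%E by rewrite lee_fin mulr_ge0 ?expR_ge0 ?sqr_ge0.
have ndu y : nondecreasing_seq (u ^~ y).
  move=> m n mn; rewrite lee_fin ler_wpM2r ?sqr_ge0// ler_expR lerN2.
  by rewrite ler_wpM2r// lef_pV2 ?posrE// ler_nat.
have cv := cvg_monotone_convergence (mu := mu) measurableT mu_
  (fun n y _ => u0 n y) (fun y _ => ndu y).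
rewrite -(cvg_lim (@ereal_hausdorff R) cv); apply: lime_le.
  apply: ereal_nondecreasing_is_cvgn => m n mn.
  apply: (ge0_le_integral mu measurableT (fun y _ => u0 m y) (mu_ m) (mu_ n)).
  by move=> y _; exact: ndu.
apply: nearW => n; apply: windowed_wave_le => //.
Qed.

End Plancherel.

(** * Inequalities for the Poisson kernel *)

Section PoissonKernelInequalities.
Context {R : realType}.
Implicit Types a b x y u v s t : R.

(** Cross-multiplied form, which reduces comparisons of Poisson kernels to polynomials. *)
Lemma pker_leM (k a b v w : R) : 0 < a -> 0 < b ->
  a * (b ^+ 2 + w ^+ 2) <= k * b * (a ^+ 2 + v ^+ 2) ->
  pker a v <= k * pker b w.
Proof.
move=> a0 b0 H.
have av : 0 < a ^+ 2 + v ^+ 2 by rewrite ltr_wpDr ?sqr_ge0// exprn_gt0.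
have bw : 0 < b ^+ 2 + w ^+ 2 by rewrite ltr_wpDr ?sqr_ge0// exprn_gt0.
by rewrite /pker mulrA ler_pdivrMr// mulrAC ler_pdivlMr.
Qed.

Lemma pker_le_inv a v : 0 < a -> pker a v <= a^-1.
Proof.
move=> a0; rewrite /pker ler_pdivrMr ?ltr_wpDr ?sqr_ge0 ?exprn_gt0//.
by rewrite mulrDr expr2 mulKf ?gt_eqF// lerDl mulr_ge0 ?sqr_ge0// invr_ge0 ltW.
Qed.

Lemma pker_le_shrink x r v : 0 <= r -> r < x / 2 -> pker (x - r) v <= 4 * pker x v.
Proof.
move=> r0 rx; have x0 : 0 < x by lra.
apply: pker_leM => //; first by lra.
have H : x ^+ 2 + v ^+ 2 <= 4 * ((x - r) ^+ 2 + v ^+ 2).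
  have : x ^+ 2 <= (2 * (x - r)) ^+ 2 by rewrite ler_sqr ?nnegrE; lra.
  by have := sqr_ge0 v; rewrite exprMn; lra.
apply: (@le_trans _ _ (x * (4 * ((x - r) ^+ 2 + v ^+ 2)))); last by lra.
by apply: ler_pM => //; [lra|rewrite addr_ge0 ?sqr_ge0|lra].
Qed.

Lemma pker_le_widen x t v : 0 < x -> 0 <= t -> t <= x -> pker (x + t) v <= 2 * pker x v.
Proof.
move=> x0 t0 tx; apply: pker_leM => //; first by lra.
apply: ler_pM; [lra|by rewrite addr_ge0 ?sqr_ge0|lra|].
by rewrite lerD2r ler_sqr ?nnegrE; lra.
Qed.

Lemma pker_le_translate x v w : `|v - w| <= x -> 0 < x -> pker x v <= 3 * pker x w.
Proof.
move=> vwx x0; apply: pker_leM => //.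
rewrite [3 * x]mulrC -mulrA ler_wpM2l ?(ltW x0)//.
have : (v - w) ^+ 2 <= x ^+ 2 by rewrite -(real_normK (num_real (v - w))) ler_sqr ?nnegrE// ltW.
have := sqr_ge0 (2 * v - w).
rewrite (_ : (2 * v - w) ^+ 2 = 4 * v ^+ 2 - 4 * (v * w) + w ^+ 2); last by ring.
rewrite (_ : (v - w) ^+ 2 = v ^+ 2 - 2 * (v * w) + w ^+ 2); last by ring.
move: (v * w) (sqr_ge0 v) => vw; lra.
Qed.

(** The difference of the two sides is the square (x t + x' s)^2 divided by the
    three denominators. It replaces the semigroup identity for Poisson kernels: it
    is pointwise, hence can be integrated against any measure, and it loses a factor
    2 only. *)
Lemma pker_pker_le x x' s t : 0 < x -> 0 < x' ->
  pker x s * pker x' t <= pker (x + x') (s - t) * (pker x s + pker x' t).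
Proof.
move=> x0 x'0.
have d1 : 0 < x ^+ 2 + s ^+ 2 by rewrite ltr_wpDr ?sqr_ge0// exprn_gt0.
have d2 : 0 < x' ^+ 2 + t ^+ 2 by rewrite ltr_wpDr ?sqr_ge0// exprn_gt0.
have d3 : 0 < (x + x') ^+ 2 + (s - t) ^+ 2.
  by rewrite ltr_wpDr ?sqr_ge0// exprn_gt0// addr_gt0.
rewrite -subr_ge0 /pker.
rewrite (_ : _ - _ = (x * t + x' * s) ^+ 2 /
  ((x ^+ 2 + s ^+ 2) * (x' ^+ 2 + t ^+ 2) * ((x + x') ^+ 2 + (s - t) ^+ 2))).
  by rewrite divr_ge0 ?sqr_ge0// !mulr_ge0// ltW.
by field; rewrite !gt_eqF.
Qed.

Local Notation mu := (@lebesgue_measure R).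

Lemma measurable_pker_line a y : measurable_fun setT (fun u : R => pker a (y - u)).
Proof. by apply: measurable_pker => //; exact: measurable_funB. Qed.

Lemma integral_pker_pker x x' y y' : 0 < x -> 0 < x' ->
  (\int[mu]_u (pker x (y - u) * pker x' (y' - u))%:E <=
   (2 * pi * pker (x + x') (y - y'))%:E)%E.
Proof.
move=> x0 x'0; set P := pker (x + x') (y - y').
have P0 : 0 <= P by rewrite ltW// pker_gt0// addr_gt0.
have p0 u : (0 <= (pker x (y - u))%:E)%E by rewrite lee_fin ltW// pker_gt0.
have p'0 u : (0 <= (pker x' (y' - u))%:E)%E by rewrite lee_fin ltW// pker_gt0.
have mp : measurable_fun setT (fun u => (pker x (y - u))%:E).
  by apply/measurable_EFinP; exact: measurable_pker_line.
have mp' : measurable_fun setT (fun u => (pker x' (y' - u))%:E).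
  by apply/measurable_EFinP; exact: measurable_pker_line.
have -> : (2 * pi * P)%:E = (P%:E * (pi%:E + pi%:E))%E.
  by rewrite -EFinD -EFinM; congr EFin; ring.
rewrite -{1}(integral_pker y x0) -(integral_pker y' x'0).
rewrite -(ge0_integralD mu measurableT (fun u _ => p0 u) mp (fun u _ => p'0 u) mp').
rewrite -(ge0_integralZl_EFin mu measurableT _ _ P0); last 2 first.
- by move=> u _; rewrite adde_ge0.
- exact: emeasurable_funD.
apply: (ge0_le_integral mu measurableT).
- by move=> u _; rewrite lee_fin mulr_ge0// ltW// pker_gt0.
- by apply/measurable_EFinP; apply: measurable_funM; exact: measurable_pker_line.
- by apply: measurable_funeM; exact: emeasurable_funD.
- move=> u _; rewrite -EFinD -EFinM lee_fin.
  rewrite (le_trans (pker_pker_le _ _ x0 x'0))//.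
  by rewrite (_ : y - u - (y' - u) = y - y')//; ring.
Qed.

End PoissonKernelInequalities.

(** * Embedding of waves for a finite Carleson measure *)

Section ProductMeasure.
Context d1 d2 (T1 : measurableType d1) (T2 : measurableType d2) (R : realType).
Variables (m1 : {sigma_finite_measure set T1 -> \bar R})
  (m2 : {sigma_finite_measure set T2 -> \bar R}).

(** An alias of the product measure, to which the structure of a sigma-finite
    measure is attached. *)
Definition sigma_finite_prod : set (T1 * T2) -> \bar R := (m1 \x m2)%E.

HB.instance Definition _ := Measure.copy sigma_finite_prod (m1 \x m2)%E.

Let sigma_finite_prodT : sigma_finite setT sigma_finite_prod.
Proof.
have /sigma_finiteP[F [FT ndF Foo]] := sigma_finiteT m1.
have /sigma_finiteP[G [GT ndG Goo]] := sigma_finiteT m2.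
exists (fun n => F n `*` G n) => [|n].
  apply/esym/seteqP; split => // -[x y] _.
  have [k _ Fkx] : (\bigcup_n F n) x by rewrite -FT.
  have [l _ Gly] : (\bigcup_n G n) y by rewrite -GT.
  exists (k + l)%N => //; split => /=.
    by move/subsetPset : (ndF _ _ (leq_addr l k)); exact.
  by move/subsetPset : (ndG _ _ (leq_addl k l)); exact.
have [mF Fn] := Foo n; have [mG Gn] := Goo n.
split; first exact: measurableX.
rewrite /sigma_finite_prod product_measure1E//.
by apply: lte_mul_pinfty => //; rewrite ge0_fin_numE.
Qed.

HB.instance Definition _ := Measure_isSigmaFinite.Build _ _ _
  sigma_finite_prod sigma_finite_prodT.

End ProductMeasure.

Lemma integral_if_cst d (T : measurableType d) (R : realType)
    (m : {measure set T -> \bar R}) (b : T -> bool) (k : R) :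
  measurable_fun setT b ->
  (\int[m]_x (if b x then k else 0)%:E = k%:E * m [set x | b x])%E.
Proof.
move=> mb; have mB : measurable [set x | b x].
  by have := mb measurableT [set true] I; rewrite setTI.
rewrite -(integral_cst m mB) [RHS]integral_mkcond.
apply: eq_integral => x _; rewrite patchE.
by case: ifPn => [bx|/negPf bx]; [rewrite mem_set|rewrite memNset//= bx].
Qed.

Lemma lebesgue_measure_window (R : realType) (y s : R) : 0 < s ->
  lebesgue_measure (`]y - s, y + s[%classic : set R) = (2 * s)%:E.
Proof.
move=> s0; rewrite lebesgue_measure_itv/= lte_fin ifT; last by lra.
by rewrite -EFinB; congr EFin; ring.
Qed.

Section CarlesonWave.
Context {R : realType}.
Local Notation mu := (@lebesgue_measure R).
Local Notation T := (measurableTypeR R).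
Local Notation TT := (measurableTypeR R * measurableTypeR R)%type.

(** The Carleson square over the interval ]u - s, u + s[; centre and half-length
    are its coordinates in the averaging argument below. *)
Definition half_strip_square (u s : R) : set TT :=
  [set p | 0 <= p.1 < 2 * s /\ `|p.2 - u| < s].

Variables (nut : {sigma_finite_measure set T -> \bar R}) (V : R -> R) (K : R).
Hypothesis mV : measurable_fun setT V.
Hypothesis V_gt0 : forall x : R, 0 < x -> 0 < V x.
Hypothesis V_ge0 : forall x : R, 0 <= V x.
Hypothesis V_le : forall x y : R, 0 < x -> x <= y -> V x <= V y.
Hypothesis nutV : forall x : R, 0 < x -> nut `[0, x[%classic = (V x)%:E.
Hypothesis K_gt0 : 0 < K.
Hypothesis V_doubling : forall x : R, 0 < x -> V (2 * x) <= K * V x.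

Variables (m : {finite_measure set TT -> \bar R}) (C : R).
Hypothesis C_gt0 : 0 < C.
Hypothesis m_carleson : forall u s : R, 0 < s ->
  (m (half_strip_square u s) <= (C * (2 * s * V (2 * s)))%:E)%E.

Variable delta : R.
Hypothesis delta_gt0 : 0 < delta.

(** The Poisson kernel bounds the wave at (x,y) by its values on the line of
    abscissa r < x. Averaging over r < x / 2 with respect to nut gives a bound by an
    integral for nut \x mu, with this kernel up to a constant. The cut-off at delta
    ensures the finiteness that TTstar_test asks for. *)
Definition avg_kernel (p : (R * R) * (R * R)) : R :=
  if [&& delta <= p.1.1, 0 <= p.2.1 & p.2.1 < p.1.1 / 2]
  then pker p.1.1 (p.1.2 - p.2.2) / V (p.1.1 / 2) else 0.

(** The majorant a of TTstar_test: by pker_pker_le the sum of the abscissae appears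
    when two Poisson kernels are integrated against each other. *)
Definition sum_kernel (p : (R * R) * (R * R)) : R :=
  if (delta <= p.1.1) && (delta <= p.2.1)
  then pker (p.1.1 + p.2.1) (p.1.2 - p.2.2) / V (Num.max p.1.1 p.2.1 / 2) else 0.

(** For w below z the factor V does not depend on w, and the Poisson kernel at
    abscissa x + w.1 is comparable to the one at abscissa x: only the position of w
    along the vertical direction is left. *)
Definition low_kernel (p : (R * R) * (R * R)) : R :=
  if p.2.1 <= p.1.1 then sum_kernel p else 0.

Let m11 : measurable_fun setT (fun p : TT * TT => p.1.1 : R).
Proof. exact: measurableT_comp. Qed.
Let m12 : measurable_fun setT (fun p : TT * TT => p.1.2 : R).
Proof. exact: measurableT_comp. Qed.
Let m21 : measurable_fun setT (fun p : TT * TT => p.2.1 : R).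
Proof. exact: measurableT_comp. Qed.
Let m22 : measurable_fun setT (fun p : TT * TT => p.2.2 : R).
Proof. exact: measurableT_comp. Qed.

Lemma measurable_avg_kernel : measurable_fun setT (avg_kernel : TT * TT -> R).
Proof.
apply: measurable_fun_ifT => //.
  apply: measurable_and; first exact: measurable_fun_ler.
  apply: measurable_and; first exact: measurable_fun_ler.
  by apply: measurable_fun_ltr => //; exact: measurable_funM.
apply: measurable_funM.
  by apply: measurable_pker => //; exact: measurable_funB.
apply: measurable_fun_ge0V => //.
by apply: (measurableT_comp mV (g := fun p : TT * TT => p.1.1 / 2)); exact: measurable_funM.
Qed.

Lemma measurable_sum_kernel : measurable_fun setT (sum_kernel : TT * TT -> R).
Proof.
apply: measurable_fun_ifT => //.
  by apply: measurable_and; exact: measurable_fun_ler.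
apply: measurable_funM.
  by apply: measurable_pker; [exact: measurable_funD|exact: measurable_funB].
apply: measurable_fun_ge0V => //.
apply: (measurableT_comp mV (g := fun p : TT * TT => Num.max p.1.1 p.2.1 / 2)).
by apply: measurable_funM => //; exact: measurable_maxr.
Qed.

Lemma measurable_low_kernel : measurable_fun setT (low_kernel : TT * TT -> R).
Proof.
apply: measurable_fun_ifT => //; first exact: measurable_fun_ler.
exact: measurable_sum_kernel.
Qed.

Lemma avg_kernel_ge0 p : 0 <= avg_kernel p.
Proof.
rewrite /avg_kernel; case: ifPn => // /and3P[dp _ _].
by rewrite divr_ge0// ltW// pker_gt0// (lt_le_trans delta_gt0).
Qed.

Lemma sum_kernel_ge0 p : 0 <= sum_kernel p.
Proof.
rewrite /sum_kernel; case: ifPn => // /andP[dp dp'].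
by rewrite divr_ge0// ltW// pker_gt0// addr_gt0// (lt_le_trans delta_gt0).
Qed.

Lemma low_kernel_ge0 p : 0 <= low_kernel p.
Proof. by rewrite /low_kernel; case: ifPn => // _; exact: sum_kernel_ge0. Qed.

Lemma sum_kernelC z z' : sum_kernel (z, z') = sum_kernel (z', z).
Proof.
rewrite /sum_kernel/= andbC; case: ifPn => // _.
by rewrite [z.1 + _]addrC maxC -[z.2 - _]opprB /pker sqrrN.
Qed.

Lemma sum_kernel_le_low z z' :
  sum_kernel (z, z') <= low_kernel (z, z') + low_kernel (z', z).
Proof.
rewrite /low_kernel/= [sum_kernel (z', z)]sum_kernelC.
have s0 := sum_kernel_ge0 (z, z').
case: ifPn => [_|]; first by rewrite lerDl; case: ifP.
by rewrite -ltNge => /ltW ->; rewrite add0r.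
Qed.

Lemma sum_kernel_le z z' : sum_kernel (z, z') <= (delta * V (delta / 2))^-1.
Proof.
rewrite /sum_kernel/=; case: ifPn => [/andP[dz dz']|_]; last first.
  by rewrite invr_ge0 mulr_ge0// ltW.
have d2 : 0 < delta / 2 by rewrite divr_gt0.
have z0 : 0 < z.1 + z'.1 by rewrite addr_gt0// (lt_le_trans delta_gt0).
rewrite invfM ler_pM ?invr_ge0//.
- by rewrite ltW// pker_gt0.
- rewrite (le_trans (pker_le_inv _ z0))// lef_pV2 ?posrE//.
  by rewrite (le_trans dz)// lerDl (le_trans (ltW delta_gt0)).
- have dm : delta / 2 <= Num.max z.1 z'.1 / 2.
    by rewrite ler_pM2r ?invr_gt0// le_max dz.
  by rewrite lef_pV2 ?posrE ?V_le ?V_gt0// (lt_le_trans d2).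
Qed.

Let nutI (x : R) : 0 < x ->
  (\int[nut]_r (if (0 <= r) && (r < x) then 1 else 0 : R)%:E = (V x)%:E)%E.
Proof.
move=> x0; rewrite integral_if_cst; last first.
  by apply: measurable_and; [exact: measurable_fun_ler|exact: measurable_fun_ltr].
by rewrite mul1e -nutV.
Qed.

(** By integral_pker_pker the vertical integral of the product is a multiple of
    the kernel of the sum; the integral in r runs up to the smaller of x / 2 and
    x' / 2, whose mass cancels one of the two factors V. *)
Lemma avg_kernel_avg_kernel z z' :
  (\int[nut \x mu]_w (avg_kernel (z, w) * avg_kernel (z', w))%:E <=
   (2 * pi)%:E * (sum_kernel (z, z'))%:E)%E.
Proof.
have ma z0 : measurable_fun setT (fun w : TT => avg_kernel (z0, w)).
  exact: (measurableT_comp measurable_avg_kernel (measurable_pair1 (z0 : TT))).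
have maa : measurable_fun setT
    (fun w : TT => (avg_kernel (z, w) * avg_kernel (z', w))%:E).
  by apply/measurable_EFinP; apply: measurable_funM; exact: ma.
have aa0 (w : TT) : (0 <= (avg_kernel (z, w) * avg_kernel (z', w))%:E)%E.
  by rewrite lee_fin mulr_ge0 ?avg_kernel_ge0.
rewrite fubini_tonelli1//= /fubini_F.
have [dzz|ndz] := boolP ((delta <= z.1) && (delta <= z'.1)); last first.
  rewrite integral0_eq ?mule_ge0 ?lee_fin ?sum_kernel_ge0 ?mulr_ge0 ?pi_ge0//.
  move=> r _; apply: integral0_eq => u _; rewrite /avg_kernel/=.
  by move: ndz; rewrite negb_and => /orP[|] /negPf ->; rewrite ?mul0r ?mulr0.
have /andP[dz dz'] := dzz.
have z0 : 0 < z.1 by rewrite (lt_le_trans delta_gt0).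
have z'0 : 0 < z'.1 by rewrite (lt_le_trans delta_gt0).
pose M := Num.min z.1 z'.1.
have M0 : 0 < M / 2 by rewrite divr_gt0// lt_min z0.
pose P := pker (z.1 + z'.1) (z.2 - z'.2).
have P0 : 0 <= P by rewrite ltW// pker_gt0// addr_gt0.
have Vz : 0 < V (z.1 / 2) by rewrite V_gt0// divr_gt0.
have Vz' : 0 < V (z'.1 / 2) by rewrite V_gt0// divr_gt0.
pose B := (V (z.1 / 2) * V (z'.1 / 2))^-1 * (2 * pi * P).
have B0 : 0 <= B.
  apply: mulr_ge0; first by rewrite invr_ge0 mulr_ge0// ltW.
  by rewrite mulr_ge0// mulr_ge0// pi_ge0.
apply: (@le_trans _ _ (\int[nut]_r
    (B%:E * (if (0 <= r)%R && (r < M / 2)%R then 1 else 0 : R)%:E))%E).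
  apply: (ge0_le_integral nut measurableT).
  - by move=> r _; apply: integral_ge0 => u _; exact: aa0.
  - exact: (measurable_fun_fubini_tonelli_F (m2 := mu) _ maa aa0).
  - apply: measurable_funeM; apply/measurable_EFinP; apply: measurable_fun_ifT => //.
    by apply: measurable_and; [exact: measurable_fun_ler|exact: measurable_fun_ltr].
  - move=> r _; case: ifPn => [/andP[r0 rM]|rM]; last first.
      rewrite mule0 integral0_eq// => u _; rewrite /avg_kernel/= dz dz'/=.
      case: ifPn; rewrite ?mul0r// => /andP[r0 rz].
      case: ifPn; rewrite ?mulr0// => /andP[_ rz'].
      by move: rM; rewrite r0 -(ltr_pM2r (ltr0Sn R 1)) divfK ?pnatr_eq0// lt_min;
         rewrite -!ltr_pdivlMr// rz rz'.
    have rz : r < z.1 / 2.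
      by rewrite (lt_le_trans rM)// ler_pM2r ?invr_gt0// ge_min lexx.
    have rz' : r < z'.1 / 2.
      by rewrite (lt_le_trans rM)// ler_pM2r ?invr_gt0// ge_min lexx orbT.
    rewrite mule1 /B EFinM.
    have VV0 : 0 <= (V (z.1 / 2) * V (z'.1 / 2))^-1.
      by rewrite invr_ge0 mulr_ge0// ltW.
    apply: le_trans (lee_wpmul2l _ (integral_pker_pker z.2 z'.2 z0 z'0)).
      2: by rewrite lee_fin.
    rewrite -(ge0_integralZl_EFin mu measurableT _ _ VV0); last 2 first.
    + by move=> u _; rewrite lee_fin mulr_ge0// ltW// pker_gt0.
    + by apply/measurable_EFinP; apply: measurable_funM; exact: measurable_pker_line.
    rewrite le_eqVlt; apply/orP; left; apply/eqP; apply: eq_integral => u _.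
    rewrite -EFinM; congr EFin; rewrite /avg_kernel/= dz dz' r0 rz rz'/=.
    by field; rewrite !gt_eqF.
rewrite ge0_integralZl_EFin//; last 2 first.
- by move=> r _; rewrite lee_fin; case: ifP.
- apply/measurable_EFinP; apply: measurable_fun_ifT => //.
  by apply: measurable_and; [exact: measurable_fun_ler|exact: measurable_fun_ltr].
rewrite nutI// -!EFinM lee_fin le_eqVlt; apply/orP; left; apply/eqP.
rewrite /sum_kernel/= dz dz'/= -/P /B /M.
have [zz'|zz'] := leP z.1 z'.1; field.
  by rewrite !gt_eqF.
by rewrite !gt_eqF.
Qed.

Let C2 : R := 72 * pi * C * K ^+ 2.

Lemma C2_gt0 : 0 < C2.
Proof. by rewrite !mulr_gt0 ?exprn_gt0 ?pi_gt0. Qed.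

Lemma V_quadruple (x : R) : 0 < x -> V (2 * x) <= K ^+ 2 * V (x / 2).
Proof.
move=> x0; apply: (le_trans (V_doubling x0)).
rewrite expr2 -mulrA ler_wpM2l ?(ltW K_gt0)//.
have : V (2 * (x / 2)) <= K * V (x / 2) by apply: V_doubling; rewrite divr_gt0.
by rewrite mulrC divfK ?pnatr_eq0.
Qed.

Let inQ (u s : R) (z : TT) : bool :=
  [&& 0 <= z.1, z.1 < 2 * s & `|z.2 - u| < s].

Let measurable_inQ (s : R) :
  measurable_fun setT (fun p : TT * T => inQ p.2 s p.1).
Proof.
have m1 : measurable_fun setT (fun p : TT * T => p.1.1 : R) by exact: measurableT_comp.
have m2 : measurable_fun setT (fun p : TT * T => p.1.2 : R) by exact: measurableT_comp.
apply: measurable_and; first exact: measurable_fun_ler.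
apply: measurable_and; first exact: measurable_fun_ltr.
apply: measurable_fun_ltr => //; apply: measurableT_comp => //.
by apply: measurable_funB => //; exact: measurable_snd.
Qed.

Let low_kernel_low_kernel_wlog (z z' : TT) : z'.1 <= z.1 ->
  (\int[m]_w (low_kernel (z, w) * low_kernel (z', w))%:E <=
   C2%:E * (sum_kernel (z, z'))%:E)%E.
Proof.
move=> zz'.
have [dzz|ndz] := boolP ((delta <= z.1) && (delta <= z'.1)); last first.
  rewrite integral0_eq ?mule_ge0 ?lee_fin ?sum_kernel_ge0 ?(ltW C2_gt0)//.
  move=> w _; rewrite /low_kernel/sum_kernel/=.
  by move: ndz; rewrite negb_and => /orP[|] /negPf ->/=; rewrite !if_same ?mul0r ?mulr0.
have /andP[dz dz'] := dzz.
have z0 : 0 < z.1 by rewrite (lt_le_trans delta_gt0).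
have z'0 : 0 < z'.1 by rewrite (lt_le_trans delta_gt0).
have Vz : 0 < V (z.1 / 2) by rewrite V_gt0// divr_gt0.
have Vz' : 0 < V (z'.1 / 2) by rewrite V_gt0// divr_gt0.
pose pp (u : R) := pker z.1 (z.2 - u) * pker z'.1 (z'.2 - u).
have pp0 u : 0 <= pp u by rewrite mulr_ge0// ltW// pker_gt0.
have mpp : measurable_fun setT pp.
  by apply: measurable_funM; exact: measurable_pker_line.
(* 36 = (2 * 2) * (3 * 3): both kernels are widened, then translated *)
pose A := 36 / (2 * z'.1 * V (z.1 / 2) * V (z'.1 / 2)).
have A0 : 0 <= A by rewrite divr_ge0// !mulr_ge0// ltW.
pose Phi (p : TT * T) : R := if inQ p.2 z'.1 p.1 then A * pp p.2 else 0.
have Phi0 p : (0 <= (Phi p)%:E)%E.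
  by rewrite lee_fin /Phi; case: ifP => // _; rewrite mulr_ge0.
have mPhi : measurable_fun setT (fun p => (Phi p)%:E).
  apply/measurable_EFinP; apply: measurable_fun_ifT => //.
  apply: measurable_funM => //.
  by apply: (measurableT_comp mpp); exact: measurable_snd.
have ml (q : TT) : measurable_fun setT (fun w : TT => low_kernel (q, w)).
  exact: (measurableT_comp measurable_low_kernel (measurable_pair1 (q : TT))).
apply: (@le_trans _ _ (\int[m]_w \int[mu]_u (Phi (w, u))%:E)%E).
  apply: (ge0_le_integral m measurableT).
  - by move=> w _; rewrite lee_fin mulr_ge0// low_kernel_ge0.
  - by apply/measurable_EFinP; apply: measurable_funM; exact: ml.
  - exact: (measurable_fun_fubini_tonelli_F (m2 := mu) _ mPhi Phi0).
  - move=> w _.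
    have [dw|dw] := boolP ((delta <= w.1) && (w.1 <= z'.1)); last first.
      rewrite (_ : low_kernel (z, w) * low_kernel (z', w) = 0); last first.
        rewrite /low_kernel/sum_kernel/=.
        move: dw; rewrite negb_and => /orP[|] /negPf ->/=; last by rewrite mulr0.
        by rewrite !andbF !if_same mul0r.
      by apply: integral_ge0 => u _; exact: Phi0.
    have /andP[dw1 wz'] := dw.
    have w0 : 0 < w.1 by rewrite (lt_le_trans delta_gt0).
    have wz : w.1 <= z.1 by exact: le_trans zz'.
    have lowE : low_kernel (z, w) * low_kernel (z', w) <= 2 * z'.1 * (A / 9 * pp w.2).
      rewrite /low_kernel/sum_kernel/= wz wz' dz dz' dw1/=.
      rewrite (max_l wz) (max_l wz').
      have -> : 2 * z'.1 * (A / 9 * pp w.2) =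
         2 * pker z.1 (z.2 - w.2) / V (z.1 / 2) *
         (2 * pker z'.1 (z'.2 - w.2) / V (z'.1 / 2)).
        by rewrite /A /pp; field; rewrite !gt_eqF.
      apply: ler_pM.
      + by rewrite divr_ge0// ltW// pker_gt0// addr_gt0.
      + by rewrite divr_ge0// ltW// pker_gt0// addr_gt0.
      + by rewrite ler_wpM2r ?invr_ge0// pker_le_widen// ltW.
      + by rewrite ler_wpM2r ?invr_ge0// pker_le_widen// ltW.
    apply: (@le_trans _ _ (\int[mu]_u
        (if `|w.2 - u| < z'.1 then A / 9 * pp w.2 else 0)%:E)%E).
      rewrite integral_if_cst; last first.
        apply: measurable_fun_ltr => //; apply: measurableT_comp => //.
        exact: measurable_funB.
      rewrite [X in (_ <= _ * X)%E](_ : _ = (2 * z'.1)%:E).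
        by rewrite -EFinM lee_fin [leRHS]mulrC.
      rewrite -(lebesgue_measure_window w.2 z'0).
      rewrite (_ : [set x | _] = `]w.2 - z'.1, (w.2 : R) + z'.1[%classic)//.
      by apply/seteqP; split => u; rewrite /= in_itv/= distrC ltr_distl.
    apply: (ge0_le_integral mu measurableT).
    + by move=> u _; rewrite lee_fin; case: ifP => // _; rewrite mulr_ge0// divr_ge0.
    + apply/measurable_EFinP; apply: measurable_fun_ifT => //.
      apply: measurable_fun_ltr => //; apply: measurableT_comp => //.
      exact: measurable_funB.
    + exact: (measurableT_comp mPhi (measurable_pair1 w)).
    + move=> u _; rewrite lee_fin /Phi /inQ/= (ltW w0).
      have -> : w.1 < 2 * z'.1.
        by rewrite (le_lt_trans wz')// ltr_pMl// ltr1n.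
      case: ifPn => //= wu; rewrite -mulrA ler_wpM2l// mulrC ler_pdivrMr//.
      rewrite /pp (_ : _ * _ * 9 = (3 * pker z.1 (z.2 - u)) * (3 * pker z'.1 (z'.2 - u))); last by ring.
      have wuE (y : R) : `|y - w.2 - (y - u)| = `|w.2 - u|.
        by rewrite distrC; congr `|_|; ring.
      apply: ler_pM.
      * by rewrite ltW// pker_gt0.
      * by rewrite ltW// pker_gt0.
      * by apply: pker_le_translate => //; rewrite wuE (le_trans (ltW wu)).
      * by apply: pker_le_translate => //; rewrite wuE ltW.
rewrite (fubini_tonelli (m1 := m) (m2 := mu) _ mPhi Phi0).
have B0 : 0 <= A * (C * (2 * z'.1 * V (2 * z'.1))).
  by rewrite mulr_ge0// mulr_ge0 ?(ltW C_gt0)// !mulr_ge0// ltW.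
apply: (@le_trans _ _ (\int[mu]_u
    ((A * (C * (2 * z'.1 * V (2 * z'.1))))%:E * (pp u)%:E))%E).
  apply: (ge0_le_integral mu measurableT).
  - by move=> u _; apply: integral_ge0 => w _; exact: Phi0.
  - exact: (measurable_fun_fubini_tonelli_G (m1 := m) _ mPhi Phi0).
  - by apply: measurable_funeM; exact/measurable_EFinP.
  - move=> u _; rewrite /Phi/= integral_if_cst; last first.
      exact: (measurableT_comp (measurable_inQ z'.1) (measurable_pair2 u)).
    rewrite (_ : [set x | _] = half_strip_square u z'.1); last first.
      apply/seteqP; split => x; rewrite /inQ /half_strip_square/=.
        by move=> /and3P[-> -> ->].
      by move=> [/andP[-> ->] ->].
    apply: le_trans (lee_wpmul2l _ (m_carleson u z'0)) _.
      by rewrite lee_fin mulr_ge0.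
    by rewrite -!EFinM lee_fin le_eqVlt; apply/orP; left; apply/eqP; ring.
rewrite ge0_integralZl_EFin//; last 2 first.
- by move=> u _; rewrite lee_fin.
- exact/measurable_EFinP.
apply: le_trans (lee_wpmul2l _ (integral_pker_pker z.2 z'.2 z0 z'0)) _.
  by rewrite lee_fin.
rewrite -!EFinM lee_fin /sum_kernel/= dz dz'/= (max_l zz').
set P := pker _ _; have P0 : 0 <= P by rewrite ltW// pker_gt0// addr_gt0.
rewrite (_ : C2 * (P / V (z.1 / 2)) =
  A * (C * (2 * z'.1 * (K ^+ 2 * V (z'.1 / 2)))) * (2 * pi * P)); last first.
  by rewrite /C2 /A; field; rewrite !gt_eqF.
apply: ler_wpM2r; first by rewrite mulr_ge0// mulr_ge0// pi_ge0.
apply: ler_wpM2l => //; apply: ler_wpM2l; first exact: ltW.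
apply: ler_wpM2l; first by rewrite mulr_ge0// ltW.
exact: V_quadruple.
Qed.

(** The Carleson condition enters the estimates here. The kernels are almost constant at the scale x' of the lower point, so that the integral for m
    is an average over translates of integrals over squares of side 2 x'; there m
    may be replaced by its bound, which leaves a Lebesgue integral of a product of
    two Poisson kernels. *)
Lemma low_kernel_low_kernel (z z' : TT) :
  (\int[m]_w (low_kernel (z, w) * low_kernel (z', w))%:E <=
   C2%:E * (sum_kernel (z, z'))%:E)%E.
Proof.
have [|/ltW] := leP z'.1 z.1; first exact: low_kernel_low_kernel_wlog.
move=> /low_kernel_low_kernel_wlog; rewrite sum_kernelC.
by under eq_integral do rewrite mulrC.
Qed.

(** For a real f supported on the half-line, with c = 0 and c = pi / 2, these are the
    real part and the opposite of the imaginary part of the Laplace transform of f. *)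
Definition damped_wave (f : R -> R) (c : R) (p : R * R) : R :=
  wave (fun t => expR (- (p.1 * `|t|)) * f t) c p.2.

Lemma measurable_damped_wave (f : R -> R) (c : R) : measurable_fun setT f ->
  measurable_fun setT (damped_wave f c : TT -> R).
Proof.
move=> mf; apply: (measurable_integral2 mu
  (h := fun q : TT * T => cos (q.2 * q.1.2 - c) * (expR (- (q.1.1 * `|q.2|)) * f q.2))).
have m1 : measurable_fun setT (fun p : TT * T => p.1.1 : R) by exact: measurableT_comp.
have m2 : measurable_fun setT (fun p : TT * T => p.1.2 : R) by exact: measurableT_comp.
have m3 : measurable_fun setT (fun p : TT * T => p.2 : R) by exact: measurable_snd.
apply: measurable_funM.
  apply: (measurableT_comp (continuous_measurable_fun (@continuous_cos R))).
  by apply: measurable_funB => //; exact: measurable_funM.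
apply: measurable_funM; last exact: (measurableT_comp mf m3).
apply: (measurableT_comp (@measurable_expR R)); apply: measurableT_comp => //.
by apply: measurable_funM => //; exact: measurableT_comp.
Qed.

Variables (f : R -> R) (c : R).
Hypothesis If : mu.-integrable setT (EFin \o f).

Let mf : measurable_fun setT f.
Proof. by apply/measurable_EFinP; exact: measurable_int If. Qed.

Lemma integrable_damped (r : R) : 0 <= r ->
  mu.-integrable setT (EFin \o (fun t => expR (- (r * `|t|)) * f t)).
Proof.
move=> r0; apply: integrable_bounded_mul => // [|t]; first exact: measurable_expR_abs.
by rewrite ger0_norm ?expR_ge0// expR_le1 oppr_le0 mulr_ge0.
Qed.

Lemma norm_damped_wave_le (p : R * R) : 0 <= p.1 ->
  `|damped_wave f c p| <= \int[mu]_t `|f t|.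
Proof.
move=> p0; apply: (le_trans (norm_wave_le c p.2 (integrable_damped p0))).
have I1 := integrable_norm (integrable_damped p0).
apply: le_Rintegral => //; first exact: integrable_norm.
move=> t _; rewrite normrM ler_piMl// ger0_norm ?expR_ge0//.
by rewrite expR_le1 oppr_le0 mulr_ge0.
Qed.

(** The wave is harmonic on the half-plane, hence its values at abscissa x are
    Poisson integrals of those at abscissa r. *)
Lemma damped_wave_poisson_le (r x y : R) : 0 <= r -> r < x ->
  ((pi * `|damped_wave f c (x, y)|)%:E <=
   \int[mu]_u (pker (x - r) (y - u) * `|damped_wave f c (r, u)|)%:E)%E.
Proof.
move=> r0 rx; have xr0 : 0 < x - r by rewrite subr_gt0.
have fE : (fun t => expR (- ((x - r) * `|t|)) * (expR (- (r * `|t|)) * f t)) =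
          (fun t => expR (- (x * `|t|)) * f t).
  by apply/funext => t; rewrite mulrA -expRD; congr (expR _ * _); ring.
have H := norm_wave_poisson_le c y xr0 (integrable_damped r0).
by rewrite fE in H; exact: H.
Qed.

Let g (z : TT) : R := if delta <= z.1 then `|damped_wave f c z| else 0.
Let h (w : TT) : R := if 0 <= w.1 then `|damped_wave f c w| else 0.

Let mdw : measurable_fun setT (fun z : TT => `|damped_wave f c z|).
Proof. by apply: measurableT_comp => //; exact: (measurable_damped_wave c mf). Qed.

Let mg : measurable_fun setT g.
Proof. by apply: measurable_fun_ifT => //; exact: measurable_fun_ler. Qed.

Let mh : measurable_fun setT h.
Proof. by apply: measurable_fun_ifT => //; exact: measurable_fun_ler. Qed.

Let g_ge0 z : 0 <= g z. Proof. by rewrite /g; case: ifP. Qed.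
Let h_ge0 w : 0 <= h w. Proof. by rewrite /h; case: ifP. Qed.

Let g_le_avg z : ((g z)%:E <= (4 / pi)%:E *
  \int[nut \x mu]_w ((avg_kernel (z, w))%:E * (h w)%:E))%E.
Proof.
have a0 w : (0 <= (avg_kernel (z, w))%:E * (h w)%:E)%E.
  by rewrite mule_ge0 ?lee_fin ?avg_kernel_ge0.
have pi0 : 0 < pi :> R := pi_gt0 R.
rewrite {1}/g; case: ifPn => [dz|_]; last first.
  apply: mule_ge0; first by rewrite lee_fin divr_ge0// ltW.
  by apply: integral_ge0 => w _; exact: a0.
have z0 : 0 < z.1 by rewrite (lt_le_trans delta_gt0).
have z20 : 0 < z.1 / 2 by rewrite divr_gt0.
have Vz : 0 < V (z.1 / 2) by rewrite V_gt0.
have ma : measurable_fun setT (fun w : TT => ((avg_kernel (z, w))%:E * (h w)%:E)%E).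
  apply: emeasurable_funM; apply/measurable_EFinP => //.
  exact: (measurableT_comp measurable_avg_kernel (measurable_pair1 (z : TT))).
rewrite fubini_tonelli1//= /fubini_F.
pose B := pi / 4 * `|damped_wave f c z| / V (z.1 / 2).
have B0 : 0 <= B by rewrite divr_ge0// mulr_ge0// divr_ge0// ltW.
have mI : measurable_fun setT
    (fun r : T => (if (0 <= r) && (r < z.1 / 2) then 1 else 0 : R)%:E).
  apply/measurable_EFinP; apply: measurable_fun_ifT => //.
  by apply: measurable_and; [exact: measurable_fun_ler|exact: measurable_fun_ltr].
apply: (@le_trans _ _ ((4 / pi)%:E * (\int[nut]_r
    (B%:E * (if (0 <= r)%R && (r < z.1 / 2)%R then 1 else 0 : R)%:E)))%E).
  rewrite ge0_integralZl_EFin//; last by move=> r _; rewrite lee_fin; case: ifP.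
  rewrite nutI// -!EFinM lee_fin le_eqVlt; apply/orP; left; apply/eqP.
  by rewrite /B; move: (pi : R) pi0 => q q0; field; rewrite !gt_eqF.
apply: lee_wpmul2l; first by rewrite lee_fin divr_ge0// ltW.
apply: (ge0_le_integral nut measurableT).
- by move=> r _; rewrite mule_ge0// lee_fin; case: ifP.
- exact: measurable_funeM.
- exact: (measurable_fun_fubini_tonelli_F (m2 := mu) _ ma a0).
- move=> r _; case: ifPn => [/andP[r0 rz]|_]; last first.
    by rewrite mule0; apply: integral_ge0 => u _; exact: a0.
  have rx : r < z.1 by rewrite (lt_le_trans rz)// ler_pdivrMr// ler_pMr// ler1n.
  rewrite mule1 /B.
  have k0 : 0 <= (4 * V (z.1 / 2))^-1 by rewrite invr_ge0 mulr_ge0// ltW.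
  have -> : (pi / 4 * `|damped_wave f c z| / V (z.1 / 2))%:E =
      ((4 * V (z.1 / 2))^-1%:E * (pi * `|damped_wave f c (z.1, z.2)|)%:E)%E.
    rewrite -EFinM -surjective_pairing; congr EFin.
    by move: (pi : R) => q; field; rewrite gt_eqF.
  apply: (le_trans (lee_wpmul2l _ (damped_wave_poisson_le z.2 r0 rx))).
    by rewrite lee_fin.
  have mdr : measurable_fun setT (fun u : T => `|damped_wave f c (r, u)|).
    exact: (measurableT_comp mdw (measurable_pair1 (r : T))).
  have mpd : measurable_fun setT
      (fun u : T => (pker (z.1 - r) (z.2 - u) * `|damped_wave f c (r, u)|)%:E).
    by apply/measurable_EFinP; apply: measurable_funM => //; exact: measurable_pker_line.
  rewrite -(ge0_integralZl_EFin mu measurableT _ mpd k0); last first.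
    by move=> u _; rewrite lee_fin mulr_ge0// ltW// pker_gt0// subr_gt0.
  apply: (ge0_le_integral mu measurableT).
  + by move=> u _; rewrite -EFinM lee_fin mulr_ge0// mulr_ge0// ltW// pker_gt0// subr_gt0.
  + exact: measurable_funeM.
  + exact: (measurableT_comp ma (measurable_pair1 (r : T))).
  + move=> u _; rewrite -!EFinM lee_fin /avg_kernel /h/= dz r0 rz/=.
    rewrite mulrA ler_wpM2r// invfM mulrAC ler_wpM2r ?invr_ge0//.
    by rewrite mulrC ler_pdivrMr// [leRHS]mulrC pker_le_shrink.
Qed.

(** TTstar_test applied to the modulus of the wave. The finite measure m and the
    cut-off at delta are exhaustions of the general case; neither enters the
    constant. *)
Lemma carleson_wave :
  (\int[m]_z ((if delta <= z.1 then `|damped_wave f c z| else 0) ^+ 2)%:E <=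
   (16 * (4 / pi) ^+ 2 * (2 * pi) * C2)%:E *
   \int[nut \x mu]_w ((if 0 <= w.1 then `|damped_wave f c w| else 0) ^+ 2)%:E)%E.
Proof.
have -> : (\int[m]_z ((if delta <= z.1 then `|damped_wave f c z| else 0) ^+ 2)%:E =
           \int[m]_z ((g z)%:E * (g z)%:E))%E.
  by apply: eq_integral => z _; rewrite -EFinM -expr2.
have -> : (\int[nut \x mu]_w ((if 0 <= w.1 then `|damped_wave f c w| else 0) ^+ 2)%:E =
           \int[nut \x mu]_w ((h w)%:E * (h w)%:E))%E.
  by apply: eq_integral => w _; rewrite -EFinM -expr2.
pose M := \int[mu]_t `|f t|.
have M0 : 0 <= M by apply: Rintegral_ge0.
have gM z : g z <= M.
  rewrite /g; case: ifPn => // dz; apply: norm_damped_wave_le.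
  exact: le_trans (ltW delta_gt0) dz.
have sM z z' := sum_kernel_le z z'.
set D := (delta * V (delta / 2))^-1 in sM.
have D0 : 0 <= D by rewrite invr_ge0 mulr_ge0// ltW.
have fin_cst (k : R) : (\int[m]_z (cst k%:E z) < +oo)%E.
  exact: (integrable_lty measurableT (finite_measure_integrable_cst m k measurableT)).
have mgE : measurable_fun setT (fun z => (g z)%:E) by exact/measurable_EFinP.
have msE : measurable_fun setT (fun p : TT * TT => (sum_kernel p)%:E).
  by apply/measurable_EFinP; exact: measurable_sum_kernel.
have mgs : measurable_fun setT
    (fun p : TT * TT => ((g p.1)%:E * (g p.2)%:E * (sum_kernel p)%:E)%E).
  exact: (emeasurable_funM (emeasurable_funM (measurableT_comp mgE measurable_fst)
    (measurableT_comp mgE measurable_snd)) msE).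
have gs0 (p : TT * TT) : (0 <= (g p.1)%:E * (g p.2)%:E * (sum_kernel p)%:E)%E.
  by rewrite !mule_ge0 ?lee_fin ?sum_kernel_ge0.
have bound := TTstar_test (m := m) (nu := sigma_finite_prod nut mu) (c := 4 / pi) (C1 := 2 * pi) (C2 := C2)
  (k := fun p => (avg_kernel p)%:E)
  (a := fun p => (sum_kernel p)%:E) (k2 := fun p => (low_kernel p)%:E)
  (g := fun z => (g z)%:E) (h := fun w => (h w)%:E).
apply: bound.
- by rewrite divr_gt0// pi_gt0.
- by rewrite mulr_gt0// pi_gt0.
- exact: C2_gt0.
- by apply/measurable_EFinP; exact: measurable_avg_kernel.
- by move=> p; rewrite lee_fin avg_kernel_ge0.
- exact: msE.
- by move=> p; rewrite lee_fin sum_kernel_ge0.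
- by apply/measurable_EFinP; exact: measurable_low_kernel.
- by move=> p; rewrite lee_fin low_kernel_ge0.
- exact: mgE.
- by move=> z; rewrite lee_fin.
- exact/measurable_EFinP.
- by move=> w; rewrite lee_fin.
- exact: g_le_avg.
- by move=> z z'; have := avg_kernel_avg_kernel z z'.
- by move=> z z'; rewrite -EFinD lee_fin sum_kernel_le_low.
- by move=> z z'; have := low_kernel_low_kernel z z'.
- apply: le_lt_trans (fin_cst (M * M)); apply: (ge0_le_integral m measurableT).
  + by move=> z _; rewrite -EFinM lee_fin mulr_ge0.
  + exact: emeasurable_funM.
  + exact: measurable_cst.
  + by move=> z _; rewrite -EFinM lee_fin ler_pM.
- apply: (@le_lt_trans _ _ (\int[m]_z \int[m]_z' (cst (M * M * D)%:E z'))%E).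
    apply: (ge0_le_integral m measurableT).
    + by move=> z _; apply: integral_ge0 => z' _; exact: (gs0 (z, z')).
    + exact: (measurable_fun_fubini_tonelli_F (m2 := m) _ mgs gs0).
    + exact: measurable_cst.
    + move=> z _; apply: (ge0_le_integral m measurableT).
      * by move=> z' _; exact: (gs0 (z, z')).
      * exact: (measurableT_comp mgs (measurable_pair1 (z : TT))).
      * exact: measurable_cst.
      * move=> z' _; rewrite -!EFinM lee_fin; apply: ler_pM.
        - by rewrite mulr_ge0.
        - exact: sum_kernel_ge0.
        - by rewrite ler_pM.
        - exact: sM.
  have := fin_cst (M * M * D); have : (0 <= \int[m]_z (cst (M * M * D)%:E z))%E.
    by apply: integral_ge0 => z _; rewrite lee_fin !mulr_ge0.
  by case: (\int[m]_z _)%E => // r _ _; exact: fin_cst.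
Qed.

End CarlesonWave.

(** * Embedding of waves of finite weighted energy *)

Section WaveEnergy.
Context {R : realType}.
Local Notation mu := (@lebesgue_measure R).
Local Notation T := (measurableTypeR R).
Local Notation TT := (measurableTypeR R * measurableTypeR R)%type.
Variable nut : {sigma_finite_measure set T -> \bar R}.

Let expw (p : TT) : R := if 0 <= p.1 then expR (- (2 * p.1 * p.2)) else 0.

Let expw_ge0 p : 0 <= expw p.
Proof. by rewrite /expw; case: ifP => // _; exact: expR_ge0. Qed.

Let measurable_expw : measurable_fun setT expw.
Proof.
apply: measurable_fun_ifT => //; first exact: measurable_fun_ler.
apply: (measurableT_comp (@measurable_expR R)); apply: measurableT_comp => //.
by apply: measurable_funM => //; exact: measurable_funM.
Qed.

Lemma zen_weightE (t : R) :
  zen_weight nut t = ((2 * pi)%:E * \int[nut]_r (expw (r, t))%:E)%E.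
Proof.
rewrite /zen_weight integral_mkcond; congr (_ * _)%E; apply: eq_integral => r _.
rewrite patchE /expw/=; case: ifPn => [|]; first by rewrite inE/= in_itv/= andbT => ->.
by rewrite notin_setE/= in_itv/= andbT => /negP/negPf ->.
Qed.

Lemma zen_weight_ge0 (t : R) : (0 <= zen_weight nut t)%E.
Proof.
by rewrite mule_ge0 ?lee_fin ?mulr_ge0 ?pi_ge0// integral_ge0// => r _;
  rewrite lee_fin expR_ge0.
Qed.

Lemma measurable_zen_weight : measurable_fun setT (zen_weight nut).
Proof.
have -> : zen_weight nut = (fun t => (2 * pi)%:E * \int[nut]_r (expw (r, t))%:E)%E.
  by apply/funext => t; exact: zen_weightE.
apply: measurable_funeM.
apply: (measurable_fun_fubini_tonelli_G (m1 := nut) (fun p => (expw p)%:E)) => //.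
exact/measurable_EFinP.
Qed.

(** Plancherel bounds the energy on a vertical line by
    2 pi int f(t)^2 exp(-2 r t) dt, and integrating in r for nut yields the weight: this is why the weight of the space
    is the Laplace transform of nut. *)
Lemma damped_wave_energy_le (f : R -> R) (c : R) :
  mu.-integrable setT (EFin \o f) -> (forall t, t <= 0 -> f t = 0) ->
  (\int[nut \x mu]_w ((if (0 <= w.1)%R then `|damped_wave f c w| else 0) ^+ 2)%:E <=
   \int[mu]_(t in `]0%R, +oo[) ((f t ^+ 2)%:E * zen_weight nut t))%E.
Proof.
move=> If f0.
have mf : measurable_fun setT f by apply/measurable_EFinP; exact: measurable_int If.
have mf2 : measurable_fun setT (fun t => (f t ^+ 2)%:E).
  by apply/measurable_EFinP; exact: measurable_funX.
have f20 t : (0 <= (f t ^+ 2)%:E)%E by rewrite lee_fin sqr_ge0.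
have mh : measurable_fun setT
    (fun w : TT => ((if 0 <= w.1 then `|damped_wave f c w| else 0) ^+ 2)%:E).
  apply/measurable_EFinP; apply: measurable_funX; apply: measurable_fun_ifT => //.
    exact: measurable_fun_ler.
  by apply: measurableT_comp => //; exact: (measurable_damped_wave c mf).
have h0 (w : TT) : (0 <= ((if 0 <= w.1 then `|damped_wave f c w| else 0) ^+ 2)%:E)%E.
  by rewrite lee_fin sqr_ge0.
rewrite fubini_tonelli1//= /fubini_F.
pose q (p : TT) := ((2 * pi)%:E * ((expw p)%:E * (f p.2 ^+ 2)%:E))%E.
have mq : measurable_fun setT q.
  apply: measurable_funeM; apply: emeasurable_funM; first exact/measurable_EFinP.
  exact: (measurableT_comp mf2).
have pi20 : 0 <= 2 * pi :> R by rewrite mulr_ge0// pi_ge0.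
have q0 p : (0 <= q p)%E by rewrite !mule_ge0 ?lee_fin ?sqr_ge0 ?expw_ge0.
apply: (@le_trans _ _ (\int[nut]_r \int[mu]_t q (r, t))%E).
  apply: (ge0_le_integral nut measurableT).
  - by move=> r _; apply: integral_ge0 => u _; exact: h0.
  - exact: (measurable_fun_fubini_tonelli_F (m2 := mu) _ mh h0).
  - exact: (measurable_fun_fubini_tonelli_F (m2 := mu) _ mq q0).
  - move=> r _; rewrite /=.
    have [r0|r0] := boolP (0 <= r); last first.
      by rewrite expr0n/= integral0 integral_ge0.
    have Ir := integrable_damped If r0.
    apply: (@le_trans _ _ (\int[mu]_u
        (wave (fun t => expR (- (r * `|t|)) * f t) c u ^+ 2)%:E)%E).
      rewrite le_eqVlt; apply/orP; left; apply/eqP; apply: eq_integral => u _.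
      by rewrite real_normK ?num_real.
    apply: (le_trans (wave_plancherel_le c Ir)).
    rewrite -(ge0_integralZl_EFin mu measurableT _ _ pi20); last 2 first.
    + by move=> t _; rewrite lee_fin sqr_ge0.
    + apply/measurable_EFinP; apply: measurable_funX; apply: measurable_funM => //.
      exact: measurable_expR_abs.
    rewrite le_eqVlt; apply/orP; left; apply/eqP; apply: eq_integral => t _.
    rewrite /q/= /expw/= r0; congr (_ * _)%E; rewrite -EFinM; congr EFin.
    have [t0|/ltW t0] := leP t 0; first by rewrite f0// !(expr0n, mulr0).
    rewrite ger0_norm// exprMn -expRM_natl; congr (expR _ * _).
    by rewrite mulrN mulrA.
rewrite (fubini_tonelli (m1 := nut) (m2 := mu) q mq q0).
rewrite [leRHS]integral_mkcond le_eqVlt; apply/orP; left; apply/eqP.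
apply: eq_integral => t _; rewrite patchE.
case: ifPn => [_|].
  rewrite zen_weightE /q/=.
  have mE : measurable_fun setT (fun r => (expw (r, t))%:E).
    by apply/measurable_EFinP; exact: (measurableT_comp measurable_expw (measurable_pair2 (t : T))).
  rewrite muleCA -(ge0_integralZl nut measurableT mE _ (f20 t)).
    rewrite -ge0_integralZl_EFin//.
    + by apply: eq_integral => r _; congr (_ * _)%E; rewrite muleC.
    + by move=> r _; rewrite mule_ge0// lee_fin.
    + exact: measurable_funeM.
  by move=> r _; rewrite lee_fin.
rewrite notin_setE/= in_itv/= andbT => /negP; rewrite -leNgt => t0.
by apply: integral0_eq => r _; rewrite /q/= f0// expr0n/= !mule0.
Qed.

End WaveEnergy.

Section WaveEmbedding.
Context {R : realType}.
Local Notation mu := (@lebesgue_measure R).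
Local Notation T := (measurableTypeR R).
Local Notation TT := (measurableTypeR R * measurableTypeR R)%type.

Variables (nut : {sigma_finite_measure set T -> \bar R}) (V : R -> R) (K : R).
Hypothesis mV : measurable_fun setT V.
Hypothesis V_gt0 : forall x : R, 0 < x -> 0 < V x.
Hypothesis V_ge0 : forall x : R, 0 <= V x.
Hypothesis V_le : forall x y : R, 0 < x -> x <= y -> V x <= V y.
Hypothesis nutV : forall x : R, 0 < x -> nut `[0, x[%classic = (V x)%:E.
Hypothesis K_gt0 : 0 < K.
Hypothesis V_doubling : forall x : R, 0 < x -> V (2 * x) <= K * V x.

Variables (nu : {measure set TT -> \bar R}) (C : R).
Hypothesis C_gt0 : 0 < C.
Hypothesis nu_carleson : forall u s : R, 0 < s ->
  (nu (half_strip_square u s) <= (C * (2 * s * V (2 * s)))%:E)%E.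

Definition embedding_cst : R :=
  16 * (4 / pi) ^+ 2 * (2 * pi) * (72 * pi * C * K ^+ 2).

Lemma embedding_cst_gt0 : 0 < embedding_cst.
Proof.
have p0 : 0 < pi :> R := pi_gt0 R.
rewrite /embedding_cst; move: (pi : R) p0 => q q0.
have q2 : 0 < (4 / q) ^+ 2 by rewrite exprn_gt0// divr_gt0.
have K2 : 0 < K ^+ 2 by rewrite exprn_gt0.
by apply: mulr_gt0; apply: mulr_gt0 => //; apply: mulr_gt0 => //; apply: mulr_gt0.
Qed.

(* The half-plane is exhausted by bounded windows away from its boundary, of finite mass *)
Let window (n : nat) : set TT :=
  [set p | [&& n.+1%:R^-1 <= p.1, p.1 < 2 * n.+1%:R & `|p.2| < n.+1%:R]].

Let measurable_window n : measurable (window n).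
Proof.
have mb : measurable_fun setT (fun p : TT =>
    [&& n.+1%:R^-1 <= p.1, p.1 < 2 * n.+1%:R & `|p.2| < n.+1%:R]).
  apply: measurable_and; first exact: measurable_fun_ler.
  apply: measurable_and; first exact: measurable_fun_ltr.
  by apply: measurable_fun_ltr => //; exact: measurableT_comp.
by have := mb measurableT [set true] Logic.I; rewrite setTI.
Qed.

Lemma measurable_half_strip_square (u s : R) :
  measurable (half_strip_square u s : set TT).
Proof.
have mb : measurable_fun setT (fun p : TT =>
    [&& 0 <= p.1, p.1 < 2 * s & `|p.2 - u| < s]).
  apply: measurable_and; first exact: measurable_fun_ler.
  apply: measurable_and; first exact: measurable_fun_ltr.
  apply: measurable_fun_ltr => //; apply: measurableT_comp => //.
  exact: measurable_funB.
have := mb measurableT [set true] Logic.I; rewrite setTI.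
rewrite (_ : _ @^-1` _ = half_strip_square u s)//.
apply/seteqP; split => p /=; rewrite /half_strip_square/=.
  by move=> /and3P[-> -> ->].
by move=> [/andP[-> ->] ->].
Qed.

Let nu_window n : (nu (window n) < +oo)%E.
Proof.
have n0 : 0 < n.+1%:R :> R by [].
apply: le_lt_trans (ltry (C * (2 * n.+1%:R * V (2 * n.+1%:R)))).
apply: le_trans (nu_carleson 0 n0); apply: le_measure; rewrite ?inE//.
  exact: measurable_half_strip_square.
move=> p /and3P[p1 p2 p3]; split; last by rewrite subr0.
by rewrite p2 andbT (le_trans _ p1)// invr_ge0.
Qed.

Let nd_window : nondecreasing_seq window.
Proof.
move=> k n kn; rewrite subsetEset => p /and3P[p1 p2 p3]; apply/and3P; split.
- by rewrite (le_trans _ p1)// lef_pV2 ?posrE// ler_nat.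
- by rewrite (lt_le_trans p2)// ler_pM2l// ler_nat.
- by rewrite (lt_le_trans p3)// ler_nat.
Qed.

Let bigcup_window : \bigcup_n window n = half_plane.
Proof.
apply/seteqP; split => [p [n _ /and3P[p1 _ _]]|p p0].
  by rewrite /half_plane/= (lt_le_trans _ p1)// invr_gt0.
rewrite /half_plane/= in p0.
pose b := p.1^-1 + p.1 + `|p.2|.
exists (Num.truncn b) => //; apply/and3P.
have b0 : 0 <= b by rewrite /b addr_ge0// addr_ge0 ?invr_ge0 ?(ltW p0).
have bn : b < (Num.truncn b).+1%:R by rewrite truncnS_gt.
have i0 : 0 < p.1^-1 by rewrite invr_gt0.
split.
- rewrite -[leRHS]invrK lef_pV2 ?posrE// (le_trans _ (ltW bn))// /b -addrA lerDl.
  by rewrite addr_ge0// ltW.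
- rewrite (@lt_trans _ _ (Num.truncn b).+1%:R)//; last by rewrite ltr_pMl// ltr1n.
  by rewrite (le_lt_trans _ bn)// /b addrAC lerDr addr_ge0// ltW.
- by rewrite (le_lt_trans _ bn)// /b lerDr addr_ge0// ltW.
Qed.

Lemma wave_embedding_integrable (f : R -> R) (c : R) :
  mu.-integrable setT (EFin \o f) -> (forall t, t <= 0 -> f t = 0) ->
  (\int[nu]_(p in half_plane) (damped_wave f c p ^+ 2)%:E <=
   embedding_cst%:E *
   \int[mu]_(t in `]0%R, +oo[) ((f t ^+ 2)%:E * zen_weight nut t))%E.
Proof.
move=> If f0.
have mf : measurable_fun setT f by apply/measurable_EFinP; exact: measurable_int If.
have mw : measurable_fun setT (fun p : TT => (damped_wave f c p ^+ 2)%:E).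
  apply/measurable_EFinP; apply: measurable_funX.
  exact: (measurable_damped_wave c mf).
have cv := ge0_nondecreasing_set_cvg_integral (mu := nu) (F := window)
  (f := fun p : TT => (damped_wave f c p ^+ 2)%:E) nd_window measurable_window
  (fun n => measurable_funTS mw).
rewrite -bigcup_window -(cvg_lim (@ereal_hausdorff R) (cv _)); last first.
  by move=> n p _; rewrite lee_fin sqr_ge0.
apply: lime_le.
  apply: ereal_nondecreasing_is_cvgn.
  apply: ge0_nondecreasing_set_nondecreasing_integral => //.
  - by move=> n; exact: measurable_funTS.
  - by move=> n p _; rewrite lee_fin sqr_ge0.
apply: nearW => n.
pose m := mfrestr (measurable_window n) (nu_window n).
have d0 : 0 < n.+1%:R^-1 :> R by rewrite invr_gt0.
have m_carleson (u s : R) : 0 < s ->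
    (m (half_strip_square u s) <= (C * (2 * s * V (2 * s)))%:E)%E.
  move=> s0; apply: (le_trans _ (nu_carleson u s0)).
  apply: le_measure; rewrite ?inE; last exact: subIsetl.
    by apply: measurableI => //; exact: measurable_half_strip_square.
  exact: measurable_half_strip_square.
have := carleson_wave mV V_gt0 V_ge0 V_le nutV K_gt0 V_doubling C_gt0 m_carleson d0 c If.
set X := (\int[_]_z _)%E => XH.
apply: (@le_trans _ _ X).
  have -> : (\int[nu]_(p in window n) (damped_wave f c p ^+ 2)%:E =
             \int[m]_(p in window n) (damped_wave f c p ^+ 2)%:E)%E.
    apply: eq_measure_integral => A mA AE.
    by rewrite /m /= /mfrestr /mrestr setIidl.
  rewrite integral_mkcond; apply: (ge0_le_integral m measurableT).
  - by move=> p _; rewrite patchE; case: ifPn => // _; rewrite lee_fin sqr_ge0.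
  - apply/(measurable_restrictT _ (measurable_window n)).
    exact: measurable_funTS.
  - apply/measurable_EFinP; apply: measurable_funX; apply: measurable_fun_ifT => //.
      exact: measurable_fun_ler.
    by apply: measurableT_comp => //; exact: (measurable_damped_wave c mf).
  - move=> p _; rewrite patchE; case: ifPn => [|_]; last by rewrite lee_fin sqr_ge0.
    rewrite inE => /and3P[-> _ _].
    by rewrite lee_fin real_normK ?num_real.
apply: (le_trans XH); apply: lee_wpmul2l.
  by rewrite lee_fin ltW// embedding_cst_gt0.
exact: damped_wave_energy_le.
Qed.

Lemma measurable_half_plane : measurable (half_plane : set TT).
Proof. by rewrite -bigcup_window; exact: bigcup_measurable. Qed.

(** The truncations exp(-t/n) f are integrable and have smaller weighted norm;
    Fatou's lemma passes to the limit. *)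
Lemma wave_embedding (f : R -> R) (c : R) :
  measurable_fun setT f -> (forall t, t <= 0 -> f t = 0) ->
  (forall x : R, 0 < x -> mu.-integrable setT (EFin \o (fun t => expR (- (x * `|t|)) * f t))) ->
  (\int[nu]_(p in half_plane) (damped_wave f c p ^+ 2)%:E <=
   embedding_cst%:E *
   \int[mu]_(t in `]0%R, +oo[) ((f t ^+ 2)%:E * zen_weight nut t))%E.
Proof.
move=> mf f0 If.
pose f_ (n : nat) t := expR (- (n.+1%:R^-1 * `|t|)) * f t.
have If_ n : mu.-integrable setT (EFin \o f_ n) by apply: If; rewrite invr_gt0.
have f_0 n t : t <= 0 -> f_ n t = 0 by move=> t0; rewrite /f_ f0// mulr0.
have mf2 : measurable_fun setT (fun t => (f t ^+ 2)%:E).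
  by apply/measurable_EFinP; exact: measurable_funX.
have mf_ n : measurable_fun setT (f_ n).
  by apply: measurable_funM => //; exact: measurable_expR_abs.
have mf_2 n : measurable_fun setT (fun t => (f_ n t ^+ 2)%:E).
  by apply/measurable_EFinP; exact: measurable_funX.
have f2w0 t : (0 <= (f t ^+ 2)%:E * zen_weight nut t)%E.
  by rewrite mule_ge0 ?lee_fin ?sqr_ge0 ?zen_weight_ge0.
have f_2w0 n t : (0 <= (f_ n t ^+ 2)%:E * zen_weight nut t)%E.
  by rewrite mule_ge0 ?lee_fin ?sqr_ge0 ?zen_weight_ge0.
have mzw : measurable_fun setT (zen_weight nut) by exact: measurable_zen_weight.
pose X := (embedding_cst%:E *
   \int[mu]_(t in `]0%R, +oo[) ((f t ^+ 2)%:E * zen_weight nut t))%E.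
pose u (n : nat) (p : TT) := (damped_wave (f_ n) c p ^+ 2)%:E.
have bound n : (\int[nu]_(p in half_plane) u n p <= X)%E.
  apply: (le_trans (wave_embedding_integrable c (If_ n) (f_0 n))).
  apply: lee_wpmul2l; first by rewrite lee_fin ltW// embedding_cst_gt0.
  apply: (ge0_le_integral mu (measurable_itv _)).
  - by move=> t _; exact: f_2w0.
  - exact: (measurable_funTS (emeasurable_funM (mf_2 n) mzw)).
  - exact: (measurable_funTS (emeasurable_funM mf2 mzw)).
  - move=> t _; apply: lee_wpmul2r; first exact: zen_weight_ge0.
    rewrite lee_fin /f_ exprMn; apply: ler_piMl; first exact: sqr_ge0.
    by apply: exprn_ile1; rewrite ?expR_ge0// expR_le1 oppr_le0 mulr_ge0 ?invr_ge0.
have mu_ n : measurable_fun (half_plane : set TT) (u n).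
  apply: measurable_funTS; apply/measurable_EFinP; apply: measurable_funX.
  exact: (measurable_damped_wave c (mf_ n)).
have cvg_u (p : TT) : half_plane p -> u n p @[n --> \oo] --> (damped_wave f c p ^+ 2)%:E.
  rewrite /half_plane/= => p0.
  suff lim : damped_wave (f_ n) c p @[n --> \oo] --> damped_wave f c p.
    by apply: cvg_EFin; [exact: nearW|exact: (cvgM lim lim)].
  have := @Rintegral_dominated_cvg _ T R mu setT
    (fun n t => cos (t * p.2 - c) * (expR (- (p.1 * `|t|)) * f_ n t))
    (fun t => cos (t * p.2 - c) * (expR (- (p.1 * `|t|)) * f t))
    (fun t => `|expR (- (p.1 * `|t|)) * f t|) measurableT.
  apply.
  - move=> n; apply: measurable_funM; first exact: measurable_cos_phase1.
    apply: measurable_funM; first exact: measurable_expR_abs.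
    by apply: measurable_funM => //; exact: measurable_expR_abs.
  - move=> t _; apply: cvgMr; apply: cvgMr; rewrite -[X in _ --> X]mul1r; apply: cvgMl.
    exact: cvg_expR_harmonic.
  - exact: (integrable_norm (If _ p0)).
  - move=> n t _; rewrite normrM.
    rewrite (le_trans (ler_piMl (normr_ge0 _) (cos_max _)))// /f_ !normrM.
    have e1 : `|expR (- (n.+1%:R^-1 * `|t|))| <= 1.
      by rewrite ger0_norm ?expR_ge0// expR_le1 oppr_le0 mulr_ge0 ?invr_ge0.
    by apply: ler_wpM2l => //; apply: ler_piMl.
have u0 n p : half_plane p -> (0 <= u n p)%E by move=> _; rewrite lee_fin sqr_ge0.
have := fatou nu measurable_half_plane mu_ u0.
have -> : (\int[nu]_(p in half_plane) limn_einf (u^~ p) =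
           \int[nu]_(p in half_plane) (damped_wave f c p ^+ 2)%:E)%E.
  apply: eq_integral => p; rewrite inE => p0.
  by rewrite (cvg_limn_einf_sup (cvg_u p p0)).1.
move=> /le_trans; apply.
rewrite limn_einf_lim; apply: lime_le.
  exact: is_cvg_einfs.
apply: nearW => n; apply: le_trans (bound n).
by apply: ereal_inf_lbound; exists n => /=.
Qed.

End WaveEmbedding.

(** * From waves to the Laplace transform *)

Section LaplaceWave.
Context {R : realType}.
Local Open Scope complex_scope.
Local Notation mu := (@lebesgue_measure R).
Local Notation T := (measurableTypeR R).
Local Notation TT := (measurableTypeR R * measurableTypeR R)%type.
Local Notation pos := (`]0%R, +oo[%classic : set T).

(** Extension by 0, so that functions on the half-line can be treated by the
    integrals over the whole line. *)
Definition half_line_patch (g : R -> R) (t : R) : R := if 0 < t then g t else 0.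

Lemma half_line_patchE (g : R -> R) : half_line_patch g = g \_ pos.
Proof.
apply/funext => t; rewrite patchE /half_line_patch.
case: ifPn => t0; first by rewrite mem_set//= in_itv/= andbT.
by rewrite memNset//= in_itv/= andbT; exact/negP.
Qed.

Lemma measurable_half_line_patch (g : R -> R) : measurable_fun pos g ->
  measurable_fun setT (half_line_patch g).
Proof.
move=> mg; rewrite half_line_patchE.
have mpos : measurable pos by exact: measurable_itv.
exact/(measurable_restrictT g mpos).
Qed.

Lemma half_line_patch0 (g : R -> R) t : t <= 0 -> half_line_patch g t = 0.
Proof. by rewrite /half_line_patch leNgt => /negPf ->. Qed.

Lemma Re_laplace_integrand (f : T -> R[i]) (x y t : R) :
  complex.Re (laplace_integrand f (cplx (x, y)) t) =
  expR (- (x * t)) * (cos (t * y) * complex.Re (f t) + sin (t * y) * complex.Im (f t)).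
Proof.
rewrite /laplace_integrand /cexp /cplx; case: (f t) => a b /=.
rewrite mul0r subr0 mul0r addr0 cosN sinN [t * x]mulrC; ring.
Qed.

Lemma Im_laplace_integrand (f : T -> R[i]) (x y t : R) :
  complex.Im (laplace_integrand f (cplx (x, y)) t) =
  expR (- (x * t)) * (cos (t * y) * complex.Im (f t) - sin (t * y) * complex.Re (f t)).
Proof.
rewrite /laplace_integrand /cexp /cplx; case: (f t) => a b /=.
rewrite mul0r subr0 mul0r addr0 cosN sinN [t * x]mulrC; ring.
Qed.

Lemma abs2E (z : R[i]) : abs2 z = complex.Re z ^+ 2 + complex.Im z ^+ 2.
Proof. by case: z => a b; rewrite /abs2/= sqr_sqrtr// addr_ge0 ?sqr_ge0. Qed.

Lemma abs2_ge0 (z : R[i]) : 0 <= abs2 z.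
Proof. by rewrite /abs2 sqr_ge0. Qed.

Lemma measurable_abs2 d (U : measurableType d) (D : set U) (f : U -> R[i]) :
  cmeasurable D f -> measurable_fun D (fun x => (abs2 (f x))%:E).
Proof.
move=> [mre mim]; apply/measurable_EFinP.
rewrite (_ : (fun x => _) = (fun x =>
  complex.Re (f x) ^+ 2 + complex.Im (f x) ^+ 2)); last first.
  by apply/funext => x; rewrite abs2E.
by apply: measurable_funD; exact: measurable_funX.
Qed.

End LaplaceWave.

Section LaplaceOfFunction.
Context {R : realType}.
Local Open Scope complex_scope.
Local Notation mu := (@lebesgue_measure R).
Local Notation T := (measurableTypeR R).
Local Notation TT := (measurableTypeR R * measurableTypeR R)%type.
Local Notation pos := (`]0%R, +oo[%classic : set T).

Variable f : T -> R[i].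
Hypothesis mf : cmeasurable pos f.

Let fr : R -> R := half_line_patch (fun t => complex.Re (f t)).
Let fi : R -> R := half_line_patch (fun t => complex.Im (f t)).

Hypothesis Ifr : forall x : R, 0 < x ->
  mu.-integrable setT (EFin \o (fun t => expR (- (x * `|t|)) * fr t)).
Hypothesis Ifi : forall x : R, 0 < x ->
  mu.-integrable setT (EFin \o (fun t => expR (- (x * `|t|)) * fi t)).

Let integrable_pos (g : R -> R) (h : T -> R) :
  mu.-integrable setT (EFin \o g) -> {in pos, g =1 h} ->
  mu.-integrable pos (EFin \o h).
Proof.
move=> Ig gh; have mpos : measurable pos by exact: measurable_itv.
apply: (eq_integrable mpos (EFin \o g)); first by move=> t tpos /=; rewrite gh.
exact: (integrableS measurableT).
Qed.

Let Rintegral_pos (g : R -> R) (h : T -> R) :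
  (forall t, t <= 0 -> g t = 0) -> {in pos, g =1 h} ->
  \int[mu]_(t in pos) h t = \int[mu]_t g t.
Proof.
move=> g0 gh; rewrite Rintegral_mkcond; apply: eq_Rintegral => t _.
rewrite patchE; case: ifPn => [/gh //|]; rewrite notin_setE/= in_itv/= andbT.
by move=> /negP; rewrite -leNgt => /g0.
Qed.

Let phase (a b : R -> R) (x y ca cb t : R) : R :=
  cos (t * y - ca) * (expR (- (x * `|t|)) * a t) +
  cos (t * y - cb) * (expR (- (x * `|t|)) * b t).

Let Re_phase x y : {in pos, phase fr fi x y 0 (pi / 2) =1
  (fun t => complex.Re (laplace_integrand f (cplx (x, y)) t))}.
Proof.
move=> t; rewrite inE/= in_itv/= andbT => t0.
rewrite Re_laplace_integrand /phase /fr /fi /half_line_patch t0 gtr0_norm//.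
by rewrite subr0 cosBpihalf; ring.
Qed.

Let Im_phase x y : {in pos, phase fi (fun t => - fr t) x y 0 (pi / 2) =1
  (fun t => complex.Im (laplace_integrand f (cplx (x, y)) t))}.
Proof.
move=> t; rewrite inE/= in_itv/= andbT => t0.
rewrite Im_laplace_integrand /phase /fr /fi /half_line_patch t0 gtr0_norm//.
by rewrite subr0 cosBpihalf; ring.
Qed.

Let Ifrn x : 0 < x ->
  mu.-integrable setT (EFin \o (fun t => expR (- (x * `|t|)) * - fr t)).
Proof.
move=> x0; have := integrableN (Ifr x0).
by apply: eq_integrable => // t _ /=; rewrite mulrN.
Qed.

Lemma laplace_integrand_integrable p : half_plane p ->
  cintegrable mu pos (laplace_integrand f (cplx p)).
Proof.
case: p => x y; rewrite /half_plane/= => x0; split.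
- apply: (integrable_pos _ (@Re_phase x y)).
  have := integrableD measurableT (integrable_wave 0 y (Ifr x0))
    (integrable_wave (pi / 2) y (Ifi x0)).
  by apply: eq_integrable.
- apply: (integrable_pos _ (@Im_phase x y)).
  have := integrableD measurableT (integrable_wave 0 y (Ifi x0))
    (integrable_wave (pi / 2) y (Ifrn x0)).
  by apply: eq_integrable.
Qed.

(** cos(t y) and sin(t y) are the cosines with phases 0 and pi / 2, so that a complex
    f contributes two waves to each component. *)
Lemma Re_laplace p : half_plane p -> complex.Re (laplace f (cplx p)) =
  damped_wave fr 0 p + damped_wave fi (pi / 2) p.
Proof.
case: p => x y; rewrite /half_plane/= => x0.
rewrite (Rintegral_pos _ (@Re_phase x y)); last first.
  by move=> t t0; rewrite /phase /fr /fi !half_line_patch0// !mulr0 addr0.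
rewrite (RintegralD measurableT (integrable_wave 0 y (Ifr x0))
    (integrable_wave (pi / 2) y (Ifi x0))).
by [].
Qed.

Lemma Im_laplace p : half_plane p -> complex.Im (laplace f (cplx p)) =
  damped_wave fi 0 p - damped_wave fr (pi / 2) p.
Proof.
case: p => x y; rewrite /half_plane/= => x0.
rewrite (Rintegral_pos _ (@Im_phase x y)); last first.
  by move=> t t0; rewrite /phase /fr /fi !half_line_patch0// oppr0 !mulr0 addr0.
rewrite (RintegralD measurableT (integrable_wave 0 y (Ifi x0))
    (integrable_wave (pi / 2) y (Ifrn x0))).
rewrite -[X in _ = _ + X]mulN1r /damped_wave /wave.
rewrite -(RintegralZl (-1) measurableT (integrable_wave (pi / 2) y (Ifr x0))).
by congr (_ + _); apply: eq_Rintegral => t _; rewrite !mulrN mulN1r.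
Qed.

End LaplaceOfFunction.

Section LaplaceEmbedding.
Context {R : realType}.
Local Open Scope complex_scope.
Local Notation mu := (@lebesgue_measure R).
Local Notation T := (measurableTypeR R).
Local Notation TT := (measurableTypeR R * measurableTypeR R)%type.
Local Notation pos := (`]0%R, +oo[%classic : set T).

Variables (nut : {sigma_finite_measure set T -> \bar R}) (V : R -> R) (K : R).
Hypothesis mV : measurable_fun setT V.
Hypothesis V_gt0 : forall x : R, 0 < x -> 0 < V x.
Hypothesis V_ge0 : forall x : R, 0 <= V x.
Hypothesis V_le : forall x y : R, 0 < x -> x <= y -> V x <= V y.
Hypothesis nutV : forall x : R, 0 < x -> nut `[0, x[%classic = (V x)%:E.
Hypothesis K_gt0 : 0 < K.
Hypothesis V_doubling : forall x : R, 0 < x -> V (2 * x) <= K * V x.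

(** The weight decreases slower than every exponential, since every interval
    [0, x / 2) has positive mass. *)
Lemma zen_weight_ge (x t : R) : 0 < x -> 0 <= t ->
  ((2 * pi * V (x / 2) * expR (- (x * t)))%:E <= zen_weight nut t)%E.
Proof.
move=> x0 t0; have x20 : 0 < x / 2 by rewrite divr_gt0.
rewrite /zen_weight -[(2 * pi * V (x / 2) * _)%R]mulrA EFinM.
apply: lee_wpmul2l; first by rewrite lee_fin mulr_ge0// pi_ge0.
have me (D : set T) : measurable_fun D (fun r : T => (expR (- (2 * r * t)))%:E).
  apply: measurable_funTS; apply/measurable_EFinP.
  apply: (measurableT_comp (@measurable_expR R)); apply: measurableT_comp => //.
  by apply: measurable_funM => //; exact: measurable_funM.
apply: (@le_trans _ _ (\int[nut]_(r in `[0%R, (x / 2)%R[) (expR (- (2 * r * t)))%:E)%E).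
  rewrite mulrC EFinM -nutV// -integral_cst//=.
  apply: (ge0_le_integral nut (measurable_itv _)) => [r _|||r].
  - by rewrite lee_fin expR_ge0.
  - exact: measurable_cst.
  - exact: me.
  - rewrite /= in_itv/= => /andP[r0 rx]; rewrite lee_fin ler_expR lerN2.
    by rewrite ler_wpM2r// mulrC -ler_pdivlMr// ltW.
apply: (@ge0_subset_integral _ _ _ nut _ _ (measurable_itv _) (measurable_itv _)
  _ (me _)).
  by move=> r _; rewrite lee_fin expR_ge0.
by move=> r; rewrite /= !in_itv/= => /andP[-> _].
Qed.

(** By zen_weight_ge, exp(-x t) |g| <= exp(-x t) (1 + g^2) is at most exp(-x t) plus
    a multiple of g^2 times the weight. *)
Lemma weighted_integrable (g : R -> R) (x : R) : 0 < x ->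
  measurable_fun setT g -> (forall t : R, t <= 0 -> g t = 0) ->
  (\int[mu]_(t in pos) ((g t ^+ 2)%:E * zen_weight nut t) < +oo)%E ->
  mu.-integrable setT (EFin \o (fun t => expR (- (x * `|t|)) * g t)).
Proof.
move=> x0 mg g0 goo; have x20 : 0 < x / 2 by rewrite divr_gt0.
have Vx := V_gt0 x20.
have pi0 : 0 < pi :> R := pi_gt0 R.
have mpos : measurable pos by exact: measurable_itv.
pose k := (2 * pi * V (x / 2))^-1.
have k0 : 0 < k by rewrite invr_gt0 mulr_gt0// mulr_gt0.
have me := measurable_expR_abs x.
have mw := measurable_zen_weight nut.
have mg2 : measurable_fun setT (fun t => (g t ^+ 2)%:E).
  by apply/measurable_EFinP; exact: measurable_funX.
have w0 t := zen_weight_ge0 nut t.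
pose b := (fun t : T => (g t ^+ 2)%:E * zen_weight nut t)%E \_ pos.
apply/integrableP; split.
  by apply/measurable_EFinP; exact: measurable_funM.
have mG : measurable_fun setT (fun t => k%:E * b t)%E.
  apply: measurable_funeM; apply/(measurable_restrictT _ mpos).
  exact: (measurable_funTS (emeasurable_funM mg2 mw)).
have g2w0 t : (0 <= (g t ^+ 2)%:E * zen_weight nut t)%E.
  by rewrite mule_ge0// lee_fin sqr_ge0.
have G0 t : (0 <= b t)%E.
  by rewrite /b patchE; case: ifP.
apply: (@le_lt_trans _ _ (\int[mu]_t (expR (- (x * `|t|)))%:E +
    \int[mu]_t (k%:E * b t))%E).
  apply: le_integral_sum2 => [|||t|t|t|t].
  - by apply/measurable_EFinP; apply: measurableT_comp => //; exact: measurable_funM.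
  - exact/measurable_EFinP.
  - exact: mG.
  - by rewrite lee_fin.
  - by rewrite lee_fin expR_ge0.
  - by rewrite mule_ge0// lee_fin ltW.
  - rewrite /b patchE; case: ifPn => [|]; last first.
      rewrite notin_setE/= in_itv/= andbT => /negP; rewrite -leNgt => t0.
      by rewrite mule0 adde0 g0// mulr0 lee_fin normr0 expR_ge0.
    rewrite inE/= in_itv/= andbT => t0.
    apply: (@le_trans _ _ ((expR (- (x * `|t|)))%:E + k%:E * ((g t ^+ 2)%:E *
        (2 * pi * V (x / 2) * expR (- (x * t)))%:E))%E); last first.
      apply: leeD => //; apply: lee_wpmul2l; first by rewrite lee_fin ltW.
      apply: lee_wpmul2l; first by rewrite lee_fin sqr_ge0.
      by apply: zen_weight_ge => //; exact: ltW.
    rewrite -!EFinM -EFinD lee_fin (gtr0_norm t0).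
    have -> : k * (g t ^+ 2 * (2 * pi * V (x / 2) * expR (- (x * t)))) =
              expR (- (x * t)) * g t ^+ 2.
      by rewrite /k; move: (pi : R) pi0 => q q0; field; rewrite !gt_eqF.
    rewrite normrM (gtr0_norm (expR_gt0 _)) -[X in _ <= X + _]mulr1 -mulrDr.
    rewrite ler_wpM2l ?expR_ge0// -(real_normK (num_real (g t))).
    have := sqr_ge0 (`|g t| - 1); rewrite sqrrB1; have := normr_ge0 (g t).
    by move: (`|g t|) => a a0; have := sqr_ge0 a; lra.
rewrite integral_expR_abs// ge0_integralZl_EFin//; last 2 first.
- apply/(measurable_restrictT _ mpos).
  exact: (measurable_funTS (emeasurable_funM mg2 mw)).
- exact: ltW.
rewrite -integral_mkcond; apply: lte_add_pinfty; first exact: ltry.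
by apply: lte_mul_pinfty => //; rewrite ?lee_fin ?ltW.
Qed.

Variables (nu : {measure set TT -> \bar R}) (C : R).
Hypothesis C_gt0 : 0 < C.
Hypothesis nu_carleson : forall u s : R, 0 < s ->
  (nu (half_strip_square u s) <= (C * (2 * s * V (2 * s)))%:E)%E.

Variable f : T -> R[i].
Hypothesis mf : cmeasurable pos f.
Hypothesis foo : (\int[mu]_(t in pos) ((abs2 (f t))%:E * zen_weight nut t) < +oo)%E.

Let fr : R -> R := half_line_patch (fun t => complex.Re (f t)).
Let fi : R -> R := half_line_patch (fun t => complex.Im (f t)).

Let mfr : measurable_fun setT fr.
Proof. exact: measurable_half_line_patch mf.1. Qed.
Let mfi : measurable_fun setT fi.
Proof. exact: measurable_half_line_patch mf.2. Qed.

Let mpos : measurable pos. Proof. exact: measurable_itv. Qed.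

Let mfw (g : R -> R) : measurable_fun setT g ->
  measurable_fun pos (fun t => (g t ^+ 2)%:E * zen_weight nut t)%E.
Proof.
move=> mg; apply: measurable_funTS; apply: emeasurable_funM.
  by apply/measurable_EFinP; exact: measurable_funX.
exact: measurable_zen_weight.
Qed.

Let abs2_split :
  (\int[mu]_(t in pos) ((abs2 (f t))%:E * zen_weight nut t) =
   \int[mu]_(t in pos) ((fr t ^+ 2)%:E * zen_weight nut t) +
   \int[mu]_(t in pos) ((fi t ^+ 2)%:E * zen_weight nut t))%E.
Proof.
rewrite -ge0_integralD//.
- apply: eq_integral => t; rewrite inE/= in_itv/= andbT => t0.
  rewrite abs2E /fr /fi /half_line_patch t0 EFinD ge0_muleDl//;
    by rewrite lee_fin sqr_ge0.
- by move=> t _; rewrite mule_ge0 ?zen_weight_ge0// lee_fin sqr_ge0.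
- exact: mfw.
- by move=> t _; rewrite mule_ge0 ?zen_weight_ge0// lee_fin sqr_ge0.
- exact: mfw.
Qed.

Let int_sqr_ge0 (g : R -> R) :
  (0 <= \int[mu]_(t in pos) ((g t ^+ 2)%:E * zen_weight nut t))%E.
Proof.
by apply: integral_ge0 => t _; rewrite mule_ge0 ?zen_weight_ge0// lee_fin sqr_ge0.
Qed.

Let froo : (\int[mu]_(t in pos) ((fr t ^+ 2)%:E * zen_weight nut t) < +oo)%E.
Proof. by apply: le_lt_trans foo; rewrite abs2_split leeDl. Qed.
Let fioo : (\int[mu]_(t in pos) ((fi t ^+ 2)%:E * zen_weight nut t) < +oo)%E.
Proof. by apply: le_lt_trans foo; rewrite abs2_split leeDr. Qed.

Let fr0 t : t <= 0 -> fr t = 0. Proof. exact: half_line_patch0. Qed.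
Let fi0 t : t <= 0 -> fi t = 0. Proof. exact: half_line_patch0. Qed.

Let Ifr (x : R) (x0 : 0 < x) := weighted_integrable x0 mfr fr0 froo.
Let Ifi (x : R) (x0 : 0 < x) := weighted_integrable x0 mfi fi0 fioo.

Lemma weighted_laplace_integrable p : half_plane p ->
  cintegrable mu pos (laplace_integrand f (cplx p)).
Proof. exact: laplace_integrand_integrable. Qed.

Lemma measurable_weighted_laplace :
  cmeasurable (half_plane : set TT) (fun p => laplace f (cplx p)).
Proof.
split.
- apply: (eq_measurable_fun
    (fun p : TT => damped_wave fr 0 p + damped_wave fi (pi / 2) p)).
    by move=> p; rewrite inE => /(Re_laplace Ifr Ifi) ->.
  by apply: measurable_funTS; apply: measurable_funD; exact: measurable_damped_wave.
- apply: (eq_measurable_fun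
    (fun p : TT => damped_wave fi 0 p - damped_wave fr (pi / 2) p)).
    by move=> p; rewrite inE => /(Im_laplace Ifr Ifi) ->.
  by apply: measurable_funTS; apply: measurable_funB; exact: measurable_damped_wave.
Qed.

Lemma laplace_embedding :
  (\int[nu]_(p in half_plane) (abs2 (laplace f (cplx p)))%:E <=
   (4 * embedding_cst K C)%:E *
   \int[mu]_(t in pos) ((abs2 (f t))%:E * zen_weight nut t))%E.
Proof.
have mhp : measurable (half_plane : set TT) := measurable_half_plane.
set A := embedding_cst K C.
have A0 : 0 < A by exact: embedding_cst_gt0.
pose S (g : R -> R) (c : R) (p : TT) := (2 * damped_wave g c p ^+ 2)%:E.
have S0 g c p : (0 <= S g c p)%E by rewrite lee_fin mulr_ge0// sqr_ge0.
have mS g c : measurable_fun setT g -> measurable_fun (half_plane : set TT) (S g c).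
  move=> mg; apply: measurable_funTS; apply/measurable_EFinP; apply: measurable_funM => //.
  by apply: measurable_funX; exact: measurable_damped_wave.
pose E (g : R -> R) := (\int[mu]_(t in pos) ((g t ^+ 2)%:E * zen_weight nut t))%E.
have SE (g : R -> R) c : measurable_fun setT g -> (forall t : R, t <= 0 -> g t = 0) ->
    (forall x : R, 0 < x ->
      mu.-integrable setT (EFin \o (fun t => expR (- (x * `|t|)) * g t))) ->
    (\int[nu]_(p in half_plane) S g c p <= (2 * A)%:E * E g)%E.
  move=> mg g0 Ig.
  have mdw : measurable_fun (half_plane : set TT) (fun p => (damped_wave g c p ^+ 2)%:E).
    apply: measurable_funTS; apply/measurable_EFinP; apply: measurable_funX.
    exact: measurable_damped_wave.
  have -> : (\int[nu]_(p in half_plane) S g c p =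
      2%:E * \int[nu]_(p in half_plane) (damped_wave g c p ^+ 2)%:E)%E.
    rewrite -(ge0_integralZl_EFin nu mhp _ mdw (ler0n R 2)).
      by apply: eq_integral => p _; rewrite -EFinM.
    by move=> p _; rewrite lee_fin sqr_ge0.
  rewrite EFinM -muleA; apply: lee_wpmul2l => //.
  exact: (wave_embedding mV V_gt0 V_ge0 V_le nutV K_gt0 V_doubling C_gt0 nu_carleson c mg g0 Ig).
pose S1 := S fr 0; pose S2 := S fi (pi / 2).
pose S3 := S fi 0; pose S4 := S fr (pi / 2).
have m1 := mS fr 0 mfr; have m2 := mS fi (pi / 2) mfi.
have m3 := mS fi 0 mfi; have m4 := mS fr (pi / 2) mfr.
apply: (@le_trans _ _ (\int[nu]_(p in half_plane) ((S1 p + S2 p) + (S3 p + S4 p)))%E).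
  apply: (ge0_le_integral nu mhp).
  - by move=> p _; rewrite lee_fin abs2_ge0.
  - exact: (measurable_abs2 measurable_weighted_laplace).
  - by apply: emeasurable_funD; exact: emeasurable_funD.
  - move=> p p0; rewrite abs2E (Re_laplace Ifr Ifi p0) (Im_laplace Ifr Ifi p0).
    rewrite /S1 /S2 /S3 /S4 /S -!EFinD lee_fin.
    move: (damped_wave fr 0 p) (damped_wave fi (pi / 2) p) => a b.
    move: (damped_wave fi 0 p) (damped_wave fr (pi / 2) p) => a' b'.
    have := sqr_ge0 (a - b); have := sqr_ge0 (a' + b').
    by rewrite !sqrrD !sqrrN; lra.
rewrite (ge0_integralD nu mhp
  (fun p _ => adde_ge0 (S0 fr 0 p) (S0 fi (pi / 2) p)) (emeasurable_funD m1 m2)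
  (fun p _ => adde_ge0 (S0 fi 0 p) (S0 fr (pi / 2) p)) (emeasurable_funD m3 m4)).
rewrite (ge0_integralD nu mhp (fun p _ => S0 _ _ p) m1 (fun p _ => S0 _ _ p) m2).
rewrite (ge0_integralD nu mhp (fun p _ => S0 _ _ p) m3 (fun p _ => S0 _ _ p) m4).
have e1 := SE fr 0 mfr fr0 Ifr; have e2 := SE fi (pi / 2) mfi fi0 Ifi.
have e3 := SE fi 0 mfi fi0 Ifi; have e4 := SE fr (pi / 2) mfr fr0 Ifr.
apply: le_trans (leeD (leeD e1 e2) (leeD e3 e4)) _.
rewrite abs2_split -/(E fr) -/(E fi).
have Er0 : (0 <= E fr)%E := int_sqr_ge0 fr.
have Ei0 : (0 <= E fi)%E := int_sqr_ge0 fi.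
have Erf : E fr \is a fin_num by rewrite (ge0_fin_numE Er0); exact: froo.
have Eif : E fi \is a fin_num by rewrite (ge0_fin_numE Ei0); exact: fioo.
rewrite -(fineK Erf) -(fineK Eif); move: (fine (E fr)) (fine (E fi)) => a b.
by rewrite -!(EFinM, EFinD) lee_fin le_eqVlt; apply/orP; left; apply/eqP; ring.
Qed.

End LaplaceEmbedding.

(** * Test functions *)

Section GammaIntegral.
Context {R : realType}.
Local Notation mu := (@lebesgue_measure R).
Local Notation T := (measurableTypeR R).
Local Notation pos := (`]0%R, +oo[%classic : set T).

Lemma cvg_expMexpR (n : nat) (s : R) : 0 < s ->
  t ^+ n * expR (- (s * t)) @[t --> +oo] --> (0 : R).
Proof.
move=> s0; have s20 : 0 < s / 2 by rewrite divr_gt0.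
pose M := n`!%:R / (s / 2) ^+ n.
have M0 : 0 <= M by rewrite divr_ge0// exprn_ge0// ltW.
apply/cvgr0Pnorm_lt => eps eps0.
have ec : 0 < eps / (M + 1) by rewrite divr_gt0// ltr_pwDr.
have := cvg_expR_mulN s20; move/cvgr0Pnorm_lt => /(_ _ ec).
apply: filterS2 (nbhs_pinfty_ge (num_real 0)) => t t0.
rewrite ger0_norm ?expR_ge0// ltr_pdivlMr ?ltr_pwDr// => /(le_lt_trans _); apply.
rewrite ger0_norm ?mulr_ge0 ?exprn_ge0 ?expR_ge0//.
have -> : - (s * t) = - (s / 2 * t) + - (s / 2 * t) by field.
rewrite expRD mulrA [leRHS]mulrC ler_wpM2r ?expR_ge0//.
rewrite (@le_trans _ _ M)// ?lerDl//.
rewrite expRN ler_pdivrMr ?expR_gt0// /M mulrAC ler_pdivlMr ?exprn_gt0//.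
rewrite -exprMn [t * _]mulrC [leRHS]mulrC -ler_pdivrMr ?ltr0n ?fact_gt0//.
case: n {M M0 ec} => [|n].
  by rewrite expr0 fact0 divr1 -[leLHS]expR0 ler_expR mulr_ge0// ltW.
by apply: le_trans (expR_ge1Dxn n _); [rewrite lerDr|rewrite mulr_ge0// ltW].
Qed.

Lemma is_derive_expn (n : nat) (x : R) :
  is_derive x 1 (fun t : R => t ^+ n.+1) (n.+1%:R * x ^+ n).
Proof.
have := is_deriveX n.+1 (is_derive_id x (1 : R)).
by rewrite /GRing.scale/= mulr1 exprfctE.
Qed.

(** Integration by parts in the form of an antiderivative: the recursion in n gives
    both its limit at infinity and its value at 0. *)
Lemma gamma_antiderivative (n : nat) (s : R) : 0 < s ->
  exists F : R -> R, [/\ forall x : R, is_derive x 1 F (x ^+ n * expR (- (s * x))),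
    F x @[x --> +oo] --> (0 : R) & F 0 = - (n`!%:R / s ^+ n.+1)].
Proof.
move=> s0; elim: n => [|n [F [dF F0 F00]]].
  exists (fun x => - s^-1 * expR (- (s * x))); split.
  - move=> x; apply: is_derive_eq; rewrite /GRing.scale/=; field.
    by rewrite gt_eqF.
  - rewrite -[X in _ --> X](mulr0 (- s^-1)); apply: cvgMr.
    exact: cvg_expR_mulN.
  - by rewrite mulr0 oppr0 expR0 mulr1 fact0 expr1 mul1r.
exists (fun x => - s^-1 * (x ^+ n.+1 * expR (- (s * x))) + n.+1%:R / s * F x); split.
- move=> x; have dFx := dF x; have dXn := is_derive_expn n x.
  apply: is_derive_eq; rewrite /GRing.scale/= exprS; field.
  by rewrite gt_eqF.
- rewrite -[X in _ --> X]addr0 -[X in _ --> X + _](mulr0 (- s^-1)).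
  rewrite -[X in _ --> _ + X](mulr0 (n.+1%:R / s)).
  by apply: cvgD; apply: cvgMr => //; exact: cvg_expMexpR.
- rewrite expr0n/= mul0r mulr0 add0r F00 factS natrM mulrN; congr (- _).
  rewrite [s ^+ n.+2]exprS; field.
  by rewrite expf_neq0 gt_eqF.
Qed.

Lemma continuous_gamma (n : nat) (s : R) :
  continuous (fun t : R => t ^+ n * expR (- (s * t))).
Proof.
move=> t; apply: cvgM; first exact: exprn_continuous.
apply: continuous_comp; last exact: continuous_expR.
by apply: cvgN; apply: cvgM; [exact: cvg_cst|exact: cvg_id].
Qed.

Lemma integral_gamma (n : nat) (s : R) : 0 < s ->
  (\int[mu]_(t in pos) (t ^+ n * expR (- (s * t)))%:E = (n`!%:R / s ^+ n.+1)%:E)%E.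
Proof.
move=> s0; have [F [dF Fl F0]] := gamma_antiderivative n s0.
rewrite integral_itv_obnd_cbnd; last first.
  apply: measurable_funTS; apply/measurable_EFinP.
  exact: (continuous_measurable_fun (@continuous_gamma n s)).
rewrite (ge0_integral_antiderivative _ _ dF Fl).
- by rewrite F0 sub0r opprK.
- by move=> t t0; rewrite mulr_ge0 ?exprn_ge0 ?expR_ge0.
- exact: continuous_gamma.
Qed.

Lemma integrable_gamma (n : nat) (s : R) : 0 < s ->
  mu.-integrable pos (EFin \o (fun t => t ^+ n * expR (- (s * t)))).
Proof.
move=> s0; apply/integrableP; split.
  apply: measurable_funTS; apply/measurable_EFinP.
  exact: (continuous_measurable_fun (@continuous_gamma n s)).
have -> : (\int[mu]_(t in pos) `|(EFin \o (fun t => (t ^+ n * expR (- (s * t)))%R)) t| =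
           \int[mu]_(t in pos) (t ^+ n * expR (- (s * t)))%:E)%E.
  apply: eq_integral => t; rewrite inE/= in_itv/= andbT => t0.
  by rewrite ger0_norm// mulr_ge0 ?expR_ge0// exprn_ge0// ltW.
by rewrite integral_gamma// ltry.
Qed.

Lemma cos_ge1B (x : R) : 1 - `|x| <= cos x.
Proof.
rewrite -cos_norm; move: `|x| (normr_ge0 x) => a; rewrite le_eqVlt => /predU1P[<-|a0].
  by rewrite cos0 subr0.
have dcos (t : R) : t \in `]0, a[ -> is_derive t 1 cos (- sin t).
  by move=> _; exact: is_derive_cos.
have ccos : {within `[0, a], continuous cos}.
  by apply: continuous_subspaceT => t; exact: continuous_cos.
have [c _] := MVT a0 dcos ccos; rewrite cos0 subr0 => E.
have -> : cos a = 1 - sin c * a by rewrite -[cos a](subrK 1) E mulNr addrC.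
by rewrite lerD2l lerN2 ler_piMl ?(ltW a0)// sin_le1.
Qed.

End GammaIntegral.

Section TestFunctions.
Context {R : realType}.
Local Open Scope complex_scope.
Local Notation mu := (@lebesgue_measure R).
Local Notation T := (measurableTypeR R).
Local Notation TT := (measurableTypeR R * measurableTypeR R)%type.
Local Notation pos := (`]0%R, +oo[%classic : set T).

Lemma laplace_test_funE (n : nat) (a b t : R) :
  laplace_test_fun n.+1 (a +i* b) t =
  (t ^+ n * expR (- (a * t)) * cos (b * t)) +i*
  (- (t ^+ n * expR (- (a * t)) * sin (b * t))).
Proof.
rewrite /laplace_test_fun/= -rmorphXn/= /cexp/=.
rewrite !mulr0 subr0 add0r cosN sinN.
by apply/eqP; rewrite eq_complex/= !mul0r subr0 addr0 mulrN !mulrA; apply/andP; split; apply/eqP; ring.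
Qed.

Lemma Re_test_fun n (l : R[i]) t : complex.Re (laplace_test_fun n.+1 l t) =
  t ^+ n * expR (- (complex.Re l * t)) * cos (complex.Im l * t).
Proof. by case: l => a b; rewrite laplace_test_funE. Qed.

Lemma Im_test_fun n (l : R[i]) t : complex.Im (laplace_test_fun n.+1 l t) =
  - (t ^+ n * expR (- (complex.Re l * t)) * sin (complex.Im l * t)).
Proof. by case: l => a b; rewrite laplace_test_funE. Qed.

Lemma abs2_test_fun n (l : R[i]) t : abs2 (laplace_test_fun n.+1 l t) =
  t ^+ (2 * n) * expR (- (2 * complex.Re l * t)).
Proof.
rewrite abs2E Re_test_fun Im_test_fun sqrrN.
rewrite [_ ^+ 2 + _](_ : _ = (t ^+ n * expR (- (complex.Re l * t))) ^+ 2 *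
  (cos (complex.Im l * t) ^+ 2 + sin (complex.Im l * t) ^+ 2)); last by ring.
rewrite cos2Dsin2 mulr1 exprMn -exprM mulnC -expRM_natl; congr (_ * expR _).
by rewrite mulrN mulrA.
Qed.

Lemma cmeasurable_test_fun n (l : R[i]) (D : set T) :
  cmeasurable D (laplace_test_fun n.+1 l).
Proof.
have mid : measurable_fun setT (fun t : T => t : R) by [].
have me : measurable_fun setT (fun t : R => t ^+ n * expR (- (complex.Re l * t))).
  exact: (continuous_measurable_fun (@continuous_gamma R n (complex.Re l))).
have ml : measurable_fun setT (fun t : R => complex.Im l * t) by exact: measurable_funM.
split; apply: measurable_funTS.
- rewrite (_ : (fun x => _) = (fun t : T =>
    t ^+ n * expR (- (complex.Re l * t)) * cos (complex.Im l * t))); last first.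
    by apply/funext => t; rewrite Re_test_fun.
  apply: measurable_funM => //.
  exact: (measurableT_comp (continuous_measurable_fun (@continuous_cos R)) ml).
- rewrite (_ : (fun x => _) = (fun t : T =>
    - (t ^+ n * expR (- (complex.Re l * t)) * sin (complex.Im l * t)))); last first.
    by apply/funext => t; rewrite Im_test_fun.
  apply: measurableT_comp => //; apply: measurable_funM => //.
  exact: (measurableT_comp (continuous_measurable_fun (@continuous_sin R)) ml).
Qed.

(** The transform of the test function is n! / (z + lambda)^(n+1). With
    s = x + a, the inequality cos u >= 1 - |u| bounds its real part below by
    n! / s^(n+1) - |y + b| (n+1)! / s^(n+2), whose second term is at most half of the
    first one. *)
Lemma Re_laplace_test_ge n (a b x y : R) : 0 < a -> 0 < x ->
  2 * n.+1%:R * `|y + b| <= x + a ->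
  n`!%:R / (2 * (x + a) ^+ n.+1) <=
  complex.Re (laplace (laplace_test_fun n.+1 (a +i* b)) (cplx (x, y))).
Proof.
move=> a0 x0 yb; have s0 : 0 < x + a by rewrite addr_gt0.
set s := x + a in s0 yb *.
have mpos : measurable pos by exact: measurable_itv.
have I1 := integrable_gamma n s0; have I2 := integrable_gamma n.+1 s0.
have I3 := integrableZl mpos `|y + b| I2.
have IB := integrableB mpos I1 I3.
have ReE t : complex.Re (laplace_integrand (laplace_test_fun n.+1 (a +i* b)) (cplx (x, y)) t) =
    t ^+ n * expR (- (s * t)) * cos (t * (y + b)).
  rewrite Re_laplace_integrand Re_test_fun Im_test_fun/=.
  rewrite [t * (y + b)]mulrDr cosD [b * t]mulrC /s [- ((x + a) * t)](_ : _ = - (x * t) + - (a * t)); last by ring.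
  by rewrite expRD; ring.
have Ic : mu.-integrable pos (EFin \o (fun t => t ^+ n * expR (- (s * t)) * cos (t * (y + b)))).
  apply: (le_integrable mpos _ _ I1).
  - apply: measurable_funTS; apply/measurable_EFinP; apply: measurable_funM.
      exact: (continuous_measurable_fun (@continuous_gamma R n s)).
    apply: (measurableT_comp (continuous_measurable_fun (@continuous_cos R))).
    exact: measurable_funM.
  - by move=> t _ /=; rewrite lee_fin normrM ler_piMr// cos_max.
rewrite /laplace/= (@eq_Rintegral _ _ _ mu _
  (fun t => t ^+ n * expR (- (s * t)) * cos (t * (y + b)))); last by move=> t _; rewrite ReE.
have lower : \int[mu]_(t in pos) (t ^+ n * expR (- (s * t)) -
    `|y + b| * (t ^+ n.+1 * expR (- (s * t)))) <=
    \int[mu]_(t in pos) (t ^+ n * expR (- (s * t)) * cos (t * (y + b))).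
  apply: le_Rintegral => // t; rewrite /= in_itv/= andbT => t0.
  rewrite (_ : _ - _ = t ^+ n * expR (- (s * t)) * (1 - t * `|y + b|)); last first.
    by rewrite exprS; ring.
  rewrite ler_wpM2l ?mulr_ge0 ?expR_ge0 ?exprn_ge0 ?(ltW t0)//.
  by apply: le_trans (cos_ge1B _); rewrite normrM gtr0_norm.
apply: le_trans lower.
rewrite (RintegralB mpos I1 I3) (RintegralZl _ mpos I2) /Rintegral !integral_gamma//=.
rewrite factS natrM.
have fs0 : 0 < n`!%:R / s ^+ n.+1 :> R by rewrite divr_gt0 ?ltr0n ?fact_gt0// exprn_gt0.
have -> : n`!%:R / (2 * s ^+ n.+1) = n`!%:R / s ^+ n.+1 / 2 :> R.
  by field; rewrite expf_neq0// gt_eqF.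
have -> : `|y + b| * (n.+1%:R * n`!%:R / s ^+ n.+2) =
    n`!%:R / s ^+ n.+1 * (n.+1%:R * `|y + b| / s).
  by rewrite [s ^+ n.+2]exprS; field; rewrite expf_neq0 ?gt_eqF.
rewrite -[X in _ <= X - _]mulr1 -mulrBr ler_pM2l//.
have : n.+1%:R * `|y + b| / s <= 2^-1.
  by rewrite ler_pdivrMr// ler_pdivlMl// mulrA.
move: (_ / s) => q q2; lra.
Qed.

End TestFunctions.

Lemma measurable_invr_expD (R : realType) (b : R) (P : nat) : 0 < b ->
  measurable_fun (`[0%R, +oo[%classic : set (measurableTypeR R))
    (fun r => (((b + r) ^+ P)^-1)%:E).
Proof.
move=> b0; apply/measurable_EFinP; apply: subspace_continuous_measurable_fun => //.
apply: continuous_in_subspaceT => r; rewrite inE/= in_itv/= andbT => r0.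
apply: cvgV; first by rewrite expf_neq0// gt_eqF// ltr_wpDr.
apply: (@continuous_comp _ _ _ (fun r => b + r) (fun x => x ^+ P)).
  by apply: cvgD; [exact: cvg_cst|exact: cvg_id].
exact: exprn_continuous.
Qed.

Section TestEnergy.
Context {R : realType}.
Local Open Scope complex_scope.
Local Notation mu := (@lebesgue_measure R).
Local Notation T := (measurableTypeR R).
Local Notation TT := (measurableTypeR R * measurableTypeR R)%type.
Local Notation pos := (`]0%R, +oo[%classic : set T).
Variable nut : {sigma_finite_measure set T -> \bar R}.

Let q (n : nat) (a : R) (p : TT) : R :=
  if (0 <= p.1) && (0 < p.2) then p.2 ^+ (2 * n) * expR (- (2 * (a + p.1) * p.2))
  else 0.

Let q_ge0 n a p : 0 <= q n a p.
Proof.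
rewrite /q; case: ifP => // /andP[_ t0].
by rewrite mulr_ge0 ?expR_ge0 ?exprn_ge0// ltW.
Qed.

Let measurable_q n a : measurable_fun setT (q n a).
Proof.
have m1 : measurable_fun setT (fun p : TT => p.1 : R) := measurable_fst.
have m2 : measurable_fun setT (fun p : TT => p.2 : R) := measurable_snd.
apply: measurable_fun_ifT => //.
  apply: measurable_and.
    exact: measurable_fun_ler.
  exact: measurable_fun_ltr.
apply: measurable_funM; first exact: measurable_funX.
apply: (measurableT_comp (@measurable_expR R)); apply: measurableT_comp => //.
apply: measurable_funM => //; apply: measurable_funM => //.
exact: measurable_funD.
Qed.

(** Tonelli and the Gamma integral: the energy of the test function is a negative
    moment of nut. The base 2 (a + r) is bounded below by a + r. *)
Lemma test_fun_energy_le (n : nat) (l : R[i]) : 0 < complex.Re l ->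
  (\int[mu]_(t in pos) ((abs2 (laplace_test_fun n.+1 l t))%:E * zen_weight nut t) <=
   (2 * pi * (2 * n)`!%:R)%:E *
   \int[nut]_(r in `[0%R, +oo[) (((complex.Re l + r) ^+ (2 * n).+1)^-1)%:E)%E.
Proof.
set a := complex.Re l => a0.
have pi20 : 0 <= 2 * pi :> R by rewrite mulr_ge0// pi_ge0.
have mq : measurable_fun setT (fun p => (q n a p)%:E).
  by apply/measurable_EFinP; exact: measurable_q.
have q0 p : (0 <= (q n a p)%:E)%E by rewrite lee_fin.
have mpos : measurable pos by exact: measurable_itv.
have mnn : measurable (`[0%R, +oo[%classic : set T) by exact: measurable_itv.
have LE : (\int[mu]_(t in pos) ((abs2 (laplace_test_fun n.+1 l t))%:E * zen_weight nut t) =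
    (2 * pi)%:E * \int[mu]_t \int[nut]_r (q n a (r, t))%:E)%E.
  rewrite -(ge0_integralZl_EFin mu measurableT _ _ pi20); last 2 first.
  - by move=> t _; apply: integral_ge0 => r _; exact: q0.
  - exact: (measurable_fun_fubini_tonelli_G (m1 := nut) _ mq q0).
  rewrite [LHS]integral_mkcond; apply: eq_integral => t _; rewrite patchE.
  case: ifPn => [|]; last first.
    rewrite notin_setE/= in_itv/= andbT => /negP/negPf t0.
    rewrite integral0_eq ?mule0// => r _.
    by rewrite /q/= t0 andbF.
  rewrite inE/= in_itv/= andbT => t0.
  rewrite abs2_test_fun /zen_weight muleCA; congr (_ * _)%E.
  rewrite -(ge0_integralZl_EFin nut mnn).
  - rewrite integral_mkcond; apply: eq_integral => r _; rewrite patchE.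
    case: ifPn => [|]; last first.
      by rewrite notin_setE/= in_itv/= andbT /q/= => /negP/negPf ->.
    rewrite inE/= in_itv/= andbT /q/= t0 => ->/=; rewrite -EFinM; congr EFin.
    by rewrite -[LHS]mulrA -expRD; congr (_ * expR _); rewrite -/a; ring.
  - by move=> r _; rewrite lee_fin expR_ge0.
  - apply: measurable_funTS; apply/measurable_EFinP.
    apply: (measurableT_comp (@measurable_expR R)); apply: measurableT_comp => //.
    by apply: measurable_funM => //; exact: measurable_funM.
  - by rewrite mulr_ge0 ?expR_ge0 ?exprn_ge0// ltW.
rewrite LE -(fubini_tonelli (m1 := nut) (m2 := mu) _ mq q0) [(2 * pi * _)%:E]EFinM -muleA.
apply: lee_wpmul2l; first by rewrite lee_fin.
have f0 : 0 <= (2 * n)`!%:R :> R by [].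
have mI := measurable_invr_expD (2 * n).+1 a0.
rewrite -(ge0_integralZl_EFin nut mnn _ mI f0); last first.
  move=> r; rewrite /= in_itv/= andbT => r0.
  by rewrite lee_fin invr_ge0 exprn_ge0// addr_ge0// ltW.
rewrite [leRHS]integral_mkcond; apply: (ge0_le_integral nut measurableT).
- by move=> r _; apply: integral_ge0 => t _; exact: q0.
- exact: (measurable_fun_fubini_tonelli_F (m2 := mu) _ mq q0).
- apply/(measurable_restrictT _ mnn); exact: measurable_funeM.
- move=> r _; rewrite patchE; case: ifPn => [|]; last first.
    rewrite notin_setE/= in_itv/= andbT => /negP/negPf r0.
    by rewrite integral0_eq// => t _; rewrite /q/= r0.
  rewrite inE/= in_itv/= andbT => r0.
  have ar0 : 0 < a + r by rewrite ltr_wpDr.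
  have -> : (\int[mu]_t (q n a (r, t))%:E =
      \int[mu]_(t in pos) (t ^+ (2 * n) * expR (- (2 * (a + r) * t)))%:E)%E.
    rewrite [RHS]integral_mkcond; apply: eq_integral => t _; rewrite patchE /q/= r0/=.
    case: ltP => t0; first by rewrite mem_set//= in_itv/= t0.
    by rewrite memNset//= in_itv/= andbT; apply/negP; rewrite -leNgt.
  rewrite integral_gamma ?mulr_gt0// -EFinM lee_fin ler_wpM2l//.
  rewrite lef_pV2 ?posrE ?exprn_gt0 ?mulr_gt0//.
  by rewrite lerXn2r ?nnegrE ?mulr_ge0 ?(ltW ar0)// ler_peMl ?(ltW ar0)// ler1n.
Qed.

End TestEnergy.

Section DyadicDecay.
Context {R : realType}.
Local Notation T := (measurableTypeR R).
Variables (nut : {measure set T -> \bar R}) (V : R -> R) (K : R).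
Hypothesis V_gt0 : forall x : R, 0 < x -> 0 < V x.
Hypothesis nutV : forall x : R, 0 < x -> nut `[0, x[%classic = (V x)%:E.
Hypothesis K_gt0 : 0 < K.
Hypothesis V_doubling : forall x : R, 0 < x -> V (2 * x) <= K * V x.

Lemma doubling_iter (L : R) (k : nat) : 0 < L -> V (2 ^+ k * L) <= K ^+ k * V L.
Proof.
move=> L0; elim: k => [|k IHk]; first by rewrite !expr0 !mul1r.
rewrite exprS -mulrA (le_trans (V_doubling _))// ?mulr_gt0 ?exprn_gt0//.
by rewrite exprS -mulrA ler_pM2l.
Qed.

(** Dyadic decomposition of the half-line at the points 2^k L. From one piece to
    the next the integrand decreases by 2^-P, while doubling lets the mass grow by K
    at most, so that for 2 K <= 2^P the sum is dominated by a geometric series of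
    ratio 1/2. This is where the exponent of the test functions has to be large. *)
Lemma integral_inv_pow_le (L : R) (P : nat) : 0 < L -> 2 * K <= 2 ^+ P ->
  (\int[nut]_(r in `[0%R, +oo[) (((L + r) ^+ P)^-1)%:E <=
   (2 * 2 ^+ P / L ^+ P * V L)%:E)%E.
Proof.
move=> L0 KP; set Q : R := 2 ^+ P in KP *.
have Q0 : 0 < Q by rewrite exprn_gt0.
have mnn : measurable (`[0%R, +oo[%classic : set T) by exact: measurable_itv.
have LP0 : 0 < L ^+ P by rewrite exprn_gt0.
pose c k : R := Q / L ^+ P / Q ^+ k.
have c0 k : 0 < c k by rewrite /c !divr_gt0// exprn_gt0.
pose t k (r : T) : \bar R := ((c k)%:E * (\1_(`[0%R, (2 ^+ k * L)%R[%classic : set T) r)%:E)%E.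
have t0 k r : (0 <= t k r)%E by rewrite mule_ge0// lee_fin// ltW.
have mt k (D : set T) : measurable_fun D (t k).
  by apply: measurable_funeM; apply/measurable_EFinP; apply: measurable_funTS; exact: measurable_indic.
apply: (@le_trans _ _ (\int[nut]_(r in `[0%R, +oo[) \sum_(0 <= k <oo) t k r)%E).
  apply: (ge0_le_integral nut mnn).
  - move=> r; rewrite /= in_itv/= andbT => r0.
    by rewrite lee_fin invr_ge0 exprn_ge0// addr_ge0// ltW.
  - exact: measurable_invr_expD.
  - by apply: ge0_emeasurable_sum => // k x _ _; exact: t0.
  - move=> r; rewrite /= in_itv/= andbT => r0.
    (* the least k for which r < 2^k L gives the term that dominates the integrand at r *)
    have exk : exists k, r < 2 ^+ k * L.
      have [m rm] : exists m : nat, r / L < m%:R.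
        by exists (Num.bound (r / L)); rewrite archi_boundP// divr_ge0// ltW.
      exists m; rewrite -ltr_pdivrMr// (lt_trans rm)//.
      by rewrite -natrX ltr_nat ltn_expl.
    have [k rk kmin] := ex_minnP exk.
    have : (t k r <= \sum_(0 <= k <oo) t k r)%E.
      apply: le_trans (nneseries_lim_ge (P := xpredT) k.+1 _) => //.
      rewrite big_nat_recr//= leeDr// sume_ge0//.
    apply: le_trans; rewrite /t indicE mem_set ?mule1; last first.
      by rewrite /= in_itv/= r0.
    rewrite lee_fin /c -[_ / _ / _]mulrA -invfM -[leRHS]invrK lef_pV2 ?posrE; last 2 first.
    + by rewrite exprn_gt0// ltr_wpDr.
    + by rewrite invr_gt0 divr_gt0// mulr_gt0// exprn_gt0.
    rewrite invf_div.
    case: k rk kmin => [|k] rk kmin.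
      rewrite expr0 mulr1 ler_pdivrMr// (le_trans (y := (L + r) ^+ P * 1))//.
        by rewrite mulr1 lerXn2r ?nnegrE ?addr_ge0 ?(ltW L0)// lerDl.
      by rewrite ler_wpM2l ?exprn_ge0 ?addr_ge0 ?(ltW L0)// exprn_ege1// ler1n.
    rewrite exprS mulrCA mulrC mulKf ?gt_eqF//.
    have kr : 2 ^+ k * L <= r by rewrite leNgt; apply/negP => /kmin; rewrite ltnn.
    rewrite /Q -exprM mulnC exprM -exprMn lerXn2r ?nnegrE ?addr_ge0 ?(ltW L0)//.
      by rewrite mulr_ge0 ?exprn_ge0// ltW.
    by rewrite mulrC (le_trans kr)// lerDr ltW.
rewrite integral_nneseries//.
have It k : (\int[nut]_(r in `[0%R, +oo[) t k r <= (Q / L ^+ P * V L / 2 ^+ k)%:E)%E.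
  rewrite ge0_integralZl_EFin ?(ltW (c0 k))//; last first.
    by apply/measurable_EFinP; apply: measurable_funTS; exact: measurable_indic.
  have m2 : measurable (`[0%R, (2 ^+ k * L)%R[%classic : set T) by exact: measurable_itv.
  have L20 : 0 < 2 ^+ k * L by rewrite mulr_gt0 ?exprn_gt0.
  rewrite integral_indic// setIidl; last first.
    by move=> r; rewrite /= !in_itv/= => /andP[->].
  rewrite nutV// -EFinM lee_fin /c.
  apply: (@le_trans _ _ (Q / L ^+ P / Q ^+ k * (K ^+ k * V L))).
    by rewrite ler_pM2l ?c0// doubling_iter.
  rewrite -!mulrA ler_pM2l// ler_pM2l ?invr_gt0// mulrA mulrC ler_pM2l ?V_gt0//.
  rewrite mulrC ler_pdivrMr ?exprn_gt0// mulrC ler_pdivlMr ?exprn_gt0//.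
  by rewrite -exprMn lerXn2r ?nnegrE ?mulr_ge0 ?(ltW K_gt0) ?(ltW Q0)// mulrC.
apply: lime_le.
  by apply: is_cvg_nneseries => k _ _; exact: integral_ge0.
apply: nearW => m.
apply: (@le_trans _ _ (\sum_(0 <= k < m) (Q / L ^+ P * V L / 2 ^+ k)%:E)%E).
  by apply: lee_sum => k _; exact: It.
rewrite sumEFin lee_fin -mulr_sumr.
rewrite [leRHS](_ : _ = Q / L ^+ P * V L * 2); last by ring.
rewrite ler_pM2l ?mulr_gt0 ?invr_gt0 ?V_gt0//.
have h2 : `|2^-1 : R| < 1 by rewrite ger0_norm// invf_lt1// ltr1n.
have := @geometric_le_lim R m 1 2^-1 ler01 _ h2; rewrite invr_gt0 => /(_ (ltr0Sn _ 1)).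
rewrite (_ : 1 / (1 - 2^-1) = 2 :> R); last by field.
apply: le_trans; rewrite /series/= le_eqVlt; apply/orP; left; apply/eqP.
by apply: eq_bigr => k _; rewrite /geometric/= mul1r exprVn.
Qed.

End DyadicDecay.

(** * Initial masses, norms and linearity *)

Section InitialMass.
Context {R : realType}.
Local Notation T := (measurableTypeR R).
Variable nut : {measure set T -> \bar R}.

Definition initial_mass (x : R) : R := fine (nut `[0, x[%classic).

Hypothesis nutN : nut (~` (`[0%R, +oo[%classic : set T)) = 0%E.
Hypothesis nut_lty : forall t : R, 0 < t -> (0 < nut `[0%R, t[%classic < +oo)%E.

Lemma initial_massE (x : R) : 0 < x -> nut `[0, x[%classic = (initial_mass x)%:E.
Proof.
by move=> x0; rewrite /initial_mass fineK// ge0_fin_numE//; case/andP: (nut_lty x0).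
Qed.

Lemma initial_mass_ge0 (x : R) : 0 <= initial_mass x.
Proof. exact: fine_ge0. Qed.

Lemma initial_mass_gt0 (x : R) : 0 < x -> 0 < initial_mass x.
Proof.
by move=> x0; rewrite -lte_fin -initial_massE//; case/andP: (nut_lty x0).
Qed.

Lemma initial_mass_le (x y : R) : x <= y -> initial_mass x <= initial_mass y.
Proof.
move=> xy; have [x0|x0] := leP x 0.
  by rewrite {1}/initial_mass set_itv_ge ?measure0 ?initial_mass_ge0// bnd_simp -leNgt.
rewrite -lee_fin -!initial_massE ?(lt_le_trans x0)//.
apply: le_measure; rewrite ?inE; try exact: measurable_itv.
by move=> r; rewrite /= !in_itv/= => /andP[-> /lt_le_trans]; exact.
Qed.

Lemma measurable_initial_mass : measurable_fun setT initial_mass.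
Proof. by apply: nondecreasing_measurable => // x y; exact: initial_mass_le. Qed.

Lemma sigma_finite_half_line : sigma_finite setT nut.
Proof.
have mnn : measurable (`[0%R, +oo[%classic : set T) by exact: measurable_itv.
exists (fun n => ~` `[0%R, +oo[%classic `|` `[0%R, n%:R[%classic) => [|n].
  apply/esym/seteqP; split => // r _.
  have [r0|r0] := leP 0 r; last first.
    by exists 0%N => //; left; rewrite /= in_itv/= andbT; apply/negP; rewrite -ltNge.
  exists (Num.bound r) => //; right.
  by rewrite /= in_itv/= r0 archi_boundP.
have mI : measurable (`[0%R, n%:R[%classic : set T) by exact: measurable_itv.
split; first by apply: measurableU => //; exact: measurableC.
have mC := measurableC mnn.
apply: (le_lt_trans (measureU2 _ mC mI)).
rewrite [X in (X + _)%E](_ : _ = 0%E) ?add0e; last exact: nutN.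
case: n mI => [|n] mI; first by rewrite set_itv_ge ?measure0// bnd_simp ltxx.
by case/andP: (nut_lty (ltr0Sn R n)).
Qed.

End InitialMass.

(** An alias of m that carries the proof s as a canonical structure. *)
Definition with_sigma_finite {d} {T : measurableType d} {R : realType}
  (m : {measure set T -> \bar R}) (s : sigma_finite setT m) : set T -> \bar R := m.

Section WithSigmaFinite.
Context {d} {T : measurableType d} {R : realType}.
Variables (m : {measure set T -> \bar R}) (s : sigma_finite setT m).
HB.instance Definition _ := Measure.copy (with_sigma_finite s) m.
HB.instance Definition _ := Measure_isSigmaFinite.Build _ _ _ (with_sigma_finite s) s.
End WithSigmaFinite.

Section L2norm.
Context {d : measure_display} {T : measurableType d} {R : realType}.
Implicit Types (m : {measure set T -> \bar R}) (D : set T) (f : T -> R[i]).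

Lemma L2norm_lty m D (v : T -> \bar R) f :
  (L2norm m D v f < +oo <-> \int[m]_(x in D) ((abs2 (f x))%:E * v x) < +oo)%E.
Proof.
split=> [/lty_poweRy|]; first by apply; rewrite invr_eq0 pnatr_eq0.
exact: poweR_lty.
Qed.

(** Squaring, so that norm inequalities become inequalities between integrals. *)
Lemma L2norm_le d' (T' : measurableType d') m (m' : {measure set T' -> \bar R})
    D (D' : set T') (v : T -> \bar R) (v' : T' -> \bar R) f (f' : T' -> R[i]) (C : R) :
  0 <= C ->
  (forall x, D x -> 0 <= v x)%E -> (forall x, D' x -> 0 <= v' x)%E ->
  (L2norm m D v f <= C%:E * L2norm m' D' v' f')%E <->
  (\int[m]_(x in D) ((abs2 (f x))%:E * v x) <=
   (C ^+ 2)%:E * \int[m']_(x in D') ((abs2 (f' x))%:E * v' x))%E.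
Proof.
move=> C0 v0 v'0; rewrite /L2norm.
set A := (\int[m]_(x in D) _)%E; set B := (\int[m']_(x in D') _)%E.
have ab (z : R[i]) : (0 <= (abs2 z)%:E)%E by rewrite lee_fin abs2_ge0.
have A0 : (0 <= A)%E by apply: integral_ge0 => x Dx; rewrite mule_ge0 ?v0.
have B0 : (0 <= B)%E by apply: integral_ge0 => x Dx; rewrite mule_ge0 ?v'0.
have h0 : 0 <= 2^-1 :> R by rewrite invr_ge0.
have CE : (C%:E * poweR B 2^-1 = poweR ((C ^+ 2)%:E * B) 2^-1)%E.
  rewrite poweRM ?lee_fin ?sqr_ge0// poweR_EFin; congr (_%:E * _)%E.
  by rewrite powR12_sqrt ?sqr_ge0// sqrtr_sqr ger0_norm.
have S0 : (0 <= (C ^+ 2)%:E * B)%E by rewrite mule_ge0// lee_fin sqr_ge0.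
have pK (x : \bar R) : (0 <= x)%E -> poweR (poweR x 2^-1) 2 = x.
  by move=> x0; rewrite -poweRrM mulVf ?pnatr_eq0// poweRe1.
rewrite CE; split => [|AB].
  move=> /(gt0_ler_poweR (ler0n R 2)); rewrite !pK//; apply;
    by rewrite in_itv/= poweR_ge0 leey.
by apply: (gt0_ler_poweR h0) AB; rewrite in_itv/= leey andbT.
Qed.

End L2norm.

Section ComplexIntegralLinearity.
Context {d : measure_display} {T : measurableType d} {R : realType}.
Variables (m : {measure set T -> \bar R}) (D : set T).
Hypothesis mD : measurable D.

Let Rintegral_axbyc (x y : R) (f g h : T -> R) :
  m.-integrable D (EFin \o f) -> m.-integrable D (EFin \o g) ->
  m.-integrable D (EFin \o h) ->
  \int[m]_(t in D) (x * f t + y * g t + h t) =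
  x * \int[m]_(t in D) f t + y * \int[m]_(t in D) g t + \int[m]_(t in D) h t.
Proof.
move=> If Ig Ih.
have Ixf := integrableZl mD x If; have Iyg := integrableZl mD y Ig.
by rewrite (RintegralD mD (integrableD mD Ixf Iyg) Ih) (RintegralD mD Ixf Iyg)
  (RintegralZl _ mD If) (RintegralZl _ mD Ig).
Qed.

Lemma cintegral_linear (a : R[i]) (f g : T -> R[i]) :
  cintegrable m D f -> cintegrable m D g ->
  cintegral m D (fun t => a * f t + g t) = a * cintegral m D f + cintegral m D g.
Proof.
case: a => x y [If If'] [Ig Ig']; apply/eqP; rewrite eq_complex/=.
apply/andP; split; apply/eqP.
- rewrite -[- (y * _)]mulNr -Rintegral_axbyc//; apply: eq_Rintegral => t _.
  by case: (f t) (g t) => f1 f2 [g1 g2] /=; rewrite mulNr.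
- rewrite -Rintegral_axbyc//; apply: eq_Rintegral => t _.
  by case: (f t) (g t) => f1 f2 [g1 g2].
Qed.

End ComplexIntegralLinearity.

(** * Carleson squares *)

Section CarlesonSquares.
Context {R : realType}.
Local Notation mu := (@lebesgue_measure R).
Local Notation T := (measurableTypeR R).
Local Notation TT := (measurableTypeR R * measurableTypeR R)%type.

Lemma bounded_lebesgue_measure_lty (I : set R) : is_interval I -> bounded_set I ->
  (mu I < +oo)%E.
Proof.
move=> iI [M [Mr MI]].
have IM (x : R) : I x -> `|x| <= `|M| + 1.
  by apply: MI; rewrite (le_lt_trans (ler_norm M))// ltrDl.
have M0 : - (`|M| + 1) <= `|M| + 1 by rewrite -subr_ge0 opprK addr_ge0// addr_ge0.
apply: (@le_lt_trans _ _ (mu `[- (`|M| + 1), `|M| + 1]%classic)).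
  apply: le_measure; rewrite ?inE.
  - exact: is_interval_measurable.
  - exact: measurable_itv.
  - by move=> x /IM; rewrite ler_norml /= in_itv.
by rewrite lebesgue_measure_itv/=; case: ifP => _; rewrite ?ltry.
Qed.

Lemma interval_dist_le (I : set R) (x y : R) : is_interval I -> I x -> I y ->
  (`|x - y|%:E <= mu I)%E.
Proof.
move=> iI; wlog xy : x y / x <= y => [H Ix Iy|Ix Iy].
  by have [/H|/ltW/H] := leP x y; [|rewrite distrC]; exact.
rewrite distrC ger0_norm ?subr_ge0//.
apply: (@le_trans _ _ (mu `[x, y]%classic)).
  rewrite lebesgue_measure_itv/= lte_fin; case: ltP => [_|yx]; first by rewrite EFinB.
  by rewrite lee_fin subr_le0.
apply: le_measure; rewrite ?inE.
- exact: measurable_itv.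
- exact: is_interval_measurable.
- by move=> z; rewrite /= in_itv/= => /iI; exact.
Qed.

Lemma carleson_squareE (I : set R) (L : R) : mu I = L%:E ->
  carleson_square I = `[0, L[%classic `*` (I : set T).
Proof.
move=> IL; apply/seteqP; split=> -[x y]; rewrite /carleson_square/= IL lte_fin in_itv/=.
  by move=> [Iy [-> ->]].
by move=> [/andP[-> ->] Iy].
Qed.

Lemma measurable_carleson_square (I : set R) (L : R) : is_interval I -> mu I = L%:E ->
  measurable (carleson_square I).
Proof.
move=> iI /carleson_squareE ->; apply: measurableX; first exact: measurable_itv.
exact: is_interval_measurable.
Qed.

Lemma carleson_square_measure (nut : {measure set T -> \bar R}) (I : set R) (L : R) :
  is_interval I -> mu I = L%:E ->
  ((nut \x mu) (carleson_square I) = nut `[0%R, L[%classic * L%:E)%E.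
Proof.
move=> iI IL.
have mJ : measurable (`[0, L[%classic : set T) by exact: measurable_itv.
rewrite (carleson_squareE IL).
rewrite (product_measure1E nut mu mJ (is_interval_measurable iI)).
by congr (_ * _)%E; exact: IL.
Qed.

Lemma half_strip_squareE (u s : R) : 0 < s ->
  half_strip_square u s = carleson_square `]u - s, u + s[%classic.
Proof.
move=> s0; apply/seteqP; split=> -[x y];
  rewrite /half_strip_square /carleson_square/= lebesgue_measure_itv/= lte_fin in_itv/=.
  rewrite ltr_distl => -[/andP[x0 xs] /[dup] yI ->].
  rewrite (lt_trans (andP yI).1 (andP yI).2) -EFinB lte_fin; split => //; split => //.
  by rewrite (_ : _ - _ = 2 * s)//; ring.
have us : u - s < u + s by rewrite ltrD2l gtrN.
rewrite us -EFinB lte_fin ltr_distl => -[-> [x0 xs]]; split => //.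
by rewrite x0/= (lt_le_trans xs)// le_eqVlt; apply/orP; left; apply/eqP; ring.
Qed.

End CarlesonSquares.

Section TestCarleson.
Context {R : realType}.
Local Open Scope complex_scope.
Local Notation mu := (@lebesgue_measure R).
Local Notation T := (measurableTypeR R).
Local Notation TT := (measurableTypeR R * measurableTypeR R)%type.
Local Notation pos := (`]0%R, +oo[%classic : set T).
Variables (nut : {sigma_finite_measure set T -> \bar R}) (V : R -> R) (K : R).
Hypothesis V_gt0 : forall x : R, 0 < x -> 0 < V x.
Hypothesis nutV : forall x : R, 0 < x -> nut `[0, x[%classic = (V x)%:E.
Hypothesis K_gt0 : 0 < K.
Hypothesis V_doubling : forall x : R, 0 < x -> V (2 * x) <= K * V x.
Variable n : nat.
Hypothesis Kn : 2 * K <= 2 ^+ (2 * n).+1.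

Definition test_cst : R := 2 * pi * (2 * n)`!%:R * (2 * 2 ^+ (2 * n).+1).

Lemma test_fun_energy_le_mass (l : R[i]) (L : R) : 0 < L -> L <= complex.Re l ->
  (\int[mu]_(t in pos) ((abs2 (laplace_test_fun n.+1 l t))%:E * zen_weight nut t) <=
   (test_cst * (V L / L ^+ (2 * n).+1))%:E)%E.
Proof.
move=> L0 Ll; have l0 := lt_le_trans L0 Ll.
apply: (le_trans (test_fun_energy_le nut n l0)).
rewrite [leRHS](_ : _ = (2 * pi * (2 * n)`!%:R)%:E *
    (2 * 2 ^+ (2 * n).+1 / L ^+ (2 * n).+1 * V L)%:E)%E; last first.
  by rewrite -EFinM /test_cst; congr EFin; ring.
apply: lee_wpmul2l.
  by rewrite lee_fin !mulr_ge0 ?pi_ge0.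
apply: le_trans (_ : _ <= \int[nut]_(r in `[0%R, +oo[) (((L + r) ^+ (2 * n).+1)^-1)%:E)%E _.
  have mnn : measurable (`[0%R, +oo[%classic : set T) by exact: measurable_itv.
  apply: (ge0_le_integral nut mnn _ (measurable_invr_expD _ l0)
    (measurable_invr_expD _ L0)) => r; rewrite /= in_itv/= andbT => r0.
    by rewrite lee_fin invr_ge0 exprn_ge0// addr_ge0// ltW.
  rewrite lee_fin lef_pV2 ?posrE ?exprn_gt0 ?ltr_wpDr//.
  by rewrite lerXn2r ?nnegrE ?addr_ge0 ?(ltW l0) ?(ltW L0)// lerD2r.
exact: (integral_inv_pow_le V_gt0 nutV K_gt0 V_doubling L0 Kn).
Qed.

End TestCarleson.

(** * The equivalences *)

Section Equivalence.
Context {R : realType}.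
Local Open Scope complex_scope.
Local Notation mu := (@lebesgue_measure R).
Local Notation T := (measurableTypeR R).
Local Notation TT := (measurableTypeR R * measurableTypeR R)%type.
Local Notation pos := (`]0%R, +oo[%classic : set T).
Variables (nut : {measure set T -> \bar R}) (K : R).
Local Notation V := (initial_mass nut).
Hypothesis nutN : nut (~` (`[0%R, +oo[%classic : set T)) = 0%E.
Hypothesis nut_lty : forall t : R, 0 < t -> (0 < nut `[0%R, t[%classic < +oo)%E.
Hypothesis K_gt0 : 0 < K.
Hypothesis V_doubling : forall x : R, 0 < x -> V (2 * x) <= K * V x.
Variable m : {measure set TT -> \bar R}.

Let nutS : {sigma_finite_measure set T -> \bar R} :=
  with_sigma_finite (sigma_finite_half_line nutN nut_lty).

Let V_gt0 (x : R) : 0 < x -> 0 < V x. Proof. exact: initial_mass_gt0. Qed.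
Let nutV (x : R) : 0 < x -> nutS `[0, x[%classic = (V x)%:E.
Proof. exact: initial_massE. Qed.
Let w_ge0 (t : T) : (0 <= zen_weight nut t)%E. Proof. exact: (zen_weight_ge0 nutS). Qed.

(** A test function of infinite weighted norm satisfies the inequality trivially,
    all others belong to the domain of the bounded map. *)
Lemma laplace_tested_of_bounded n :
  laplace_bounded nut m -> laplace_tested nut m n.+1.
Proof.
move=> [_ _ _ [C C0 bC]]; exists (C ^+ 2); first by rewrite exprn_gt0.
move=> l l0; set B := (\int[mu]_(t in pos) _)%E.
have [->|Boo] := eqVneq B +oo%E; first by rewrite gt0_muley ?leey// lte_fin exprn_gt0.
have fL : inL2 mu pos (zen_weight nut) (laplace_test_fun n.+1 l).
  split; first exact: cmeasurable_test_fun.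
  by apply/L2norm_lty; rewrite ltey.
have := bC _ fL; move/(L2norm_le _ _ _ _ (ltW C0) (fun _ _ => lee01) (fun t _ => w_ge0 t)).
by under eq_integral do rewrite mule1.
Qed.

(** The bound is laplace_embedding; linearity follows from the absolute convergence of
    the Laplace integral at every point of the half-plane. *)
Lemma laplace_bounded_of_carleson :
  carleson_condition (nut \x mu)%E m -> laplace_bounded nut m.
Proof.
move=> [C C0 carl].
have V_ge0 := initial_mass_ge0 nut.
have V_le (x y : R) (x0 : 0 < x) := @initial_mass_le R nut nut_lty x y.
have mV := measurable_initial_mass nut_lty.
have m_carleson (u s : R) : 0 < s ->
    (m (half_strip_square u s) <= (C * (2 * s * V (2 * s)))%:E)%E.
  move=> s0; have s20 : 0 < 2 * s by rewrite mulr_gt0.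
  have us : u - s < u + s by rewrite ltrD2l gtrN.
  have E : mu `]u - s, u + s[%classic = (2 * s)%:E.
    by rewrite lebesgue_measure_itv/= lte_fin us -EFinB; congr EFin; ring.
  have iI : is_interval (`]u - s, u + s[%classic : set R) by exact: interval_is_interval.
  have bI : bounded_set (`]u - s, u + s[%classic : set R).
    exists (`|u| + s); split=> [|M uM x]; first exact: num_real.
    rewrite /= in_itv/= -ltr_distl => xu.
    by have := ler_distD u x 0; rewrite !subr0; lra.
  rewrite half_strip_squareE//; apply: le_trans (carl _ iI bI) _.
  rewrite (carleson_square_measure nut iI E).
  have -> : nut `[0%R, (2 * s)%R[%classic = (V (2 * s))%:E by exact: nutV.
  by rewrite -!EFinM [V _ * _]mulrC.
have Lwoo f : inL2 mu pos (zen_weight nut) f ->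
    (\int[mu]_(t in pos) ((abs2 (f t))%:E * zen_weight nutS t) < +oo)%E.
  by move=> [_ /L2norm_lty].
have integrable_Lw f : inL2 mu pos (zen_weight nut) f -> forall p, half_plane p ->
    cintegrable mu pos (laplace_integrand f (cplx p)).
  by move=> Lf; exact: (weighted_laplace_integrable V_gt0 nutV Lf.1 (Lwoo _ Lf)).
set A := 4 * embedding_cst K C.
have A0 : 0 < A by rewrite mulr_gt0// embedding_cst_gt0.
have emb f : inL2 mu pos (zen_weight nut) f ->
    (L2norm m half_plane (cst 1%E) (fun p => laplace f (cplx p)) <=
     (Num.sqrt A)%:E * L2norm mu pos (zen_weight nut) f)%E.
  move=> Lf; apply/(L2norm_le _ _ _ _ (sqrtr_ge0 A) (fun _ _ => lee01) (fun t _ => w_ge0 t)).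
  rewrite sqr_sqrtr ?(ltW A0)//; under eq_integral do rewrite mule1.
  exact: (laplace_embedding mV V_gt0 V_ge0 V_le nutV K_gt0 V_doubling C0 m_carleson Lf.1 (Lwoo _ Lf)).
split => //.
- move=> f Lf; split.
    exact: (measurable_weighted_laplace V_gt0 nutV Lf.1 (Lwoo _ Lf)).
  apply: le_lt_trans (emb f Lf) _; apply: lte_mul_pinfty => //; exact: Lf.2.
- move=> a f g Lf Lg p p0; rewrite /laplace.
  have mpos : measurable pos by exact: measurable_itv.
  rewrite -(cintegral_linear mpos a (integrable_Lw f Lf p p0) (integrable_Lw g Lg p p0)).
  congr (cintegral _ _ _); apply/funext => t.
  by rewrite /laplace_integrand mulrDr mulrCA.
- by exists (Num.sqrt A); [rewrite sqrtr_gt0|].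
Qed.

(** For I of length L containing y0, the test function with parameter
    lambda = 2 (n+1) L - i y0 has on Q_I a transform of size at least a multiple of
    L^-(n+1) by Re_laplace_test_ge, while its energy is at most a multiple of
    V(L) / L^(2n+1). Chebyshev's inequality then bounds m(Q_I) by a multiple of
    L V(L). *)
Lemma carleson_of_laplace_tested n : 2 * K <= 2 ^+ (2 * n).+1 ->
  m (~` (half_plane : set TT)) = 0%E ->
  laplace_tested nut m n.+1 -> carleson_condition (nut \x mu)%E m.
Proof.
move=> Kn m0 [C C0 tC].
have mhp : measurable (half_plane : set TT) := measurable_half_plane.
pose b : R := 2 * n.+1%:R.
have b1 : 1 <= b by rewrite /b -natrM ler1n.
pose D : R := (n`!%:R / (2 * (b + 1) ^+ n.+1)) ^+ 2.
have b0 : 0 < b := lt_le_trans ltr01 b1.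
have D0 : 0 < D.
  by rewrite exprn_gt0// divr_gt0 ?ltr0n ?fact_gt0// mulr_gt0// exprn_gt0// addr_gt0.
have pi0 := pi_gt0 R.
have c0 : 0 < test_cst n :> R.
  by rewrite /test_cst !mulr_gt0 ?ltr0n ?fact_gt0// exprn_gt0.
exists (C * test_cst n / D); first by rewrite divr_gt0// mulr_gt0.
move=> I iI bI; have Ioo := bounded_lebesgue_measure_lty iI bI.
have IE : mu I = (fine (mu I))%:E by rewrite fineK// ge0_fin_numE.
set L := fine (mu I) in IE; have := mu I.
have mQ := measurable_carleson_square iI IE.
have [L0|L0] := leP L 0.
  rewrite (carleson_squareE IE) set_itv_ge ?set0X ?measure0 ?mule0//.
  by rewrite bnd_simp -leNgt.
have [I0|/set0P[y0 Iy0]] := eqVneq I set0.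
  by move: IE; rewrite I0 measure0 => -[/esym L00]; rewrite L00 ltxx in L0.
pose l : R[i] := (b * L) +i* (- y0).
have bL0 : 0 < b * L by rewrite mulr_gt0.
have LbL : L <= b * L by rewrite ler_peMl// ltW.
have energy := test_fun_energy_le_mass V_gt0 nutV K_gt0 V_doubling Kn (l := l) L0 LbL.
have mf := cmeasurable_test_fun n l pos.
have mlf := measurable_weighted_laplace V_gt0 nutV mf (le_lt_trans energy (ltry _)).
pose F (p : TT) : \bar R := (abs2 (laplace (laplace_test_fun n.+1 l) (cplx p)))%:E.
have mF : measurable_fun (half_plane : set TT) F := measurable_abs2 mlf.
have F0 p : (0 <= F p)%E by rewrite lee_fin abs2_ge0.
pose Q := carleson_square I `&` half_plane.
have mQ' : measurable Q by exact: measurableI.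
(* m gives no mass to the part of the square on the imaginary axis *)
have QE : m (carleson_square I) = m Q.
  apply/eqP; rewrite eq_le; apply/andP; split; last first.
    by apply: le_measure; rewrite ?inE//; exact: subIsetl.
  have mhpC := measurableC mhp.
  apply: (@le_trans _ _ (m (Q `|` ~` half_plane))).
    apply: le_measure; rewrite ?inE//; first exact: measurableU.
    by move=> p Qp; have [hp|hp] := pselect (half_plane p); [left|right].
  apply: (le_trans (measureU2 _ mQ' mhpC)).
  by rewrite [X in (_ + X)%E](_ : _ = 0%E) ?adde0.
have lower p : Q p -> ((D / L ^+ (2 * n.+1))%:E <= F p)%E.
  case: p => x y [] [/= Iy [_]]; rewrite IE lte_fin => xL x0.
  have yL : `|y + - y0| <= L by rewrite -lee_fin -IE; exact: interval_dist_le.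
  have s0 : 0 < x + b * L by rewrite addr_gt0.
  have sL : x + b * L <= (b + 1) * L by rewrite mulrDl mul1r addrC lerD2l ltW.
  have yb : 2 * n.+1%:R * `|y + - y0| <= x + b * L.
    by rewrite -/b (le_trans (y := b * L))// ?lerDr ?(ltW x0)// ler_pM2l.
  have := Re_laplace_test_ge bL0 x0 yb; rewrite -/l.
  set z := complex.Re _ => zge.
  rewrite /F lee_fin abs2E -/z (le_trans (y := z ^+ 2))//; last by rewrite lerDl sqr_ge0.
  have q0 : 0 <= n`!%:R / (2 * ((b + 1) * L) ^+ n.+1).
    by rewrite divr_ge0// mulr_ge0// exprn_ge0// mulr_ge0 ?(ltW L0)// addr_ge0// ltW.
  rewrite [leLHS](_ : _ = (n`!%:R / (2 * ((b + 1) * L) ^+ n.+1)) ^+ 2); last first.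
    rewrite /D [(2 * n.+1)%N]mulnC exprM [(_ * L) ^+ _]exprMn.
    have v0 : (b + 1) ^+ n.+1 != 0 by rewrite expf_neq0// gt_eqF// addr_gt0.
    have w0 : L ^+ n.+1 != 0 by rewrite expf_neq0// gt_eqF.
    by move: ((b + 1) ^+ n.+1) (L ^+ n.+1) v0 w0 => v w v0 w0; field; rewrite v0 w0.
  rewrite lerXn2r ?nnegrE//; first by rewrite (le_trans _ zge)// divr_ge0// mulr_ge0// exprn_ge0// ltW.
  apply: le_trans zge; rewrite ler_wpM2l// lef_pV2 ?posrE ?mulr_gt0 ?exprn_gt0 ?mulr_gt0 ?addr_gt0//.
  by rewrite ler_pM2l// lerXn2r ?nnegrE ?(ltW s0)// mulr_ge0 ?(ltW L0)// addr_ge0// ltW.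
have key : ((D / L ^+ (2 * n.+1))%:E * m Q <=
    C%:E * (test_cst n * (V L / L ^+ (2 * n).+1))%:E)%E.
  rewrite -(integral_cst m mQ').
  apply: (@le_trans _ _ (\int[m]_(p in Q) F p)%E).
    apply: (ge0_le_integral m mQ').
    - by move=> p _; rewrite lee_fin divr_ge0 ?(ltW D0)// exprn_ge0// ltW.
    - exact: measurable_cst.
    - by apply: (measurable_funS mhp) mF; exact: subIsetr.
    - exact: lower.
  apply: (@le_trans _ _ (\int[m]_(p in half_plane) F p)%E).
    exact: (ge0_subset_integral m mQ' mhp mF (fun p _ => F0 p) (@subIsetr _ _ _)).
  apply: (le_trans (tC l bL0)); apply: lee_wpmul2l; first by rewrite lee_fin ltW.
  exact: energy.
rewrite QE (carleson_square_measure nut iI IE).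
have -> : nut `[0%R, L[%classic = (V L)%:E by exact: nutV.
have DL0 : 0 < D / L ^+ (2 * n.+1) by rewrite divr_gt0// exprn_gt0.
rewrite -(lee_pmul2l (x := (D / L ^+ (2 * n.+1))%:E))// ?lte_fin//.
move=> _; apply: (le_trans key); rewrite -!EFinM lee_fin le_eqVlt; apply/orP; left; apply/eqP.
rewrite [(2 * n.+1)%N]mulnS [L ^+ (2 + _)]exprS [L ^+ (2 * n).+1]exprS.
by field; rewrite !gt_eqF// exprn_gt0.
Qed.

End Equivalence.

Theorem theorem2p4 (R : realType)
    (nut : {measure set (measurableTypeR R) -> \bar R})
    (nut_regular : regular_borel_on (`[0%R, +oo[%classic : set R) nut)
    (nut_doubling : doubling nut) :
  exists N0 : nat, forall N : nat, (N0 < N)%N ->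
  forall mu : {measure set (measurableTypeR R * measurableTypeR R) -> \bar R},
    regular_borel_on (half_plane : set (R * R)) mu ->
    let nu := (nut \x @lebesgue_measure R)%E in
    (laplace_bounded nut mu <-> laplace_tested nut mu N) /\
    (laplace_tested nut mu N <-> carleson_condition nu mu).
Proof.
have [nutN _] := nut_regular.
have [nut_lty [K nut_K]] := nut_doubling.
have V_doubling (x : R) : 0 < x -> initial_mass nut (2 * x) <= K * initial_mass nut x.
  by move=> x0; have := nut_K x x0; rewrite !initial_massE// mulr_gt0.
(* 0 < V 2 <= K * V 1 *)
have K_gt0 : 0 < K.
  have := V_doubling 1 ltr01; rewrite mulr1 => VK.
  rewrite -(pmulr_lgt0 _ (initial_mass_gt0 nut_lty ltr01)) (lt_le_trans _ VK)//.
  exact: initial_mass_gt0.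
exists (Num.bound K) => -[//|n] Kn m [mN _] nu.
(* K <= n < 2 ^ n *)
have Kn2 : 2 * K <= 2 ^+ (2 * n).+1.
  rewrite exprS ler_pM2l// (le_trans (y := n%:R))//.
    by rewrite (le_trans (ltW (archi_boundP (ltW K_gt0))))// ler_nat -ltnS.
  rewrite -natrX ler_nat (leq_trans (ltnW (ltn_expl n (ltnSn 1))))// leq_exp2l//.
  exact: leq_pmull.
have b2t : laplace_bounded nut m -> laplace_tested nut m n.+1.
  exact: (laplace_tested_of_bounded nutN nut_lty).
have t2c : laplace_tested nut m n.+1 -> carleson_condition nu m.
  exact: (carleson_of_laplace_tested nutN nut_lty K_gt0 V_doubling Kn2 mN).
have c2b : carleson_condition nu m -> laplace_bounded nut m.
  exact: (laplace_bounded_of_carleson nutN nut_lty K_gt0 V_doubling).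
by split; (split; first by []); [move=> /t2c/c2b | move=> /c2b/b2t].
Qed.
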